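(* There is an algorithm that, given a connected graph $G$ with $m$ edges and maximum degree $\Delta(G)$, in $O(m(\Delta(G) + \alpha(m,\Delta(G))))$ time either finds a $1$-join of $G$ or reports that $G$ has no $1$-join.
   Context: $\alpha(\cdot,\cdot)$ denotes the inverse Ackermann function; the computational model is a random access machine with logarithmic costs. A $1$-join of a graph $G$ is a partition $(V_1,V_2)$ of $V(G)$ together with sets $A_1 \subseteq V_1$, $A_2 \subseteq V_2$ such that: $A_1 \cup A_2$ is a clique; $V_1\setminus A_1$ has no neighbor in $V_2$ and $V_2 \setminus A_2$ has no neighbor in $V_1$; and $A_i \neq \emptyset$ and $V_i \setminus A_i \neq \emptyset$ for $i=1,2$.
   Formalization: Logarithmic costs are counted in words of about log n bits (rounded up per instruction), not single bits, since in bits even reading a cubic graph exceeds the bound; the bound is read as C(m(Δ+α)+1), the +1 mattering only for graphs without edges. *)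

(* Defs.v *)
From mathcomp Require Import all_boot all_order all_algebra.

Set Implicit Arguments.
Unset Strict Implicit.
Unset Printing Implicit Defensive.

Section Graph.
Variables (T : finType) (e : rel T).

Definition connected_graph : Prop := forall x y : T, connect e x y.

Definition num_edges : nat :=
  #|[set [set p.1; p.2] | p : T * T & e p.1 p.2]|.

Definition max_degree : nat := \max_(x : T) #|[set y | e x y]|.

Definition one_join (V1 V2 A1 A2 : {set T}) : Prop :=
  [/\ V1 :|: V2 = [set: T] /\ [disjoint V1 & V2],
      A1 \subset V1 /\ A2 \subset V2,
      {in A1 :|: A2 &, forall x y, x != y -> e x y},
      {in V1 :\: A1 & V2, forall x y, ~~ e x y} /\
      {in V2 :\: A2 & V1, forall x y, ~~ e x y}
    & [/\ A1 != set0, A2 != set0, V1 :\: A1 != set0 & V2 :\: A2 != set0]].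

End Graph.

(* Tarjan's variant of Ackermann's function, for i, j >= 1:
     A(1, j) = 2 ^ j,  A(i, 1) = A(i-1, 2),  A(i, j) = A(i-1, A(i, j-1)).
   The values at i = 0 or j = 0 are junk. *)
Fixpoint ack (i : nat) : nat -> nat :=
  match i with
  | i'.+1 =>
    if i' is _.+1 then
      fix ack_i (j : nat) : nat :=
        match j with
        | j'.+1 => if j' is _.+1 then ack i' (ack_i j') else ack i' 2
        | 0 => ack i' 2
        end
    else expn 2
  | 0 => expn 2
  end.

Lemma ack1E j : ack 1 j = 2 ^ j. Proof. by []. Qed.

Lemma ackS1 i : ack i.+2 1 = ack i.+1 2. Proof. by []. Qed.

Lemma ackSS i j : ack i.+2 j.+2 = ack i.+1 (ack i.+2 j.+1). Proof. by []. Qed.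

Lemma leq_ack i j : i.+1 + j <= ack i.+1 j.
Proof.
elim: i j => [|i IHi] j; first by rewrite ack1E add1n ltn_expl.
case: j => [|j]; first by apply: leq_trans (IHi 2); rewrite addn0 addn2 leqnSn.
elim: j => [|j IHj]; first by apply: leq_trans (IHi 2); rewrite addn1 addn2.
rewrite ackSS; apply: leq_trans (IHi _).
by rewrite addnS addSn ltnS; apply: leq_trans IHj _; rewrite leq_addl.
Qed.

Lemma inv_ack_ex m n : exists i, (0 < i) && (n < 2 ^ ack i (m %/ n)).
Proof.
exists n.+1; apply: leq_trans (ltn_expl n (ltnSn 1)) _.
by rewrite leq_exp2l // (leq_trans _ (leq_ack _ _)) // addSn -addnS leq_addr.
Qed.

(* Tarjan's alpha(m, n) = min { i >= 1 | A(i, floor(m / n)) > log_2 n }, for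
   m >= n >= 1; the inequality is stated after exponentiation. *)
Definition inv_ack (m n : nat) : nat := ex_minn (inv_ack_ex m n).

(* The random access machine of Aho, Hopcroft and Ullman: a fixed program,
   integer registers 0, 1, 2, ... of which 0 is the accumulator, a read-only
   input tape and a write-only output tape. *)
Inductive operand :=
  | Lit of int  (* "=i" *)
  | Reg of nat  (* "i"  *)
  | Ind of nat  (* "*i" *).

Inductive instr :=
  | LOAD of operand | STORE of operand
  | ADD of operand | SUB of operand | MULT of operand | DIV of operand
  | READ of operand | WRITE of operand
  | JUMP of nat | JGTZ of nat | JZERO of nat
  | HALT.

Definition program := seq instr.

Record config := Config {
  pc : nat;
  regs : nat -> int;
  inp : seq int;
  out : seq int }.

Definition start (input : seq int) : config := Config 0 (fun=> 0%R) input [::].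

Definition upd (r : nat -> int) (k : nat) (v : int) : nat -> int :=
  fun j => if j == k then v else r j.

(* Indirection through a negative register and writing to a literal are
   errors. *)
Definition addr (r : nat -> int) (a : operand) : option nat :=
  match a with
  | Lit _ => None
  | Reg i => Some i
  | Ind i => if r i is Posz k then Some k else None
  end.

Definition value (r : nat -> int) (a : operand) : option int :=
  if a is Lit z then Some z else omap r (addr r a).

Definition fetch (P : program) (c : config) : instr := nth HALT P (pc c).

Definition arith (op : int -> int -> int) (c : config) (a : operand) :
    option config :=
  if value (regs c) a is Some v
  then Some (Config (pc c).+1 (upd (regs c) 0 (op (regs c 0) v)) (inp c) (out c))
  else None.

Definition jump_if (b : bool) (l : nat) (c : config) : config :=
  Config (if b then l else (pc c).+1) (regs c) (inp c) (out c).

(* [None] when the machine has halted or is in error. *)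
Definition step (P : program) (c : config) : option config :=
  let r := regs c in
  match fetch P c with
  | LOAD a => arith (fun _ v => v) c a
  | ADD a => arith +%R c a
  | SUB a => arith (fun x y => x - y)%R c a
  | MULT a => arith *%R c a
  | DIV a => if value r a == Some 0%R then None else arith divz c a
  | STORE a =>
      if addr r a is Some k
      then Some (Config (pc c).+1 (upd r k (r 0)) (inp c) (out c)) else None
  | READ a =>
      match addr r a, inp c with
      | Some k, v :: s => Some (Config (pc c).+1 (upd r k v) s (out c))
      | _, _ => None
      end
  | WRITE a =>
      if value r a is Some v
      then Some (Config (pc c).+1 r (inp c) (rcons (out c) v)) else None
  | JUMP l => Some (jump_if true l c)
  | JGTZ l => Some (jump_if (0 < r 0)%R l c)
  | JZERO l => Some (jump_if (r 0 == 0%R) l c)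
  | HALT => None
  end.

(* l(z) = floor(log_2 |z|) + 1 for z <> 0, and l(0) = 1. *)
Definition bitlen (z : int) : nat := (trunc_log 2 `|z|).+1.

Definition addr_cost (r : nat -> int) (a : operand) : nat :=
  match a with
  | Lit _ => 0
  | Reg i => bitlen i
  | Ind i => bitlen i + bitlen (r i)
  end.

Definition value_cost (r : nat -> int) (a : operand) : nat :=
  match a with
  | Lit z => bitlen z
  | Reg i => bitlen i + bitlen (r i)
  | Ind i => bitlen i + bitlen (r i) + bitlen (r `|r i|%N)
  end.

(* The logarithmic cost, in bits, of the next instruction. *)
Definition log_cost (P : program) (c : config) : nat :=
  let r := regs c in
  match fetch P c with
  | LOAD a | WRITE a => value_cost r a
  | STORE a => bitlen (r 0) + addr_cost r a
  | ADD a | SUB a | MULT a | DIV a => bitlen (r 0) + value_cost r a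
  | READ a => bitlen (head 0%R (inp c)) + addr_cost r a
  | JUMP _ | HALT => 1
  | JGTZ _ | JZERO _ => bitlen (r 0)
  end.

(* The logarithmic cost in units of w-bit words, rounded up: every instruction
   costs at least 1, and one that handles numbers of k bits costs of the order
   of 1 + k / w.  For w = 1 this is [log_cost] itself.  On graphs with n
   vertices the unit is w = bitlen n, the length of a vertex name: measured in
   bits, reading the m edges alone takes time of order m log n. *)
Definition cost (w : nat) (P : program) (c : config) : nat :=
  (log_cost P c + w.-1) %/ w.

(* [run w P c t o]: from [c] the program [P] reaches a HALT instruction, at
   total cost [t], and the output tape then contains [o]. *)
Inductive run (w : nat) (P : program) : config -> nat -> seq int -> Prop :=
  | run_halt c : fetch P c = HALT -> run w P c (cost w P c) (out c)
  | run_step c c' t o :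
      step P c = Some c' -> run w P c' t o -> run w P c (cost w P c + t) o.

Section Encoding.
Variables (n : nat) (e : rel 'I_n).

(* Every edge occurs exactly once in [s], in one of its two orientations. *)
Definition edge_list (s : seq ('I_n * 'I_n)) : Prop :=
  forall x y : 'I_n, count_mem (x, y) s + count_mem (y, x) s = e x y.

Definition graph_input (s : seq ('I_n * 'I_n)) : seq int :=
  [:: Posz n, Posz (size s)
    & flatten [seq [:: Posz p.1; Posz p.2] | p : 'I_n * 'I_n <- s]].

(* For each vertex in turn, 2 * [is it in V2] + [is it in A1 or A2]. *)
Definition join_output (V1 V2 A1 A2 : {set 'I_n}) : seq int :=
  [seq Posz ((x \in V2).*2 + (x \in A1 :|: A2)) | x <- enum 'I_n].

Definition finds_one_join (o : seq int) : Prop :=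
  exists V1 V2 A1 A2 : {set 'I_n},
    one_join e V1 V2 A1 A2 /\ o = 1%R :: join_output V1 V2 A1 A2.

Definition reports_no_one_join (o : seq int) : Prop :=
  o = [:: 0%R] /\ ~ exists V1 V2 A1 A2 : {set 'I_n}, one_join e V1 V2 A1 A2.

End Encoding.

(* Main.v *)
(** Let K(xy) = N[x] :&: N[y] for an edge xy, and say that two edges are in the
    same class when they have the same K. All edges across a 1-join satisfy
    K = A1 :|: A2. Conversely, let C be such that all edges between S and its
    complement satisfy K = C, and such that each side has an edge with K <> C.
    Any z in C is on one of the sides, hence joined by a crossing edge to an end
    of any crossing edge on the other side; so z is an end of an edge with
    K = C, which makes z adjacent to all of C. Thus C is automatically a clique
    and the two sides form a 1-join.

    Classes are found by inserting the sets K(xy) in a trie, for all edges in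
    parallel: for each vertex z and all x, y in N[z] with xy an edge, the edge
    xy moves to its z-child. This takes time of the order of the sum of the
    squared degrees, which is O(m Delta). A class that separates the graph is an
    articulation point of the bipartite graph of vertices and classes, which has
    O(m) edges and is searched in depth-first order. The search starts at a
    vertex that meets two classes, so that the side of the root always has an
    edge outside the class; a child v of a class node F is the root of the other
    side when low(v) >= pre(F) and v meets two classes.

    The total time is O(m Delta + 1). *)
Require Import Defs.
From mathcomp Require Import all_boot all_order all_algebra.
From mathcomp Require Import zify.

Set Implicit Arguments.
Unset Strict Implicit.
Unset Printing Implicit Defensive.
Import Order.TTheory GRing.Theory Num.Theory.

(** * A While language compiled to the random access machine *)

Inductive expr :=
  | Num of nat
  | Var of nat
  | Arr of nat & expr
  | Plus of expr & expr
  | Times of expr & expr.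

Inductive cond := Lt of expr & expr | Eq of expr & expr.

Inductive cmd :=
  | Skip
  | Assign of nat & expr
  | Put of nat & expr & expr
  | Read of nat
  | Write of expr
  | Seq of cmd & cmd
  | If of cond & cmd & cmd
  | While of cond & cmd.

Record state := State {
  sv : nat -> nat;
  av : nat -> nat -> nat;
  si : seq int;
  so : seq int }.

Definition set_fun (T : Type) (f : nat -> T) (x : nat) (v : T) : nat -> T :=
  fun y => if y == x then v else f y.

(* Same as set_fun, for literal arguments: simpl decides the comparison. *)
Definition set_key (T : Type) (f : nat -> T) (x : nat) (v : T) : nat -> T :=
  fun y => if y == x then v else f y.
Arguments set_key T f x v y /.

Definition set_var s x v := State (set_key (sv s) x v) (av s) (si s) (so s).
Definition set_arr s k i v :=
  State (sv s) (set_key (av s) k (set_fun (av s k) i v)) (si s) (so s).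
Arguments set_var s x v /.
Arguments set_arr s k i v /.

Fixpoint eval (s : state) (e : expr) : nat :=
  match e with
  | Num c => c
  | Var x => sv s x
  | Arr k e => av s k (eval s e)
  | Plus a b => eval s a + eval s b
  | Times a b => eval s a * eval s b
  end.

Definition ceval (s : state) (b : cond) : bool :=
  match b with
  | Lt a b => eval s a < eval s b
  | Eq a b => eval s a == eval s b
  end.

Inductive exec (B : nat) : cmd -> state -> nat -> state -> Prop :=
  | ESkip s : exec B Skip s 0 s
  | EAssign s x e : eval s e < B -> exec B (Assign x e) s 1 (set_var s x (eval s e))
  | EPut s k i e : eval s e < B ->
      exec B (Put k i e) s 1 (set_arr s k (eval s i) (eval s e))
  | ERead s x v l : si s = Posz v :: l -> v < B ->
      exec B (Read x) s 1 (State (set_key (sv s) x v) (av s) l (so s))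
  | EWrite s e :
      exec B (Write e) s 1
        (State (sv s) (av s) (si s) (rcons (so s) (Posz (eval s e))))
  | ESeq c1 c2 s1 s2 s3 t1 t2 : exec B c1 s1 t1 s2 -> exec B c2 s2 t2 s3 ->
      exec B (Seq c1 c2) s1 (t1 + t2) s3
  | EIf b c1 c2 s s' t : exec B (if ceval s b then c1 else c2) s t s' ->
      exec B (If b c1 c2) s t.+1 s'
  | EWhileF b c s : ceval s b = false -> exec B (While b c) s 1 s
  | EWhileT b c s s' s'' t t' : ceval s b -> exec B c s t s' ->
      exec B (While b c) s' t' s'' -> exec B (While b c) s (t + t').+1 s''.

(* Memory layout: variable x lives in register x + 1, temporaries in registers
   32 to 63, and cell i of array k in register 64 * (i + 1) + k. *)
Fixpoint cexpr (e : expr) (d : nat) : program :=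
  match e with
  | Num c => [:: LOAD (Lit (Posz c))]
  | Var x => [:: LOAD (Reg x.+1)]
  | Arr k e => cexpr e d ++ [:: MULT (Lit (Posz 64)); ADD (Lit (Posz (64 + k)));
                             STORE (Reg (32 + d)); LOAD (Ind (32 + d))]
  | Plus a b => cexpr a d ++ STORE (Reg (32 + d)) ::
                cexpr b d.+1 ++ [:: ADD (Reg (32 + d))]
  | Times a b => cexpr a d ++ STORE (Reg (32 + d)) ::
                 cexpr b d.+1 ++ [:: MULT (Reg (32 + d))]
  end.

Definition cdiff (a b : expr) : program :=
  cexpr a 0 ++ STORE (Reg 32) :: cexpr b 1 ++ [:: SUB (Reg 32)].

Definition ccond (b : cond) (l : nat) : program :=
  match b with
  | Lt a b => rcons (cdiff a b) (JGTZ l)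
  | Eq a b => rcons (cdiff a b) (JZERO l)
  end.

Fixpoint ccmd (c : cmd) (pc : nat) : program :=
  match c with
  | Skip => [::]
  | Assign x e => cexpr e 0 ++ [:: STORE (Reg x.+1)]
  | Put k i e => cexpr i 0 ++ [:: MULT (Lit (Posz 64)); ADD (Lit (Posz (64 + k)));
      STORE (Reg 32)] ++ cexpr e 1 ++ [:: STORE (Ind 32)]
  | Read x => [:: READ (Reg x.+1)]
  | Write e => cexpr e 0 ++ [:: WRITE (Reg 0)]
  | Seq c1 c2 => let p1 := ccmd c1 pc in p1 ++ ccmd c2 (pc + size p1)
  | If b c1 c2 =>
      let k := size (ccond b 0) in
      let p2 := ccmd c2 (pc + k) in
      let l := pc + k + (size p2).+1 in
      let p1 := ccmd c1 l in
      ccond b l ++ p2 ++ JUMP (l + size p1) :: p1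
  | While b c =>
      let k := size (ccond b 0) in
      let p := ccmd c (pc + k.+1) in
      ccond b (pc + k.+1) ++ JUMP (pc + k.+1 + (size p).+1) :: p ++ [:: JUMP pc]
  end.

Fixpoint wf_expr (e : expr) (d : nat) : bool :=
  match e with
  | Num c => true
  | Var x => x < 31
  | Arr k e => [&& k < 64, d < 32 & wf_expr e d]
  | Plus a b | Times a b => [&& d < 32, wf_expr a d & wf_expr b d.+1]
  end.

Definition wf_cond (b : cond) : bool :=
  match b with Lt a b | Eq a b => wf_expr a 0 && wf_expr b 1 end.

Fixpoint wf_cmd (c : cmd) : bool :=
  match c with
  | Skip => true
  | Assign x e => (x < 31) && wf_expr e 0
  | Put k i e => [&& k < 64, wf_expr i 0 & wf_expr e 1]
  | Read x => x < 31
  | Write e => wf_expr e 0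
  | Seq c1 c2 => wf_cmd c1 && wf_cmd c2
  | If b c1 c2 => [&& wf_cond b, wf_cmd c1 & wf_cmd c2]
  | While b c => wf_cond b && wf_cmd c
  end.

(* When variables and array cells are below 2 ^ (a * w), with w > 0, all numbers
   occurring in the evaluation of e are below 2 ^ (deg a e * w). *)
Fixpoint deg (a : nat) (e : expr) : nat :=
  match e with
  | Num c => c.+1
  | Var x => a
  | Arr k e => maxn (deg a e + 7) a
  | Plus e1 e2 => (maxn (deg a e1) (deg a e2)).+1
  | Times e1 e2 => deg a e1 + deg a e2
  end.

Definition cond_deg (a : nat) (b : cond) : nat :=
  match b with Lt e1 e2 | Eq e1 e2 => maxn (deg a e1) (deg a e2) end.

Fixpoint cmd_deg (a : nat) (c : cmd) : nat :=
  match c with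
  | Skip | Read _ => a
  | Assign _ e | Write e => deg a e
  | Put k i e => maxn (deg a i + 7) (deg a e)
  | Seq c1 c2 => maxn (cmd_deg a c1) (cmd_deg a c2)
  | If b c1 c2 => maxn (cond_deg a b) (maxn (cmd_deg a c1) (cmd_deg a c2))
  | While b c => maxn (cond_deg a b) (cmd_deg a c)
  end.

Definition code_at (P : program) (pc : nat) (l : program) : Prop :=
  forall i, i < size l -> nth HALT P (pc + i) = nth HALT l i.

Lemma code_at_cat P pc l1 l2 : code_at P pc (l1 ++ l2) ->
  code_at P pc l1 /\ code_at P (pc + size l1) l2.
Proof.
move=> H; split=> i Hi.
  by rewrite H ?size_cat ?ltn_addr // nth_cat Hi.
by rewrite -addnA H ?size_cat ?ltn_add2l // nth_cat ltnNge leq_addr addKn.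
Qed.

Lemma code_at_cons P pc x l : code_at P pc (x :: l) ->
  nth HALT P pc = x /\ code_at P pc.+1 l.
Proof.
move=> H; split; first by rewrite -(addn0 pc) H.
by move=> i Hi; rewrite addSnnS H.
Qed.

Inductive steps (L : nat) (P : program) : config -> nat -> config -> Prop :=
  | steps0 c : steps L P c 0 c
  | stepsS c c' c'' k : step P c = Some c' -> log_cost P c <= L ->
      steps L P c' k c'' -> steps L P c k.+1 c''.

Lemma steps_trans L P c1 c2 c3 k1 k2 :
  steps L P c1 k1 c2 -> steps L P c2 k2 c3 -> steps L P c1 (k1 + k2) c3.
Proof.
move=> H; elim: H k2 => [c|c c' c'' k h1 h2 h3 IH] k2 H2; first by rewrite add0n.
by rewrite addSn; apply: (stepsS h1 h2); apply: IH.
Qed.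

Lemma steps1 L P c c' : step P c = Some c' -> log_cost P c <= L -> steps L P c 1 c'.
Proof. by move=> h1 h2; apply: (stepsS h1 h2); apply: steps0. Qed.

Section Compile.
Variables (P : program) (w a q : nat).
Hypotheses (w_gt0 : 0 < w) (q_ge7 : 7 <= q) (a_leq : a <= q).
Local Notation b := (q * w).

Lemma bitlen_fits (z : int) : `|z|%N < 2 ^ b -> bitlen z <= b.
Proof.
rewrite /bitlen; case: (posnP `|z|%N) => [-> _|zp zlt].
  by rewrite trunc_log0; lia.
have /andP[h _] := trunc_log_bounds (isT : 1 < 2) zp.
by rewrite -(ltn_exp2l _ _ (isT : 1 < 2)); apply: leq_ltn_trans h zlt.
Qed.

Lemma fits_small c : c < 128 -> c < 2 ^ b.
Proof.
move=> h; apply: leq_trans h _; apply: (@leq_trans (2 ^ 7)) => //.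
by rewrite leq_exp2l //; nia.
Qed.

Definition related (s : state) (r : nat -> int) : Prop :=
  (forall x, x < 31 -> r x.+1 = Posz (sv s x)) /\
  (forall k i, k < 64 -> r (64 * i.+1 + k) = Posz (av s k i)).

Definition state_lt (B : nat) (s : state) : Prop :=
  (forall x, sv s x < B) /\ (forall k i, av s k i < B).

Lemma leq_pexp m m' : m <= m' -> 2 ^ (m * w) <= 2 ^ (m' * w).
Proof. by move=> h; rewrite leq_exp2l // leq_mul2r h orbT. Qed.

Lemma deg_eval s e : state_lt (2 ^ (a * w)) s -> eval s e < 2 ^ (deg a e * w).
Proof.
case=> hv ha; elim: e => [c|x|k e IH|e1 IH1 e2 IH2|e1 IH1 e2 IH2] //=.
- have h : c < 2 ^ c.+1 by apply: ltn_trans (ltnSn c) _; apply: ltn_expl.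
  by apply: leq_trans h _; rewrite leq_exp2l // leq_pmulr.
- by apply: leq_trans (ha _ _) _; apply: leq_pexp; rewrite leq_maxr.
- set d := maxn _ _.
  have h1 : eval s e1 < 2 ^ (d * w).
    by apply: leq_trans IH1 (leq_pexp _); rewrite leq_maxl.
  have h2 : eval s e2 < 2 ^ (d * w).
    by apply: leq_trans IH2 (leq_pexp _); rewrite leq_maxr.
  apply: (@leq_trans (2 ^ (d * w).+1)); first by rewrite expnS; lia.
  by rewrite leq_exp2l //; nia.
- rewrite mulnDl expnD; move: IH1 IH2.
  set u := 2 ^ _; set v := 2 ^ _; move=> h1 h2.
  by apply: (@leq_ltn_trans (u.-1 * v.-1)); [apply: leq_mul; lia | nia].
Qed.

Lemma address_fits i k d : i < 2 ^ (d * w) -> k < 64 -> d + 7 <= q ->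
  64 * i.+1 + k < 2 ^ b.
Proof.
move=> hi hk hq.
apply: (@leq_trans (2 ^ ((d + 7) * w))); last exact: leq_pexp.
apply: (@leq_trans (2 ^ (d * w + 7))); last first.
  by rewrite leq_exp2l // mulnDl leq_add2l leq_pmulr.
by rewrite expnD; move: hi; set u := 2 ^ _; rewrite (_ : 2 ^ 7 = 128) //; lia.
Qed.

Lemma bl_small c : c < 128 -> bitlen (Posz c) <= b.
Proof. by move=> h; apply: bitlen_fits; apply: fits_small. Qed.

Lemma fits_add_addr i k d : i < 2 ^ (d * w) -> k < 64 -> d + 7 <= q ->
  [/\ bitlen (Posz i) <= b, bitlen (Posz (i * 64)) <= b
    & bitlen (Posz (i * 64 + (64 + k))) <= b].
Proof.
move=> hi hk hq; have h := address_fits hi hk hq.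
by split; apply: bitlen_fits => /=; apply: leq_ltn_trans h; lia.
Qed.

Lemma related_frame s r r' d : related s r ->
  (forall j, 0 < j -> (j < 32 + d) || (64 <= j) -> r' j = r j) -> related s r'.
Proof.
move=> [h1 h2] H; split=> [x hx|k i hk]; first by rewrite H ?h1 //; lia.
by rewrite H ?h2 //; lia.
Qed.

Lemma cexpr_correct e d pc r s ip op :
  related s r -> state_lt (2 ^ (a * w)) s -> wf_expr e d -> deg a e <= q ->
  code_at P pc (cexpr e d) ->
  exists r', [/\ steps (4 * b) P (Config pc r ip op) (size (cexpr e d))
                   (Config (pc + size (cexpr e d)) r' ip op),
                 r' 0 = Posz (eval s e)
               & forall j, 0 < j -> (j < 32 + d) || (64 <= j) -> r' j = r j].
Proof.
move=> Hr Hs; have Hdeg e' : deg a e' <= q -> bitlen (Posz (eval s e')) <= b.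
  move=> h; apply: bitlen_fits => //=.
  by apply: leq_trans (deg_eval _ Hs) _; apply: leq_pexp.
elim: e d pc r Hr => [c|x|k e IH|e1 IH1 e2 IH2|e1 IH1 e2 IH2] d pc r Hr /= Hwf Hq.
- move=> /code_at_cons[Hc _]; exists (upd r 0 (Posz c)); split=> //; last first.
    by move=> [].
  apply: steps1; rewrite ?/log_cost /step /fetch /= Hc /= ?addn1 //.
  by have := Hdeg (Num c) Hq; rewrite /=; lia.
- move=> /code_at_cons[Hc _]; exists (upd r 0 (r x.+1)); split=> //; last first.
  + by move=> [].
  + by rewrite /upd /=; case: Hr => ->.
  apply: steps1; rewrite ?/log_cost /step /fetch /= Hc /= ?addn1 //.
  have := Hdeg (Var x) Hq; case: (Hr) => -> //= _.
  by have : bitlen (Posz x.+1) <= b by [apply: bl_small => //; lia]; lia.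
- move: Hwf => /and3P[hk hd Hwf] /code_at_cat[He].
  have /= hq : deg a e <= q by lia.
  move=> /code_at_cons[Hc1 /code_at_cons[Hc2 /code_at_cons[Hc3 /code_at_cons[Hc4 _]]]].
  have [r1 [Hs1 Hv1 Hf1]] := IH d pc r Hr Hwf hq He.
  have hadd : 64 * (eval s e).+1 + k < 2 ^ b.
    by apply: address_fits (deg_eval _ Hs) hk _ => //; lia.
  have [B1 B2 B3] : [/\ bitlen (Posz (eval s e)) <= b,
      bitlen (Posz (eval s e * 64)) <= b
    & bitlen (Posz (eval s e * 64 + (64 + k))) <= b].
    by apply: fits_add_addr (deg_eval _ Hs) hk _ => //; lia.
  have Bc : forall c, c < 128 -> bitlen (Posz c) <= b by move=> c; apply: bl_small.
  have [A defA] : exists A, A = (64 * (eval s e).+1 + k) by eexists.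
  have EA : (Posz (eval s e) * Posz 64 + Posz (64 + k))%R = Posz A by rewrite defA; lia.
  have Hrd : r1 A = Posz (av s k (eval s e)).
    by have [_ h] := related_frame Hr Hf1; rewrite defA h.
  set r2 := upd (upd (upd r1 0 (Posz (eval s e) * Posz 64)%R) 0 (Posz A)) (32 + d) (Posz A).
  have E64 : 32 + d == A = false by rewrite defA; lia.
  exists (upd r2 0 (r2 A)); split; last first.
  + move=> [//|j] _ hj; rewrite /upd /= -Hf1 // /r2 /upd /=.
    by rewrite (_ : j.+1 == 32 + d = false) //; lia.
  + rewrite {1}/upd eqxx /r2 /upd eq_sym E64 (_ : A == 0 = false) ?Hrd //.
    by rewrite defA; lia.
  rewrite size_cat; apply: steps_trans Hs1 _ => /=.
  apply: (@stepsS _ _ _ (Config (pc + size (cexpr e d)).+1 (upd r1 0 (Posz (eval s e) * Posz 64)%R) ip op)).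
  + by rewrite /step /fetch /= Hc1 /arith /= Hv1.
  + rewrite /log_cost /fetch /= Hc1 /= Hv1.
    by have := Bc 64 isT; lia.
  apply: (@stepsS _ _ _ (Config (pc + size (cexpr e d)).+2 (upd (upd r1 0 (Posz (eval s e) * Posz 64)%R) 0 (Posz A)) ip op)).
  + by rewrite /step /fetch /= Hc2 /arith /= {2}/upd /= EA.
  + rewrite /log_cost /fetch /= Hc2 /= {1}/upd /=.
    by have := Bc (64 + k); move: B2; rewrite -PoszM; lia.
  apply: (@stepsS _ _ _ (Config (pc + size (cexpr e d)).+3 r2 ip op)).
  + by rewrite /step /fetch /= Hc3 /= /r2.
  + rewrite /log_cost /fetch /= Hc3 /= {1}/upd /=.
    have := Bc (32 + d); move: B3; rewrite (_ : _ + (64 + k) = A); first lia.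
    by rewrite defA; lia.
  rewrite addnA addn4; apply: steps1.
  + have H32 : r2 (32 + d) = Posz A by rewrite /r2 /upd eqxx.
    by rewrite /step /fetch /= Hc4 /arith; cbn -[addn r2]; rewrite H32.
  + rewrite /log_cost /fetch /= Hc4; cbn -[addn r2 bitlen].
    have -> : r2 (32 + d) = Posz A by rewrite /r2 /upd eqxx.
    have -> : r2 `|Posz A|%N = Posz (av s k (eval s e)).
      by rewrite /r2 /upd /= eq_sym E64 (_ : A == 0 = false) ?Hrd //; rewrite defA; lia.
    have := Bc (32 + d); move: B3; rewrite (_ : _ + (64 + k) = A); last by rewrite defA; lia.
    have : bitlen (Posz (av s k (eval s e))) <= b.
      apply: bitlen_fits => //=; apply: leq_trans (Hs.2 _ _) _; apply: leq_pexp; lia.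
    lia.
- move: Hwf => /and3P[hd Hwf1 Hwf2] /code_at_cat[He1 /code_at_cons[Hc1 /code_at_cat[He2 /code_at_cons[Hc2 _]]]].
  have /= [hq1 hq2] : deg a e1 <= q /\ deg a e2 <= q by lia.
  have [r1 [Hs1 Hv1 Hf1]] := IH1 d pc r Hr Hwf1 hq1 He1.
  have Bd : bitlen (Posz (32 + d)) <= b by apply: bl_small => //; lia.
  have B1 := Hdeg _ hq1; have B2 := Hdeg _ hq2.
  set r2 := upd r1 (32 + d) (Posz (eval s e1)).
  have Hf2 j : 0 < j -> (j < 32 + d) || (64 <= j) -> r2 j = r1 j.
    by move=> _ hj; rewrite /r2 /upd ifF //; lia.
  have [r3 [Hs3 Hv3 Hf3]] := IH2 d.+1 _ r2 (related_frame (related_frame Hr Hf1) Hf2) Hwf2 hq2 He2.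
  have Ht : r3 (32 + d) = Posz (eval s e1).
    by rewrite Hf3 ?addn_gt0 // ?addnS ?ltnSn // /r2 /upd eqxx.
  exists (upd r3 0 (Posz (eval s e1 + eval s e2))); split=> //; last first.
    by move=> [//|j] _ hj; rewrite -Hf1 // -Hf2 // -Hf3 //; lia.
  rewrite size_cat; apply: steps_trans Hs1 _ => /=.
  apply: (@stepsS _ _ _ (Config (pc + size (cexpr e1 d)).+1 r2 ip op)).
  + by rewrite /step /fetch /= Hc1 /= Hv1.
  + by rewrite /log_cost /fetch /= Hc1 /= Hv1; lia.
  rewrite size_cat; apply: steps_trans Hs3 _ => /=.
  apply: steps1.
  + rewrite /step /fetch /= Hc2 /arith /= Ht Hv3 -PoszD (addnC (eval s e2)); congr (Some (Config _ _ _ _)); lia.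
  + by rewrite /log_cost /fetch /= Hc2 /= Ht Hv3; lia.
- move: Hwf => /and3P[hd Hwf1 Hwf2] /code_at_cat[He1 /code_at_cons[Hc1 /code_at_cat[He2 /code_at_cons[Hc2 _]]]].
  have /= [hq1 hq2] : deg a e1 <= q /\ deg a e2 <= q by lia.
  have [r1 [Hs1 Hv1 Hf1]] := IH1 d pc r Hr Hwf1 hq1 He1.
  have Bd : bitlen (Posz (32 + d)) <= b by apply: bl_small => //; lia.
  have B1 := Hdeg _ hq1; have B2 := Hdeg _ hq2.
  set r2 := upd r1 (32 + d) (Posz (eval s e1)).
  have Hf2 j : 0 < j -> (j < 32 + d) || (64 <= j) -> r2 j = r1 j.
    by move=> _ hj; rewrite /r2 /upd ifF //; lia.
  have [r3 [Hs3 Hv3 Hf3]] := IH2 d.+1 _ r2 (related_frame (related_frame Hr Hf1) Hf2) Hwf2 hq2 He2.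
  have Ht : r3 (32 + d) = Posz (eval s e1).
    by rewrite Hf3 ?addn_gt0 // ?addnS ?ltnSn // /r2 /upd eqxx.
  exists (upd r3 0 (Posz (eval s e1 * eval s e2))); split=> //; last first.
    by move=> [//|j] _ hj; rewrite -Hf1 // -Hf2 // -Hf3 //; lia.
  rewrite size_cat; apply: steps_trans Hs1 _ => /=.
  apply: (@stepsS _ _ _ (Config (pc + size (cexpr e1 d)).+1 r2 ip op)).
  + by rewrite /step /fetch /= Hc1 /= Hv1.
  + by rewrite /log_cost /fetch /= Hc1 /= Hv1; lia.
  rewrite size_cat; apply: steps_trans Hs3 _ => /=.
  apply: steps1.
  + rewrite /step /fetch /= Hc2 /arith /= Ht Hv3 -PoszM (mulnC (eval s e2)); congr (Some (Config _ _ _ _)); lia.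
  + by rewrite /log_cost /fetch /= Hc2 /= Ht Hv3; lia.
Qed.

Lemma size_ccond c l l' : size (ccond c l) = size (ccond c l').
Proof. by case: c => e1 e2; rewrite !size_rcons. Qed.

Lemma cdiff_correct e1 e2 pc r s ip op :
  related s r -> state_lt (2 ^ (a * w)) s -> wf_expr e1 0 && wf_expr e2 1 ->
  maxn (deg a e1) (deg a e2) <= q -> code_at P pc (cdiff e1 e2) ->
  exists r', [/\ steps (4 * b) P (Config pc r ip op) (size (cdiff e1 e2))
                   (Config (pc + size (cdiff e1 e2)) r' ip op),
                 r' 0 = (Posz (eval s e2) - Posz (eval s e1))%R,
                 bitlen (r' 0) <= b & related s r'].
Proof.
move=> Hr Hs /andP[Hwf1 Hwf2] Hq.
have [hq1 hq2] : deg a e1 <= q /\ deg a e2 <= q by lia.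
have F1 : eval s e1 < 2 ^ b by apply: leq_trans (deg_eval _ Hs) (leq_pexp hq1).
have F2 : eval s e2 < 2 ^ b by apply: leq_trans (deg_eval _ Hs) (leq_pexp hq2).
have B1 : bitlen (Posz (eval s e1)) <= b by apply: bitlen_fits.
have B2 : bitlen (Posz (eval s e2)) <= b by apply: bitlen_fits.
have B3 : bitlen (Posz (eval s e2) - Posz (eval s e1))%R <= b by apply: bitlen_fits; lia.
have Bd : bitlen (Posz 32) <= b by apply: bl_small.
move=> /code_at_cat[He1 /code_at_cons[Hc1 /code_at_cat[He2 /code_at_cons[Hc2 _]]]].
have [r1 [Hs1 Hv1 Hf1]] := cexpr_correct ip op Hr Hs Hwf1 hq1 He1.
set r2 := upd r1 32 (Posz (eval s e1)).
have Hf2 j : 0 < j -> (j < 32 + 0) || (64 <= j) -> r2 j = r1 j.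
  by move=> _ hj; rewrite /r2 /upd ifF //; lia.
have Hr2 := related_frame (related_frame Hr Hf1) Hf2.
have [r3 [Hs3 Hv3 Hf3]] := cexpr_correct ip op Hr2 Hs Hwf2 hq2 He2.
have Ht : r3 32 = Posz (eval s e1) by rewrite Hf3.
set D := (Posz (eval s e2) - Posz (eval s e1))%R in B3 *.
exists (upd r3 0 D); split; rewrite ?[upd r3 0 D 0]/D //; last first.
  by apply: (related_frame (d := 0) (related_frame Hr2 Hf3)) => -[].
rewrite /cdiff size_cat; apply: steps_trans Hs1 _ => /=.
apply: (@stepsS _ _ _ (Config (pc + size (cexpr e1 0)).+1 r2 ip op)).
+ by rewrite /step /fetch /= Hc1 /= Hv1.
+ by rewrite /log_cost /fetch /= Hc1 /= Hv1; lia.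
rewrite size_cat; apply: steps_trans Hs3 _ => /=.
apply: steps1.
+ by rewrite /step /fetch /= Hc2 /arith /= Ht Hv3 -/D; congr (Some (Config _ _ _ _)); lia.
+ by rewrite /log_cost /fetch /= Hc2 /= Ht Hv3; lia.
Qed.

Lemma ccond_correct c l pc r s ip op :
  related s r -> state_lt (2 ^ (a * w)) s -> wf_cond c -> cond_deg a c <= q ->
  code_at P pc (ccond c l) ->
  exists r', steps (4 * b) P (Config pc r ip op) (size (ccond c l))
               (Config (if ceval s c then l else pc + size (ccond c l)) r' ip op) /\
             related s r'.
Proof.
move=> Hr Hs; case: c => e1 e2 /= Hwf Hq; rewrite -cats1 => /code_at_cat[Hd /code_at_cons[Hc _]];
  have [r' [Hst Hv Hb Hr']] := cdiff_correct ip op Hr Hs Hwf Hq Hd;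
  exists r'; split=> //; rewrite size_cat; apply: steps_trans Hst _ => /=;
  apply: steps1; rewrite /step /log_cost /fetch /= Hc /jump_if /= ?Hv.
- by rewrite subr_gt0 ltz_nat addn1 addnS.
- by rewrite -Hv; lia.
- by rewrite subr_eq0 eqz_nat eq_sym addn1 addnS.
- by rewrite -Hv; lia.
Qed.

Lemma related_set_var s r x v : x < 31 -> related s r ->
  related (set_var s x v) (upd r x.+1 (Posz v)).
Proof.
move=> hx [h1 h2]; split=> [y hy|k i hk]; rewrite /upd /= /set_fun.
  by rewrite eqSS; case: eqP => // _; apply: h1.
by rewrite ifF ?h2 //; lia.
Qed.

Lemma related_set_arr s r k i v : k < 64 -> related s r ->
  related (set_arr s k i v) (upd r (64 * i.+1 + k) (Posz v)).
Proof.
move=> hk [h1 h2]; split=> [y hy|k' i' hk']; rewrite /upd /= /set_fun.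
  by rewrite ifF ?h1 //; lia.
case: (eqVneq k' k) => [->|nk].
  case: (eqVneq i' i) => [->|ni]; first by rewrite eqxx.
  by rewrite ifF ?h2 //; lia.
rewrite ifF ?h2 //; apply/eqP => h; move/eqP: nk; apply.
have : k' = (64 * i'.+1 + k') %% 64 by rewrite mulnC modnMDl modn_small.
by rewrite h mulnC modnMDl modn_small.
Qed.

Lemma state_lt_set_var B s x v : v < B -> state_lt B s -> state_lt B (set_var s x v).
Proof. by move=> hv [h1 h2]; split=> //= y; case: ifP. Qed.

Lemma state_lt_set_arr B s k i v : v < B -> state_lt B s -> state_lt B (set_arr s k i v).
Proof.
move=> hv [h1 h2]; split=> //= k' i'.
by rewrite /set_fun /set_key; case: ifP => // _; case: ifP.
Qed.

Lemma ccmd_correct K c s t s' : exec (2 ^ (a * w)) c s t s' ->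
  wf_cmd c -> cmd_deg a c <= q -> forall pc r,
  related s r -> state_lt (2 ^ (a * w)) s -> code_at P pc (ccmd c pc) ->
  size (ccmd c pc) <= K ->
  exists r' k, [/\ steps (4 * b) P (Config pc r (si s) (so s)) k
                     (Config (pc + size (ccmd c pc)) r' (si s') (so s')),
                   related s' r', state_lt (2 ^ (a * w)) s' & k <= K * t].
Proof.
elim=> {c s t s'} [s|s x e ve|s k i e ve|s x v l Es vv|s e|c1 c2 s1 s2 s3 t1 t2 _ IH1 _ IH2|c c1 c2 s s' t _ IH|c c1 s Ec|c c1 s s' s'' t t' Ec _ IH1 _ IH2].
- move=> _ _ pc r Hr Hs _ _; exists r, 0; split=> //.
  by rewrite addn0; apply: steps0.
- move=> /= /andP[Hx Hwf] Hq pc r Hr Hs /code_at_cat[He /code_at_cons[Hc _]] HK.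
  have [r1 [Hs1 Hv1 Hf1]] := cexpr_correct (si s) (so s) Hr Hs Hwf Hq He.
  exists (upd r1 x.+1 (Posz (eval s e))), (size (cexpr e 0) + 1); split.
  + apply: steps_trans Hs1 _; apply: steps1; rewrite /step /log_cost /fetch /= Hc /=.
      by rewrite Hv1 size_cat /= addnA addn1.
    have B1 : bitlen (Posz x.+1) <= b by apply: bl_small; lia.
    have : bitlen (r1 0) <= b.
      by rewrite Hv1; apply: bitlen_fits; apply: leq_trans (deg_eval _ Hs) (leq_pexp Hq).
    lia.
  + exact/related_set_var/(related_frame Hr Hf1).
  + exact: state_lt_set_var.
  + by move: HK; rewrite size_cat /=; lia.
- move=> /= /and3P[Hk Hwf1 Hwf2] Hq pc r Hr Hs /code_at_cat[He1].
  move=> /code_at_cons[Hc1 /code_at_cons[Hc2 /code_at_cons[Hc3 /code_at_cat[He2 /code_at_cons[Hc4 _]]]]] HK.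
  have [hq1 hq2] : deg a i + 7 <= q /\ deg a e <= q by lia.
  have hq1' : deg a i <= q by lia.
  have [r1 [Hs1 Hv1 Hf1]] := cexpr_correct (si s) (so s) Hr Hs Hwf1 hq1' He1.
  have [B1 B2 B3] := fits_add_addr (deg_eval i Hs) Hk hq1.
  have Bc : forall c, c < 128 -> bitlen (Posz c) <= b by move=> c; apply: bl_small.
  have [A defA] : exists A, A = 64 * (eval s i).+1 + k by eexists.
  have EA : (Posz (eval s i) * Posz 64 + Posz (64 + k))%R = Posz A by rewrite defA; lia.
  set ra := upd r1 0 (Posz (eval s i) * Posz 64)%R.
  set rb := upd ra 0 (Posz A).
  set r2 := upd rb 32 (Posz A).
  have Hf2 j : 0 < j -> (j < 32 + 0) || (64 <= j) -> r2 j = r1 j.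
    move=> hj0 hj; rewrite /r2 /rb /ra /upd ifF; last by lia.
    by rewrite (_ : j == 0 = false) //; lia.
  have Hr2 := related_frame (related_frame Hr Hf1) Hf2.
  have [r3 [Hs3 Hv3 Hf3]] := cexpr_correct (si s) (so s) Hr2 Hs Hwf2 hq2 He2.
  have Ht : r3 32 = Posz A by rewrite Hf3.
  exists (upd r3 A (Posz (eval s e))), (size (cexpr i 0) + (size (cexpr e 1) + 1).+3); split.
  + apply: steps_trans Hs1 _.
    apply: (@stepsS _ _ _ (Config (pc + size (cexpr i 0)).+1 ra (si s) (so s))).
    * by rewrite /step /fetch /= Hc1 /arith /= Hv1.
    * by rewrite /log_cost /fetch /= Hc1 /= Hv1; have := Bc 64 isT; lia.
    apply: (@stepsS _ _ _ (Config (pc + size (cexpr i 0)).+2 rb (si s) (so s))).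
    * by rewrite /step /fetch /= Hc2 /arith /= {2}/ra /upd /= EA.
    * rewrite /log_cost /fetch /= Hc2 /= (_ : ra 0 = (Posz (eval s i) * Posz 64)%R) //.
      by have := Bc (64 + k); move: B2; rewrite -PoszM; lia.
    apply: (@stepsS _ _ _ (Config (pc + size (cexpr i 0)).+3 r2 (si s) (so s))).
    * by rewrite /step /fetch /= Hc3 /= /r2.
    * rewrite /log_cost /fetch /= Hc3 /= (_ : rb 0 = Posz A) //.
      have := Bc 32 isT; move: B3; rewrite (_ : _ + (64 + k) = A); first lia.
      by rewrite defA; lia.
    apply: steps_trans Hs3 _; apply: steps1; rewrite /step /log_cost /fetch /= Hc4 /=.
    * rewrite Ht Hv3; congr (Some (Config _ _ _ _)).
      by rewrite size_cat /= size_cat /=; lia.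
    * rewrite Ht Hv3; have := Bc 32 isT; move: B3; rewrite (_ : _ + (64 + k) = A); last first.
        by rewrite defA; lia.
      have : bitlen (Posz (eval s e)) <= b.
        by apply: bitlen_fits; apply: leq_trans (deg_eval _ Hs) (leq_pexp hq2).
      lia.
  + by rewrite defA; apply/related_set_arr/(related_frame Hr2 Hf3).
  + exact: state_lt_set_arr.
  + by move: HK; rewrite size_cat /= size_cat /=; lia.
- move=> /= Hx Hq pc r Hr Hs /code_at_cons[Hc _] HK.
  exists (upd r x.+1 (Posz v)), 1; split=> //.
  + apply: steps1; rewrite /step /log_cost /fetch /= Hc /= Es /= ?addn1 //.
    have B1 : bitlen (Posz x.+1) <= b by apply: bl_small; lia.
    have : bitlen (Posz v) <= b.
      by apply: bitlen_fits; apply: leq_trans vv (leq_pexp _).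
    lia.
  + exact: (related_set_var v Hx Hr).
  + exact: (@state_lt_set_var _ _ x _ vv Hs).
  + by rewrite muln1.
- move=> /= Hwf Hq pc r Hr Hs /code_at_cat[He /code_at_cons[Hc _]] HK.
  have [r1 [Hs1 Hv1 Hf1]] := cexpr_correct (si s) (so s) Hr Hs Hwf Hq He.
  exists r1, (size (cexpr e 0) + 1); split=> //.
  + apply: steps_trans Hs1 _; apply: steps1; rewrite /step /log_cost /fetch /= Hc /=.
      by rewrite Hv1 size_cat /= addnA addn1.
    have B1 : bitlen (Posz 0) <= b by apply: bl_small.
    have : bitlen (r1 0) <= b.
      by rewrite Hv1; apply: bitlen_fits; apply: leq_trans (deg_eval _ Hs) (leq_pexp Hq).
    lia.
  + exact: (related_frame Hr Hf1).
  + by move: HK; rewrite size_cat /=; lia.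
- move=> /= /andP[Hwf1 Hwf2]; rewrite geq_max => /andP[Hq1 Hq2] pc r Hr Hs.
  move=> /code_at_cat[He1 He2]; rewrite size_cat => HK.
  have [|r2 [k2 [S2 R2 L2 T2]]] := IH1 Hwf1 Hq1 pc r Hr Hs He1; first by lia.
  have [|r3 [k3 [S3 R3 L3 T3]]] := IH2 Hwf2 Hq2 _ r2 R2 L2 He2; first by lia.
  exists r3, (k2 + k3); split=> //; last by lia.
  by rewrite addnA; apply: steps_trans S2 S3.
- move=> /= /and3P[Hwf Hwf1 Hwf2]; rewrite !geq_max => /and3P[Hq Hq1 Hq2] pc r Hr Hs.
  move=> /code_at_cat[He1 /code_at_cat[He2 /code_at_cons[Hc Hc1]]] HK.
  have [r1 [S1 R1]] := ccond_correct (si s) (so s) Hr Hs Hwf Hq He1.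
  move: He2 Hc Hc1 S1 HK IH; rewrite !size_cat /=.
  rewrite (size_ccond _ _ 0); set n0 := size (ccond c 0).
  set n2 := size (ccmd c2 _); set l := pc + n0 + n2.+1.
  set n1 := size (ccmd c1 _) => He2 Hc Hc1 S1 HK.
  case: (ceval s c) S1 => S1 IH.
  + have E1 : (pc + n0 + n2).+1 = l by rewrite /l; lia.
    rewrite E1 in Hc1.
    have [|r2 [k2 [S2 R2 L2 T2]]] := IH Hwf1 Hq1 _ r1 R1 Hs Hc1.
      by rewrite -/n1; lia.
    exists r2, (n0 + k2); split=> //; last by lia.
    apply: steps_trans S1 _; move: S2; congr steps; congr Config.
    by rewrite -/n1 /l; lia.
  + have [|r2 [k2 [S2 R2 L2 T2]]] := IH Hwf2 Hq2 _ r1 R1 Hs He2.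
      by rewrite -/n2; lia.
    exists r2, (n0 + (k2 + 1)); split=> //; last by lia.
    apply: steps_trans S1 _; apply: steps_trans S2 _; apply: steps1.
      rewrite /step /fetch /= -/n2 Hc /= /jump_if /=; congr (Some (Config _ _ _ _)).
      by rewrite /l; lia.
    by rewrite /log_cost /fetch /= -/n2 Hc; nia.
- move=> /= /andP[Hwf _]; rewrite geq_max => /andP[Hq _] pc r Hr Hs.
  move=> /code_at_cat[He1 /code_at_cons[Hc _]] HK.
  have [r1 [S1 R1]] := ccond_correct (si s) (so s) Hr Hs Hwf Hq He1.
  move: Hc S1 HK; rewrite Ec !size_cat /= (size_ccond _ _ 0) size_cat /= => Hc S1 HK.
  exists r1, (size (ccond c 0) + 1); split=> //; last by lia.
  apply: steps_trans S1 _; apply: steps1; rewrite /step /log_cost /fetch /= Hc /=.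
    by rewrite /jump_if /=; congr (Some (Config _ _ _ _)); lia.
  nia.
- move=> Hwf' Hq' pc r Hr Hs Hcode HK; move: (Hwf') (Hq') (Hcode) (HK) => /=.
  move=> /andP[Hwf Hwf1]; rewrite geq_max => /andP[Hq Hq1].
  move=> /code_at_cat[He1 /code_at_cons[Hc /code_at_cat[Hc1 /code_at_cons[Hc2 _]]]].
  have [r1 [S1 R1]] := ccond_correct (si s) (so s) Hr Hs Hwf Hq He1.
  move: Hc Hc1 Hc2 S1; rewrite Ec !size_cat /= (size_ccond _ _ 0) size_cat /=.
  set n0 := size (ccond c 0); set n1 := size (ccmd c1 _) => Hc Hc1 Hc2 S1 HK'.
  rewrite -addnS in Hc1 Hc2.
  have [|r2 [k2 [S2 R2 L2 T2]]] := IH1 Hwf1 Hq1 _ r1 R1 Hs Hc1.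
    by rewrite -/n1; lia.
  have [r3 [k3 [S3 R3 L3 T3]]] := IH2 Hwf' Hq' pc r2 R2 L2 Hcode HK.
  exists r3, (n0 + (k2 + (1 + k3))); split=> //; last by lia.
  apply: steps_trans S1 _; apply: steps_trans S2 _.
  have -> : pc + (n0 + (n1 + 1).+1) = pc + size (ccmd (While c c1) pc).
    by rewrite /= !size_cat /= (size_ccond _ _ 0) size_cat.
  apply: steps_trans S3; apply: steps1; rewrite /step /log_cost /fetch /= -/n1 Hc2 //=.
  nia.
Qed.

End Compile.

Definition init (input : seq int) : state :=
  State (fun=> 0) (fun _ _ => 0) input [::].

Lemma steps_run L w P c k c' : 0 < w -> steps (L * w) P c k c' ->
  fetch P c' = HALT -> exists2 t, run w P c t (out c') & t <= L * k + 1.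
Proof.
move=> w0; elim=> {c k c'} [c|c c1 c2 k h1 h2 h3 IH] H.
  exists (cost w P c); first exact: run_halt.
  by rewrite muln0 /cost /log_cost H add1n prednK // divnn w0.
have [t ht le_t] := IH H; exists (cost w P c + t); first exact: run_step h1 ht.
have : cost w P c <= L by rewrite /cost -ltnS ltn_divLR // mulSn; lia.
by rewrite mulnS; lia.
Qed.

Theorem run_compiled c a q w input t s :
  wf_cmd c -> cmd_deg a c <= q -> a <= q -> 7 <= q -> 0 < w ->
  exec (2 ^ (a * w)) c (init input) t s ->
  exists2 T, run w (ccmd c 0) (start input) T (so s)
           & T <= 4 * q * (size (ccmd c 0) * t) + 1.
Proof.
move=> wf hd ha hq hw Hex.
have Hcode : code_at (ccmd c 0) 0 (ccmd c 0) by [].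
have Hrel : related (init input) (fun=> Posz 0) by [].
have Hlt : state_lt (2 ^ (a * w)) (init input) by split=> *; rewrite /= expn_gt0.
have [r [k [S _ _ hk]]] := ccmd_correct hw hq ha Hex wf hd Hrel Hlt Hcode (leqnn _).
rewrite mulnA in S; have [|T HT hT] := steps_run hw S.
  by rewrite /fetch /= nth_default.
by exists T => //; apply: leq_trans hT _; rewrite leq_add2r leq_mul2l hk orbT.
Qed.

Fixpoint vars (c : cmd) : seq nat :=
  match c with
  | Assign x _ | Read x => [:: x]
  | Seq c1 c2 | If _ c1 c2 => vars c1 ++ vars c2
  | While _ c => vars c
  | _ => [::]
  end.

Fixpoint arrs (c : cmd) : seq nat :=
  match c with
  | Put k _ _ => [:: k]
  | Seq c1 c2 | If _ c1 c2 => arrs c1 ++ arrs c2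
  | While _ c => arrs c
  | _ => [::]
  end.

Fixpoint has_io (c : cmd) : bool :=
  match c with
  | Read _ | Write _ => true
  | Seq c1 c2 | If _ c1 c2 => has_io c1 || has_io c2
  | While _ c => has_io c
  | _ => false
  end.

Definition framed (c : cmd) (s s' : state) : Prop :=
  [/\ forall x, x \notin vars c -> sv s' x = sv s x,
      forall k, k \notin arrs c -> av s' k = av s k
    & ~~ has_io c -> si s' = si s /\ so s' = so s].

Lemma framed_refl c s : framed c s s. Proof. by []. Qed.

Lemma framed_trans c s1 s2 s3 : framed c s1 s2 -> framed c s2 s3 -> framed c s1 s3.
Proof.
move=> [a1 a2 a3] [b1 b2 b3]; split=> [x hx|k hk|h].
- by rewrite b1 ?a1.
- by rewrite b2 ?a2.
- by have [-> ->] := b3 h; apply: a3.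
Qed.

Lemma exec_framed B c s t s' : exec B c s t s' -> framed c s s'.
Proof.
elim=> {c s t s'} //.
- move=> s x e _; split=> //= y; rewrite /set_fun /set_key mem_seq1 => /negbTE -> //.
- move=> s k i e _; split=> //= k'; rewrite /set_fun /set_key mem_seq1 => /negbTE -> //.
- by move=> s x v l _ _; split=> //= y; rewrite /set_fun /set_key mem_seq1 => /negbTE ->.
- move=> c1 c2 s1 s2 s3 t1 t2 _ [a1 a2 a3] _ [b1 b2 b3]; split=> /=.
  + by move=> x; rewrite mem_cat negb_or => /andP[h1 h2]; rewrite b1 ?a1.
  + by move=> x; rewrite mem_cat negb_or => /andP[h1 h2]; rewrite b2 ?a2.
  + by rewrite negb_or => /andP[/a3[<- <-] /b3].
- move=> b c1 c2 s s' t _ [a1 a2 a3]; split=> /=.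
  + by move=> x; rewrite mem_cat negb_or => /andP[h1 h2]; rewrite a1 //; case: ifP.
  + by move=> x; rewrite mem_cat negb_or => /andP[h1 h2]; rewrite a2 //; case: ifP.
  + by rewrite negb_or => /andP[h1 h2]; apply: a3; case: ifP.
- by move=> b c s s' s'' t t' _ _ H1 _; apply: framed_trans H1.
Qed.

Definition wp B c (Q : nat -> state -> Prop) (s : state) : Prop :=
  exists t s', exec B c s t s' /\ Q t s'.

Section Wp.
Variable B : nat.
Implicit Types (Q : nat -> state -> Prop) (s : state).

Lemma wp_framed c Q s : wp B c (fun t s' => framed c s s' -> Q t s') s -> wp B c Q s.
Proof.
by move=> [t [s' [h q]]]; exists t, s'; split=> //; apply: q; apply: exec_framed h.
Qed.

Lemma wp_weaken c Q Q' s : (forall t s', Q' t s' -> Q t s') -> wp B c Q' s -> wp B c Q s.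
Proof. by move=> h [t [s' [h1 h2]]]; exists t, s'; split=> //; apply: h. Qed.

Lemma wp_skip Q s : Q 0 s -> wp B Skip Q s.
Proof. by exists 0, s; split=> //; apply: ESkip. Qed.

Lemma wp_assign x e Q s :
  eval s e < B -> Q 1 (set_var s x (eval s e)) -> wp B (Assign x e) Q s.
Proof. by move=> h q; exists 1, (set_var s x (eval s e)); split=> //; apply: EAssign. Qed.

Lemma wp_put k i e Q s :
  eval s e < B -> Q 1 (set_arr s k (eval s i) (eval s e)) -> wp B (Put k i e) Q s.
Proof. by move=> h q; exists 1; eexists; split; [apply: EPut|]. Qed.

Lemma wp_read x v l Q s : si s = Posz v :: l -> v < B ->
  Q 1 (State (set_key (sv s) x v) (av s) l (so s)) -> wp B (Read x) Q s.
Proof. by move=> h h' q; exists 1; eexists; split; [apply: ERead h h'|]. Qed.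

Lemma wp_write e Q s :
  Q 1 (State (sv s) (av s) (si s) (rcons (so s) (Posz (eval s e)))) ->
  wp B (Write e) Q s.
Proof. by move=> q; exists 1; eexists; split; [apply: EWrite|]. Qed.

Lemma wp_seq c1 c2 Q s :
  wp B c1 (fun t1 s1 => wp B c2 (fun t2 s2 => Q (t1 + t2) s2) s1) s ->
  wp B (Seq c1 c2) Q s.
Proof.
move=> [t1 [s1 [h1 [t2 [s2 [h2 q]]]]]].
by exists (t1 + t2), s2; split=> //; apply: ESeq h1 h2.
Qed.

Lemma wp_if b c1 c2 Q s :
  (ceval s b -> wp B c1 (fun t => Q t.+1) s) ->
  (~~ ceval s b -> wp B c2 (fun t => Q t.+1) s) -> wp B (If b c1 c2) Q s.
Proof.
move=> h1 h2; have [t [s' [h q]]] :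
  wp B (if ceval s b then c1 else c2) (fun t => Q t.+1) s by case: ifP => [|/negbT] h; auto.
by exists t.+1, s'; split=> //; apply: EIf.
Qed.

Lemma wp_while_ghost (I : nat -> state -> Prop) k0 b c Q s0 :
  I k0 s0 ->
  (forall k s, framed c s0 s -> I k s -> ceval s b ->
     wp B c (fun t s' => exists2 k', I k' s' & t + k' < k) s) ->
  (forall t k s, framed c s0 s -> I k s -> ~~ ceval s b -> t + k <= k0 + 1 -> Q t s) ->
  wp B (While b c) Q s0.
Proof.
move=> I0 Hbody Hend.
suff H j k s : k < j -> framed c s0 s -> I k s -> exists t k' s',
    [/\ exec B (While b c) s t s', framed c s0 s', I k' s', ~~ ceval s' b
      & t + k' <= k + 1].
  have [t [k' [s' [h1 h2 h3 h4 h5]]]] := H _ _ _ (ltnSn _) (framed_refl c s0) I0.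
  by exists t, s'; split=> //; apply: Hend h5.
elim: j k s => // j IH k s kj Fs Is.
case Eb : (ceval s b); last first.
  by exists 1, k, s; split; rewrite ?Eb ?(addnC 1) //; apply: EWhileF.
have [t [s' [h [k' Is' kt]]]] := Hbody k s Fs Is Eb.
have [|t' [k'' [s'' [h1 h2 h3 h4 h5]]]] := IH k' s' _ (framed_trans Fs (exec_framed h)) Is'.
  by lia.
by exists (t + t').+1, k'', s''; split=> //; [apply: EWhileT h h1 | lia].
Qed.

Lemma wp_while (I : state -> Prop) (m : state -> nat) b c Q s0 :
  I s0 ->
  (forall s, framed c s0 s -> I s -> ceval s b ->
     wp B c (fun t s' => I s' /\ t + m s' < m s) s) ->
  (forall t s, framed c s0 s -> I s -> ~~ ceval s b -> t + m s <= m s0 + 1 -> Q t s) ->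
  wp B (While b c) Q s0.
Proof.
move=> I0 Hbody Hend.
apply: (wp_while_ghost (I := fun k s => I s /\ k = m s) (k0 := m s0)) => //.
- move=> k s Fs [Is ->] hb; apply: wp_weaken (Hbody s Fs Is hb) => t s' [Is' h].
  by exists (m s').
- by move=> t k s Fs [Is ->]; apply: Hend.
Qed.

End Wp.

(** * The program *)

Notation "c1 ;; c2" := (Seq c1 c2) (at level 90, right associativity).
Declare Scope imp_scope.
Delimit Scope imp_scope with imp.
Bind Scope imp_scope with expr.
Notation "a + b" := (Plus a b) : imp_scope.
Notation "a * b" := (Times a b) : imp_scope.
Notation "x ::= e" := (Assign x e%imp) (at level 80).
Notation "$ x" := (Var x) (at level 5, format "$ x") : imp_scope.
Notation incr x := (x ::= $x + Num 1) (only parsing).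

Notation vn := 0 (only parsing).
Notation vm := 1 (only parsing).
Notation vN := 2 (only parsing).
Notation vQ := 3 (only parsing).
Notation vi := 4 (only parsing).
Notation vj := 5 (only parsing).
Notation vx := 6 (only parsing).
Notation vy := 7 (only parsing).
Notation vz := 8 (only parsing).
Notation vc := 9 (only parsing).
Notation vt := 10 (only parsing).
Notation vcnt := 11 (only parsing).
Notation vroot := 12 (only parsing).
Notation vu := 13 (only parsing).
Notation vv := 14 (only parsing).
Notation vp := 15 (only parsing).
Notation vfound := 16 (only parsing).
Notation vfu := 17 (only parsing).

(* [aM] holds at index x * N + y the trie node of the edge xy, and 0 if xy is not
   an edge; row z of [aNb] lists N[z]; row u of [aInc] lists the neighbours of
   node u in the incidence graph; [aTwo] marks the vertices meeting two classes. *)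
Notation aM := 0 (only parsing).
Notation aDeg := 1 (only parsing).
Notation aNb := 2 (only parsing).
Notation aTrie := 3 (only parsing).
Notation aInc := 4 (only parsing).
Notation aIdeg := 5 (only parsing).
Notation aTwo := 6 (only parsing).
Notation aPtr := 7 (only parsing).
Notation aPre := 8 (only parsing).
Notation aLow := 9 (only parsing).
Notation aPar := 10 (only parsing).
Notation aMark := 11 (only parsing).

Definition self_loop_body : cmd :=
  Put aNb ($vx * $vN) ($vx);; Put aDeg ($vx) (Num 1);; incr vx.

Definition read_edge : cmd :=
  Read vx;; Read vy;; incr vx;; incr vy;;
  Put aM ($vx * $vN + $vy) (Num 1);;
  Put aM ($vy * $vN + $vx) (Num 1);;
  Put aNb ($vx * $vN + Arr aDeg ($vx)) ($vy);;
  Put aDeg ($vx) (Arr aDeg ($vx) + Num 1);;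
  Put aNb ($vy * $vN + Arr aDeg ($vy)) ($vx);;
  Put aDeg ($vy) (Arr aDeg ($vy) + Num 1);;
  incr vi.

Definition read_graph : cmd :=
  Read vn;; Read vm;; vN ::= $vn + Num 1;; vQ ::= $vN * $vN;;
  vx ::= Num 1;; While (Lt ($vx) ($vN)) self_loop_body;;
  vi ::= Num 0;; While (Lt ($vi) ($vm)) read_edge.

Definition trie_step : cmd :=
  vy ::= Arr aNb ($vz * $vN + $vj);;
  vc ::= Arr aM ($vx * $vN + $vy);;
  If (Lt (Num 0) ($vc))
    (vt ::= Arr aTrie ($vc * $vN + $vz);;
     If (Eq ($vt) (Num 0))
       (incr vcnt;; vt ::= $vcnt;; Put aTrie ($vc * $vN + $vz) ($vt))
       Skip;;
     Put aM ($vx * $vN + $vy) ($vt))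
    Skip;;
  incr vj.

Definition trie_row : cmd :=
  vj ::= Num 0;; vx ::= Arr aNb ($vz * $vN + $vi);;
  While (Lt ($vj) (Arr aDeg ($vz))) trie_step;;
  incr vi.

Definition trie_round : cmd :=
  vi ::= Num 0;;
  While (Lt ($vi) (Arr aDeg ($vz))) trie_row;;
  incr vz.

Definition classify : cmd :=
  vcnt ::= Num 1;; vz ::= Num 1;; While (Lt ($vz) ($vN)) trie_round.

Definition incidence_step : cmd :=
  vc ::= Arr aM ($vx * $vN + Arr aNb ($vx * $vN + $vi));;
  If (Lt (Num 0) ($vc))
    (vc ::= $vc + $vN;;
     Put aInc ($vx * $vQ + Arr aIdeg ($vx)) ($vc);;
     Put aIdeg ($vx) (Arr aIdeg ($vx) + Num 1);;
     Put aInc ($vc * $vQ + Arr aIdeg ($vc)) ($vx);;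
     Put aIdeg ($vc) (Arr aIdeg ($vc) + Num 1);;
     If (Eq ($vc) (Arr aInc ($vx * $vQ))) Skip
       (Put aTwo ($vx) (Num 1);; vroot ::= $vx))
    Skip;;
  incr vi.

Definition incidence_row : cmd :=
  vi ::= Num 0;;
  While (Lt ($vi) (Arr aDeg ($vx))) incidence_step;;
  incr vx.

Definition incidence : cmd :=
  vx ::= Num 1;; While (Lt ($vx) ($vN)) incidence_row.

Definition dfs_scan : cmd :=
  vv ::= Arr aInc ($vu * $vQ + Arr aPtr ($vu));;
  Put aPtr ($vu) (Arr aPtr ($vu) + Num 1);;
  If (Eq (Arr aPre ($vv)) (Num 0))
    (incr vcnt;; Put aPre ($vv) ($vcnt);; Put aLow ($vv) ($vcnt);;
     Put aPar ($vv) ($vu);; vu ::= $vv)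
    (If (Lt (Arr aPre ($vv)) (Arr aLow ($vu)))
       (Put aLow ($vu) (Arr aPre ($vv))) Skip).

Definition dfs_retreat : cmd :=
  vp ::= Arr aPar ($vu);;
  If (Lt (Arr aLow ($vu)) (Arr aLow ($vp)))
    (Put aLow ($vp) (Arr aLow ($vu))) Skip;;
  If (Lt ($vn) ($vp))
    (If (Lt (Arr aLow ($vu)) (Arr aPre ($vp)))
       (vu ::= $vp)
       (If (Eq (Arr aTwo ($vu)) (Num 0))
          (vu ::= $vp)
          (vfound ::= $vp;; vfu ::= $vu;; vu ::= Num 0)))
    (vu ::= $vp).

Definition dfs : cmd :=
  vu ::= $vroot;; vcnt ::= Num 1;;
  Put aPre ($vu) (Num 1);; Put aLow ($vu) (Num 1);;
  While (Lt (Num 0) ($vu))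
    (If (Lt (Arr aPtr ($vu)) (Arr aIdeg ($vu))) dfs_scan dfs_retreat).

Definition mark_step : cmd :=
  Put aMark (Arr aInc ($vfound * $vQ + $vi)) (Num 1);; incr vi.

Definition write_step : cmd :=
  If (Lt (Arr aPre ($vx)) (Arr aPre ($vfu)))
    (Write (Arr aMark ($vx))) (Write (Num 2 + Arr aMark ($vx)));;
  incr vx.

Definition write_join : cmd :=
  If (Eq ($vfound) (Num 0)) (Write (Num 0))
    (Write (Num 1);;
     vi ::= Num 0;; While (Lt ($vi) (Arr aIdeg ($vfound))) mark_step;;
     vx ::= Num 1;; While (Lt ($vx) ($vN)) write_step).

Definition one_join_cmd : cmd :=
  read_graph;; classify;; incidence;; dfs;; write_join.

Lemma wf_one_join : wf_cmd one_join_cmd. Proof. by []. Qed.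

Ltac wstep := try apply: wp_seq; first [apply: wp_put | apply: wp_assign];
  [simpl; try lia | simpl].

(** * One-joins and classes of edges *)

Section OneJoin.
Variables (T : finType) (e : rel T).
Hypotheses (e_sym : symmetric e) (e_irr : irreflexive e).

Definition closed_common (x y : T) : {set T} :=
  [set z | ((z == x) || e z x) && ((z == y) || e z y)].
Local Notation K := closed_common.

Lemma closed_commonP z x y : reflect ((z = x \/ e z x) /\ (z = y \/ e z y)) (z \in K x y).
Proof.
rewrite inE; apply: (iffP andP) => -[h1 h2].
  by split; [case/orP: h1 => [/eqP|]; auto | case/orP: h2 => [/eqP|]; auto].
by split; apply/orP; [case: h1 => [->|]; rewrite ?eqxx; auto | case: h2 => [->|]; rewrite ?eqxx; auto].
Qed.

Lemma closed_commonC x y : K x y = K y x.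
Proof. by apply/setP => z; rewrite !inE andbC. Qed.

Lemma mem_closed_common_l x y : e x y -> x \in K x y.
Proof. by move=> h; rewrite inE eqxx h orbT. Qed.

Lemma mem_closed_common_r x y : e x y -> y \in K x y.
Proof. by rewrite closed_commonC e_sym; apply: mem_closed_common_l. Qed.

Lemma connected_ind (S : pred T) x : connected_graph e -> S x ->
  (forall u v, e u v -> S u -> S v) -> forall y, S y.
Proof.
move=> conn Sx hS y; have /connectP[p hp ->] := conn x y.
elim: p x Sx hp => //= z p IH x Sx /andP[exz hp]; apply: IH hp.
exact: hS exz Sx.
Qed.

Lemma connected_crossing (S : pred T) x y : connected_graph e -> S x -> ~~ S y ->
  exists u v, [/\ e u v, S u & ~~ S v].
Proof.
move=> conn Sx nSy; case: (boolP [exists u, exists v, [&& e u v, S u & ~~ S v]]).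
  by case/existsP => u /existsP[v /and3P[]]; exists u, v.
rewrite negb_exists => /forallP h; case/negP: nSy.
apply: (connected_ind conn Sx) => u v euv Su; have := h u; rewrite negb_exists.
by move=> /forallP /(_ v); rewrite euv Su negbK.
Qed.

Section Separation.
Variables (S C : {set T}).
Hypothesis crossing : forall x y, e x y -> x \in S -> y \notin S -> K x y = C.
Variables (x0 y0 : T).
Hypotheses (e0 : e x0 y0) (x0S : x0 \in S) (y0S : y0 \notin S).

Lemma crossing_sym x y : e x y -> (x \in S) != (y \in S) -> K x y = C.
Proof.
case: (boolP (x \in S)) => hx; case: (boolP (y \in S)) => hy //= exy _.
  exact: crossing.
by rewrite closed_commonC; apply: crossing => //; rewrite e_sym.
Qed.

Lemma mem_cut_clique z : z \in C -> exists2 w, e z w & K z w = C.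
Proof.
have /= eC := crossing e0 x0S y0S.
rewrite -{1}eC => /closed_commonP[hx hy]; case: (boolP (z \in S)) => hz.
  exists y0; first by case: hy hz => // ->; rewrite (negbTE y0S).
  by apply: crossing_sym; [case: hy hz => // ->; rewrite (negbTE y0S) | rewrite hz (negbTE y0S)].
exists x0; first by case: hx hz => // ->; rewrite x0S.
by apply: crossing_sym; [case: hx hz => // ->; rewrite x0S | rewrite (negbTE hz) x0S].
Qed.

Lemma cut_clique z w : z \in C -> w \in C -> z != w -> e z w.
Proof.
move=> /mem_cut_clique[u ezu eC]; rewrite -eC => /closed_commonP[+ _] nzw.
by case=> [ewz|]; [rewrite ewz eqxx in nzw | rewrite e_sym].
Qed.

Lemma class_end x y : e x y -> K x y = C -> x \in C.
Proof. by move=> exy <-; apply: mem_closed_common_l. Qed.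

Lemma mem_cut_cliqueE z : (z \in C) = [exists w, e z w && (K z w == C)].
Proof.
apply/idP/existsP => [/mem_cut_clique[w ezw eC]|[w /andP[ezw /eqP]]].
  by exists w; rewrite ezw eC eqxx.
exact: class_end.
Qed.

Lemma side_has_private (D : {set T}) x y : (forall u v, e u v -> (u \in D) != (v \in D) -> K u v = C) ->
  e x y -> x \in D -> K x y != C -> exists2 z, z \in D & z \notin C.
Proof.
move=> hD exy xD nC; have yD : y \in D.
  by apply: contraNT nC => yD; apply/eqP/hD => //; rewrite xD (negbTE yD).
case: (boolP (x \in C)) => xC; last by exists x.
case: (boolP (y \in C)) => yC; last by exists y.
have sub : C \subset K x y.
  apply/subsetP => z zC; apply/closed_commonP; split.
    by case: (eqVneq z x) => [|nzx]; [left | right; apply: cut_clique].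
  by case: (eqVneq z y) => [|nzy]; [left | right; apply: cut_clique].
have /subsetPn[z zK zC] : ~~ (K x y \subset C).
  by apply: contra nC => sub'; rewrite eqEsubset sub'.
exists z => //; case/closed_commonP: zK => -[e1|ezx] _.
  by rewrite e1 xC in zC.
apply: contraNT zC => zD; rewrite (class_end ezx) //; apply: hD => //.
by rewrite (negbTE zD) xD.
Qed.

Lemma separation_one_join :
  (exists x y, [/\ e x y, x \in S & K x y != C]) ->
  (exists x y, [/\ e x y, x \notin S & K x y != C]) ->
  one_join e (~: S) S (C :\: S) (C :&: S).
Proof.
move=> [x [y [exy xS nC]]] [x' [y' [exy' xS' nC']]].
have crossC u v : e u v -> (u \in ~: S) != (v \in ~: S) -> K u v = C.
  by rewrite !inE => euv h; apply: crossing_sym => //; move: h; do 2 case: (_ \in S).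
have x0C : x0 \in C by apply: class_end e0 _; apply: crossing.
have y0C : y0 \in C by rewrite -(crossing e0 x0S y0S) mem_closed_common_r.
have CE : C :\: S :|: C :&: S = C.
  by apply/setP => z; rewrite !inE; case: (z \in S); rewrite ?andbT ?andbF ?orbF.
split; first by rewrite setUC setUCr -setI_eq0 setIC setICr.
- by rewrite subsetIr; split=> //; apply/subsetP => z; rewrite !inE => /andP[].
- by rewrite CE => u v; apply: cut_clique.
- split=> u v; rewrite !inE => /andP[hu1 hu2] hv; apply/negP => euv.
    have hC : K u v = C by apply: crossing_sym => //; rewrite hv (negbTE hu2).
    by rewrite (class_end euv hC) (negbTE hu2) in hu1.
  have hC : K u v = C by apply: crossing_sym => //; rewrite hu2 (negbTE hv).
  by rewrite (class_end euv hC) hu2 in hu1.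
split.
- by apply/set0Pn; exists y0; rewrite inE y0S.
- by apply/set0Pn; exists x0; rewrite inE x0C.
- have [|z zS zC] := side_has_private crossC exy' _ nC'; first by rewrite inE.
  by apply/set0Pn; exists z; rewrite !inE (negbTE zC) andbF -in_setC zS.
- have [z zS zC] := side_has_private crossing_sym exy xS nC.
  by apply/set0Pn; exists z; rewrite !inE (negbTE zC) zS.
Qed.

(* So every other class has all its edges on the same side. *)
Lemma class_one_side x y u v : e x y -> e u v -> K x y = K u v -> x \in S -> u \notin S ->
  K x y = C.
Proof.
move=> exy euv eqK xS uS.
case: (boolP (y \in S)) => yS; last exact: crossing.
case: (boolP (v \in S)) => vS.
  by rewrite eqK; apply: crossing_sym => //; rewrite (negbTE uS) vS.
have uK : u \in K x y by rewrite eqK mem_closed_common_l.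
have xK : x \in K u v by rewrite -eqK mem_closed_common_l.
have eux : e u x by case/closed_commonP: uK => -[h|//]; rewrite h xS in uS.
have euy : e u y by case/closed_commonP: uK => _ [h|//]; rewrite h yS in uS.
have Kux : K u x = C by apply: crossing_sym => //; rewrite xS (negbTE uS).
have xC : x \in C by rewrite -Kux mem_closed_common_r.
have yC : y \in C by apply: (class_end (y := u)); rewrite ?crossing_sym ?yS ?(negbTE uS) // e_sym.
apply/eqP; rewrite eqEsubset; apply/andP; split; apply/subsetP => z hz.
  rewrite -Kux; apply/closed_commonP; have := hz; rewrite eqK => /closed_commonP[h1 _].
  by case/closed_commonP: hz => h2 _.
apply/closed_commonP; split.
  by case: (eqVneq z x) => [|nzx]; [left | right; apply: cut_clique].
by case: (eqVneq z y) => [|nzy]; [left | right; apply: cut_clique].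
Qed.

End Separation.

Lemma one_join_sym V1 V2 A1 A2 : one_join e V1 V2 A1 A2 -> one_join e V2 V1 A2 A1.
Proof.
case=> [[h1 h2] [h3 h4] h5 [h6 h7] [h8 h9 h10 h11]]; split=> //.
- by rewrite setUC disjoint_sym.
- by rewrite setUC.
Qed.

Lemma one_join_separation V1 V2 A1 A2 : connected_graph e -> one_join e V1 V2 A1 A2 ->
  [/\ V1 = ~: V2, (exists x y, [/\ e x y, x \in V2 & y \notin V2]),
      (forall x y, e x y -> x \in V2 -> y \notin V2 -> K x y = A1 :|: A2),
      (exists x y, [/\ e x y, x \in V2 & K x y != A1 :|: A2])
    & (exists x y, [/\ e x y, x \notin V2 & K x y != A1 :|: A2])].
Proof.
move=> conn oj; have [[h1 h2] [h3 h4] h5 [h6 h7] [h8 h9 h10 h11]] := oj.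
have V1E : V1 = ~: V2.
  apply/setP => z; rewrite inE; apply/idP/idP => hz.
    by move/disjointFr: h2 => ->.
  by have : z \in V1 :|: V2 by [rewrite h1 inE]; rewrite inE (negbTE hz) orbF.
have cr x y : e x y -> x \in V2 -> y \notin V2 -> x \in A2 /\ y \in A1.
  move=> exy hx hy; have hy1 : y \in V1 by rewrite V1E inE.
  split; apply: contraT => hn.
    by have := h7 x y; rewrite !inE hx hn exy => /(_ isT hy1).
  by have := h6 y x; rewrite !inE hy1 hn e_sym exy => /(_ isT hx).
have priv (D A : {set T}) x : x \in D :\: A -> (forall z, z \in D -> z \in A1 :|: A2 -> z \in A) ->
    exists y, e x y /\ K x y != A1 :|: A2.
  rewrite inE => /andP[xA xD] hA.
  have [a aA] := set0Pn _ h8; have [b bA] := set0Pn _ h9.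
  have xn : x \notin A1 :|: A2 by apply: contra xA; apply: hA.
  have [||u [v [euv /= /eqP eu _]]] := connected_crossing (S := pred1 x) (x := x) (y := a) conn.
  - by rewrite /= eqxx.
  - by apply: contraNneq xn => <-; rewrite inE aA.
  exists v; rewrite -eu; split=> //; apply: contraNneq xn => <-.
  by rewrite -eu mem_closed_common_l.
split=> //.
- have [a aA] := set0Pn _ h8; have [b bA] := set0Pn _ h9.
  have aV : a \in V1 := subsetP h3 _ aA; have bV : b \in V2 := subsetP h4 _ bA.
  have nab : b != a by apply: contraTneq aV => <-; rewrite V1E inE bV.
  by exists b, a; rewrite h5 ?inE ?aA ?bA ?orbT //; split=> //; rewrite V1E inE in aV.
- move=> x y exy hx hy; have [xA yA] := cr x y exy hx hy.
  apply/setP => z; apply/closed_commonP/idP => [[hzx hzy]|hz].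
    case: (boolP (z \in V2)) => hz.
      case: hzy => [e1|ezy]; first by rewrite e1 (negbTE hy) in hz.
      by have [h _] := cr z y ezy hz hy; rewrite inE h orbT.
    case: hzx => [e1|ezx]; first by rewrite e1 hx in hz.
    by have [|_ h] := cr x z _ hx hz; rewrite 1?e_sym // inE h.
  split.
    by case: (eqVneq z x) => [|nzx]; [left | right; apply: h5; rewrite // inE xA orbT].
  by case: (eqVneq z y) => [|nzy]; [left | right; apply: h5; rewrite // inE yA].
- have [w hw] := set0Pn _ h11; have [|y [ewy nK]] := priv _ _ _ hw.
    move=> z zD; rewrite inE => /orP[/(subsetP h3)|//]; by rewrite V1E inE zD.
  by exists w, y; split=> //; move: hw; rewrite inE => /andP[].
- have [w hw] := set0Pn _ h10; have [|y [ewy nK]] := priv _ _ _ hw.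
    move=> z zD; rewrite inE => /orP[//|/(subsetP h4)] h; by move: zD; rewrite V1E inE h.
  by exists w, y; split=> //; move: hw; rewrite inE V1E inE => /andP[].
Qed.

End OneJoin.

(** * Depth-first search *)

Section DepthFirst.
Variables (n root : nat) (il : nat -> seq nat) (two : nat -> bool).
Local Notation adj u w := (w \in il u).
Hypothesis adj_sym : forall u w, adj u w -> adj w u.
Hypothesis adj_bip : forall u w, adj u w -> (n < u) = (w <= n).
Hypothesis adj_gt0 : forall u w, adj u w -> 0 < w.
Hypothesis two_intro : forall u w w', u <= n -> adj u w -> adj u w' -> w != w' -> two u.
Hypothesis root_vertex : 0 < root <= n.

(* [P] is the current search path, deepest node first; a node is visited when
   [pre] is positive, and finished when it is visited and not on [P]. *)
Fixpoint chain (pre par : nat -> nat) (P : seq nat) : Prop :=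
  if P is u :: P' then
    [/\ par u = head 0 P', forall p, p \in P' -> pre p < pre u,
        P' = [::] \/ adj u (head 0 P') & chain pre par P']
  else True.

Lemma chain_ext pre par pre' par' P : (forall u, u \in P -> pre' u = pre u) ->
  (forall u, u \in P -> par' u = par u) -> chain pre par P -> chain pre' par' P.
Proof.
elim: P => //= u P IH h1 h2 [h3 h4 h5 h6].
have hP p : p \in P -> p \in u :: P by rewrite inE => ->; rewrite orbT.
split=> //; first by rewrite h2 ?mem_head.
  by move=> p hp; rewrite !h1 ?mem_head ?hP //; apply: h4.
by apply: IH => // v hv; [apply: h1 | apply: h2]; apply: hP.
Qed.

Lemma chain_par pre par P v : chain pre par P -> v \in P -> par v != 0 ->
  [/\ par v \in P, pre (par v) < pre v & adj v (par v)].
Proof.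
elim: P => //= u P IH [h1 h2 h3 h4]; rewrite inE => /orP[/eqP ->|hv] hp.
  case: P h1 h2 h3 {IH h4} => [|p P] /= h1 h2 h3; first by rewrite h1 in hp.
  rewrite h1 !inE eqxx orbT; split=> //; first by apply: h2; rewrite mem_head.
  by case: h3.
by have [h5 h6 h7] := IH h4 hv hp; split=> //; rewrite inE h5 orbT.
Qed.

Record search_inv (pre low par ptr : nat -> nat) (cnt : nat) (P : seq nat) : Prop := {
  si_chain : chain pre par P;
  si_path : forall u, u \in P -> 0 < pre u /\ 0 < u;
  si_zero : pre 0 = 0 /\ low 0 = 0;
  si_root : pre root = 1;
  si_cnt : forall x, pre x <= cnt;
  si_inj : forall x y, 0 < pre x -> pre x = pre y -> x = y;
  si_ptr : forall y, ptr y <= size (il y);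
  si_new : forall y, pre y = 0 -> ptr y = 0;
  si_black : forall y, 0 < pre y -> y \notin P -> ptr y = size (il y);
  si_seen : forall y i, 0 < pre y -> i < ptr y -> 0 < pre (nth 0 (il y) i);
  si_nbr : forall y x, 0 < pre y -> y \notin P -> adj y x ->
    (x \in P -> pre x < pre y) /\
    (forall u, u \in P -> pre u <= pre y -> x \in P \/ pre u <= pre x);
  si_low : forall u, u \in P -> low u <= pre u;
  si_low_sound : forall y i u, 0 < pre y -> i < ptr y -> u \in P -> pre u <= pre y ->
    exists2 u', u' \in P & pre u <= pre u' /\ low u' <= pre (nth 0 (il y) i);
  si_low_attained : forall u, u \in P -> low u = pre u \/
    exists y x, [/\ adj y x, 0 < pre x, pre u <= pre y & pre x = low u] }.

Lemma search_inv_init :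
  search_inv (set_fun (fun=> 0) root 1) (set_fun (fun=> 0) root 1) (fun=> 0) (fun=> 0)
    1 [:: root].
Proof.
have rt : set_fun (fun=> 0) root 1 root = 1 by rewrite /set_fun eqxx.
have nr x : x != root -> set_fun (fun=> 0) root 1 x = 0 by rewrite /set_fun => /negbTE ->.
split=> //.
- by split=> //; left.
- by move=> u; rewrite inE => /eqP ->; rewrite rt; case/andP: root_vertex.
- by rewrite nr //; lia.
- by move=> x; rewrite /set_fun; case: ifP.
- move=> x y; rewrite /set_fun; case: eqP => // ->; case: eqP => // ->//.
- move=> y; rewrite inE => h /nr; lia.
- move=> y x h; rewrite inE => /nr; lia.
- by move=> u; rewrite inE => /eqP ->; left.
Qed.

Section Steps.
Variables (pre low par ptr : nat -> nat) (cnt : nat) (u : nat) (P : seq nat).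
Hypothesis inv : search_inv pre low par ptr cnt (u :: P).

Lemma top_visited : 0 < pre u /\ 0 < u.
Proof. by apply: (si_path inv); rewrite mem_head. Qed.

Lemma top_pre p : p \in u :: P -> pre p <= pre u.
Proof. by case: (si_chain inv) => _ h _ _; rewrite inE => /orP[/eqP -> //|/h /ltnW]. Qed.

Lemma scan_visited (v := nth 0 (il u) (ptr u)) (lw : nat) :
  ptr u < size (il u) -> 0 < pre v -> lw = minn (low u) (pre v) ->
  search_inv pre (set_fun low u lw) par (set_fun ptr u (ptr u).+1) cnt (u :: P).
Proof.
move=> hi hv ->; have [pu u0] := top_visited; case: (inv); split=> //.
- by case: si_zero0 => h1 h2; rewrite /set_fun ifF //; lia.
- by move=> y; rewrite /set_fun; case: eqP => // ->.
- by move=> y hy; rewrite /set_fun; case: eqP => [e|_]; [rewrite e in hy; lia | exact: si_new0].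
- by move=> y hy ny; rewrite /set_fun; case: eqP => [e|_]; [rewrite e mem_head in ny | exact: si_black0].
- move=> y i hy; rewrite /set_fun; case: eqP => [->|_]; last exact: si_seen0.
  by rewrite ltnS leq_eqVlt => /orP[/eqP -> //|hlt]; apply: si_seen0.
- move=> w hw; rewrite /set_fun; case: eqP => [->|_]; last exact: si_low0.
  by have := si_low0 u (mem_head _ _); lia.
- move=> y i w hy hlt hw le_wy.
  have H : i < ptr y \/ y = u /\ i = ptr u.
    move: hlt; rewrite /set_fun; case: eqP => [->|]; [lia | by left].
  case: H => [hlt'|[-> ->]]; last first.
    by exists u; rewrite ?mem_head // top_pre //; split=> //; rewrite /set_fun eqxx; apply: geq_minr.
  have [w' hw' [h1 h2]] := si_low_sound0 y i w hy hlt' hw le_wy.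
  by exists w' => //; split=> //; rewrite /set_fun; case: eqP => [e|//]; move: h2; rewrite e; lia.
- move=> w hw; rewrite /set_fun; case: eqP => [e|_]; last exact: si_low_attained0.
  case: (leqP (low u) (pre v)) => [le_uv|lt_vu]; last first.
    by right; exists u, v; rewrite e; split=> //; apply: mem_nth.
  by rewrite -e; apply: si_low_attained0.
Qed.

Lemma scan_new (v := nth 0 (il u) (ptr u)) :
  ptr u < size (il u) -> pre v = 0 ->
  search_inv (set_fun pre v cnt.+1) (set_fun low v cnt.+1) (set_fun par v u)
    (set_fun ptr u (ptr u).+1) cnt.+1 (v :: u :: P).
Proof.
move=> hi hv; have [pu u0] := top_visited; have huv : adj u v by apply: mem_nth.
have v0 : 0 < v := adj_gt0 huv.
have nvP : v \notin u :: P by apply/negP => /(si_path inv); lia.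
have eqv : forall f c, set_fun f v c v = c :> nat by move=> *; rewrite /set_fun eqxx.
have nev : forall f c x, x != v -> set_fun f v c x = f x :> nat.
  by move=> f c x; rewrite /set_fun => /negbTE ->.
have inP x : x \in u :: P -> x != v by move=> hx; apply: contraNneq nvP => <-.
have vis x : 0 < pre x -> x != v by move=> hx; apply: contraTneq hx => ->; rewrite hv.
have nuv : (v == u) = false by apply/negbTE; rewrite eq_sym; apply: vis.
case: (inv) => i1 i2 i3 i4 i5 i6 i7 i8 i9 i10 i11 i12 i13 i14.
split.
- split; rewrite ?eqv //=; last 2 first.
  + by right; apply: adj_sym.
  + by apply: chain_ext i1 => w hw; rewrite nev ?inP.
  + by move=> p hp; rewrite nev ?inP // ltnS.
- move=> w; rewrite inE => /orP[/eqP ->|hw]; first by rewrite eqv.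
  by rewrite nev ?inP //; apply: i2.
- by rewrite !nev //; apply: contraTneq v0 => <-.
- by rewrite nev //; apply: vis; rewrite i4.
- by move=> x; rewrite /set_fun; case: ifP => // _; apply: leqW.
- move=> x y; rewrite /set_fun; case: eqP => [->|_]; case: eqP => [->|_] //.
  + by move=> _ e; have := i5 y; lia.
  + by move=> _ e; have := i5 x; lia.
  + exact: i6.
- by move=> y; rewrite /set_fun; case: eqP => // ->.
- move=> y; rewrite {1}/set_fun; case: eqP => // _ hy; rewrite /set_fun.
  by case: eqP => [e|_]; [rewrite e in hy; lia | exact: i8].
- move=> y hy; rewrite inE negb_or => /andP[nyv ny]; rewrite nev // in hy.
  by rewrite /set_fun; case: eqP => [e|_]; [rewrite e mem_head in ny | exact: i9].
- move=> y i hy hlt.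
  have H : y != v /\ i < ptr y \/ y = u /\ i = ptr u.
    move: hlt; rewrite {1}/set_fun; case: eqP => [->|_] hlt.
      rewrite eq_sym nuv; lia.
    left; split=> //; apply: contraTneq hlt => ->; rewrite i8 //.
  case: H => [[nyv hlt']|[-> ->]]; last by rewrite -/v eqv.
  rewrite nev // in hy; have h := i10 y i hy hlt'.
  by rewrite nev // vis.
- move=> y x hy; rewrite inE negb_or => /andP[nyv ny] hyx; rewrite nev // in hy.
  have [h1 h2] := i11 y x hy ny hyx.
  have hx : 0 < pre x.
    have := i10 y (index x (il y)) hy; rewrite i9 // index_mem hyx => /(_ isT).
    by rewrite nth_index.
  have nxv := vis x hx; rewrite !(nev _ _ x) // !(nev _ _ y) // inE (negbTE nxv) /=.
  split=> // w; rewrite inE => /orP[/eqP ->|hw].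
    by rewrite eqv; have := i5 y; lia.
  by rewrite nev ?inP //; apply: h2.
- move=> w; rewrite inE => /orP[/eqP ->|hw]; first by rewrite !eqv.
  by rewrite !nev ?inP //; apply: i12.
- move=> y i w hy hlt hw le_wy.
  have H : y != v /\ i < ptr y \/ y = u /\ i = ptr u.
    move: hlt; rewrite {1}/set_fun; case: eqP => [->|_] hlt.
      rewrite eq_sym nuv; lia.
    left; split=> //; apply: contraTneq hlt => ->; rewrite i8 //.
  case: H => [[nyv hlt']|[ey ei]].
    rewrite nev // in hy; rewrite (nev _ _ y) // in le_wy.
    have hwP : w \in u :: P.
      move: hw; rewrite inE => /orP[/eqP e|//]; rewrite e eqv in le_wy.
      by have := i5 y; lia.
    rewrite (nev _ _ w) ?inP // in le_wy *.
    have [w' hw' [h1 h2]] := i13 y i w hy hlt' hwP le_wy.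
    have hx := i10 y i hy hlt'.
    exists w'; first by rewrite inE hw' orbT.
    by rewrite !(nev _ _ w') ?inP // (nev _ _ _ (vis _ hx)).
  rewrite ey ei -/v eqv; rewrite ey in le_wy.
  exists u; first by rewrite !inE eqxx orbT.
  rewrite !(nev _ _ u) ?inP ?mem_head // in le_wy *; split=> //.
  by have := i12 u (mem_head _ _); have := i5 u; lia.
- move=> w; rewrite inE => /orP[/eqP ->|hw]; first by left; rewrite !eqv.
  rewrite !nev ?inP //; case: (i14 w hw) => [->|[y [x [h1 h2 h3 h4]]]]; [by left|right].
  exists y, x; split=> //; try by rewrite (nev _ _ x) ?vis.
  by rewrite /set_fun; case: ifP => // _; apply: leq_trans (i5 _) _.
Qed.

Lemma retreat (lp : nat) : ptr u = size (il u) ->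
  (P != [::] -> lp = minn (low (head 0 P)) (low u)) -> (P = [::] -> lp = 0) ->
  search_inv pre (set_fun low (head 0 P) lp) par ptr cnt P.
Proof.
move=> hptr hlp hlp0; have [pu u0] := top_visited.
case: (inv) => i1 i2 i3 i4 i5 i6 i7 i8 i9 i10 i11 i12 i13 i14.
have inP x : x \in P -> x \in u :: P by rewrite inE => ->; rewrite orbT.
have [_ lt_u _ chP] := i1.
have upre x : x \in P -> pre x < pre u := lt_u x.
have lowE x : x \in P -> set_fun low (head 0 P) lp x =
    if x == head 0 P then minn (low x) (low u) else low x.
  move=> hx; rewrite /set_fun; case: eqP => // ->; apply: hlp.
  by apply: contraTneq hx => ->.
have hhead : P != [::] -> head 0 P \in P by case: (P) => //= *; rewrite mem_head.
have headpre x : x \in P -> pre x <= pre (head 0 P).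
  case: (P) chP => //= p P' [_ h _ _]; rewrite inE => /orP[/eqP -> //|/h /ltnW //].
split=> //.
- by move=> x hx; apply/i2/inP.
- case: i3 => h1 h2; split=> //; rewrite /set_fun; case: eqP => // e.
  case: (eqVneq P [::]) => [/hlp0 -> //|/hhead]; rewrite -e => h.
  by have [] := i2 0 (inP _ h).
- move=> y hy ny; case: (eqVneq y u) => [-> //|nyu].
  by apply: i9 => //; rewrite inE negb_or nyu.
- move=> y x hy ny hyx; case: (eqVneq y u) => [ey|nyu].
    rewrite ey in hyx ny *; split=> [/upre //|w hw _].
    have hx : 0 < pre x.
      have := i10 u (index x (il u)) pu; rewrite hptr index_mem hyx => /(_ isT).
      by rewrite nth_index.
    case: (boolP (x \in P)) => nx; [by left|right].
    case: (eqVneq x u) => [->|nxu]; first exact/ltnW/upre.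
    have [|h _] := i11 x u hx _ (adj_sym hyx); first by rewrite inE negb_or nxu.
    exact/ltnW/(ltn_trans (upre _ hw))/h/mem_head.
  have [|h1 h2] := i11 y x hy _ hyx; first by rewrite inE negb_or nyu.
  split=> [/inP /h1 //|w hw le_wy].
  case: (h2 w (inP _ hw) le_wy) => [|h]; last by right.
  by rewrite inE => /orP[/eqP ->|]; [right; apply/ltnW/upre | left].
- move=> w hw; rewrite lowE //; have := i12 w (inP _ hw); case: ifP => _; lia.
- move=> y i w hy hlt hw le_wy.
  have [w' + [h1 h2]] := i13 y i w hy hlt (inP _ hw) le_wy.
  have Pn : P != [::] by apply: contraTneq hw => ->.
  rewrite inE => /orP[/eqP e|hw'].
    exists (head 0 P); first exact: hhead.
    split; first exact: headpre.
    by rewrite lowE ?hhead // eqxx; rewrite e in h2; lia.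
  by exists w' => //; split=> //; rewrite lowE //; case: ifP => _; lia.
- move=> w hw; rewrite lowE //; case: eqP => [e|_]; last exact/i14/inP.
  case: (leqP (low w) (low u)) => h; first exact/i14/inP.
  case: (i14 u (mem_head _ _)) => [e'|[y [x [h1 h2 h3 h4]]]].
    by have := i12 w (inP _ hw); have := upre w hw; lia.
  right; exists y, x; split=> //; apply: leq_trans h3; exact/ltnW/upre.
Qed.

(* The nodes visited since [u] was entered form a union of components of the
   graph without the node [head 0 P]. *)
Lemma subtree_closed x y : ptr u = size (il u) -> pre (head 0 P) <= low u ->
  pre u <= pre x -> adj x y -> pre u <= pre y \/ y = head 0 P.
Proof.
move=> hptr hlow le_ux hxy; have [pu u0] := top_visited.
case: (inv) => i1 i2 i3 i4 i5 i6 i7 i8 i9 i10 i11 i12 i13 i14.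
have px : 0 < pre x by lia.
case: (leqP (pre u) (pre y)) => [|lt_yu]; [by left|right].
have hpt : ptr x = size (il x).
  case: (boolP (x \in u :: P)) => hx; last exact: i9.
  by rewrite (i6 x u px) //; have := top_pre hx; lia.
have hiy : index y (il x) < ptr x by rewrite hpt index_mem.
have py : 0 < pre y by have := i10 x _ px hiy; rewrite nth_index.
have hyP : y \in u :: P.
  case: (boolP (y \in u :: P)) => // ny.
  have [h1 _] := i11 y x py ny (adj_sym hxy).
  case: (boolP (x \in u :: P)) => hx; first by have := h1 hx; lia.
  have [_ h2] := i11 x y px hx hxy.
  by case: (h2 u (mem_head _ _) le_ux) => // h; lia.
have [w hw [h1 h2]] := i13 x _ u px hiy (mem_head _ _) le_ux.
have ew : w = u by apply: i6; [have := i2 w hw; lia | have := top_pre hw; lia].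
rewrite nth_index // ew in h2.
have hyP' : y \in P by move: hyP; rewrite inE => /orP[/eqP e|//]; rewrite e in lt_yu; lia.
have [_ _ _ chP] := i1.
apply: i6 => //; apply/eqP; rewrite eqn_leq (leq_trans hlow h2) andbT.
by case: (P) chP hyP' => //= p P' [_ h _ _]; rewrite inE => /orP[/eqP -> //|/h /ltnW].
Qed.

End Steps.

(* [F] is a class node and [sigma] the side of every other node with respect to
   a separation by [F]; the search starts on the side [false]. *)
Record side_inv (F : nat) (sigma : nat -> bool) (pre par : nat -> nat) (P : seq nat) : Prop := {
  sd_after : forall x, 0 < pre x -> sigma x -> x != F -> 0 < pre F < pre x;
  sd_same : forall v x, v \in P -> par v = F -> pre v <= pre x -> sigma x = sigma v;
  sd_class : forall x, 0 < pre x -> n < x -> x != F -> sigma x ->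
    exists v, [/\ v \in P, par v = F, sigma v & two v];
  sd_path : forall u, u \in P -> sigma u -> u != F ->
    exists v, [/\ v \in P, par v = F, sigma v, pre v <= pre u & (v = u) \/ two v] }.

Section Sides.
Variables (F : nat) (sigma : nat -> bool).
Hypotheses (F_class : n < F) (sigma_root : sigma root = false).
Hypothesis sigma_adj : forall x y, adj x y -> x != F -> y != F -> sigma x = sigma y.

Lemma side_inv_init : side_inv F sigma (set_fun (fun=> 0) root 1) (fun=> 0) [:: root].
Proof.
have vis x : 0 < set_fun (fun=> 0) root 1 x -> x = root by rewrite /set_fun; case: eqP.
split.
- by move=> x /vis ->; rewrite sigma_root.
- by move=> v x _ e; move: F_class; rewrite -e.
- by move=> x /vis ->; rewrite sigma_root.
- by move=> u; rewrite inE => /eqP ->; rewrite sigma_root.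
Qed.

Section Steps.
Variables (pre low par ptr : nat -> nat) (cnt : nat) (u : nat) (P : seq nat).
Hypothesis inv : search_inv pre low par ptr cnt (u :: P).
Hypothesis sinv : side_inv F sigma pre par (u :: P).

Lemma side_push (v := nth 0 (il u) (ptr u)) : ptr u < size (il u) -> pre v = 0 ->
  side_inv F sigma (set_fun pre v cnt.+1) (set_fun par v u) (v :: u :: P).
Proof.
move=> hi hv; have [pu u0] := top_visited inv; have huv : adj u v by apply: mem_nth.
have nvP : v \notin u :: P by apply/negP => /(si_path inv); lia.
have eqv : forall f c, set_fun f v c v = c :> nat by move=> *; rewrite /set_fun eqxx.
have nev : forall f c x, x != v -> set_fun f v c x = f x :> nat.
  by move=> f c x; rewrite /set_fun => /negbTE ->.
have inP x : x \in u :: P -> x != v by move=> hx; apply: contraNneq nvP => <-.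
have vis x : 0 < pre x -> x != v by move=> hx; apply: contraTneq hx => ->; rewrite hv.
case: (sinv) => j0 j1 j2 j3; have i5 := si_cnt inv.
have par_vis w : w \in u :: P -> par w = F -> [/\ F \in u :: P, pre F < pre w & adj w F].
  by move=> hw e; rewrite -e; apply: (chain_par (si_chain inv)) => //; rewrite e; lia.
have hP3 w : w \in v :: u :: P -> sigma w -> w != F ->
    exists v', [/\ v' \in v :: u :: P, set_fun par v u v' = F, sigma v',
                 set_fun pre v cnt.+1 v' <= set_fun pre v cnt.+1 w & (v' = w) \/ two v'].
  rewrite inE => /orP[/eqP ->|hw] sw nw; last first.
    have [v' [h1 h2 h3 h4 h5]] := j3 w hw sw nw.
    by exists v'; rewrite inE h1 orbT !nev ?inP.
  case: (eqVneq u F) => [eF|nuF].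
    by exists v; rewrite mem_head !eqv; split=> //; left.
  have su : sigma u by rewrite (sigma_adj huv).
  have [v' [h1 h2 h3 h4 h5]] := j3 u (mem_head _ _) su nuF.
  exists v'; rewrite inE h1 orbT eqv !nev ?inP //; split=> //; first exact: leqW.
  right; case: h5 => // e; rewrite e in h1 h2 *.
  have [_ _ huF] := par_vis u (mem_head _ _) h2.
  apply: (two_intro (w := F) (w' := v)) => //; last by rewrite eq_sym.
  by have := adj_bip (adj_sym huF); rewrite F_class => <-.
split=> //.
- move=> x hx sx nxF; case: (eqVneq x v) => [e|nx]; last first.
    rewrite (nev _ _ x) // in hx *; have h := j0 x hx sx nxF.
    by rewrite nev // vis //; lia.
  rewrite e in sx nxF *; rewrite eqv; case: (eqVneq u F) => [eF|nuF].
    by rewrite -eF nev ?inP ?mem_head // pu ltnS i5.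
  have su : sigma u by rewrite (sigma_adj huv).
  have h := j0 u pu su nuF; rewrite nev ?vis //; last by lia.
  by have := i5 F; lia.
- move=> w x; rewrite inE => /orP[/eqP ->|hw].
    rewrite !eqv => eF hx; case: (eqVneq x v) => [-> //|nx].
    by rewrite nev // in hx; have := i5 x; lia.
  rewrite !(nev _ _ w) ?inP // => eF hx; case: (eqVneq x v) => [ex|nx]; last first.
    by apply: j1 => //; rewrite nev // in hx.
  have [hF lt_F _] := par_vis w hw eF.
  have le_wu := top_pre inv hw.
  rewrite ex -(sigma_adj huv) ?(j1 w u) //.
    by apply: contraTneq lt_F => <-; lia.
  by apply: contraNneq nvP => ->.
- move=> x hx hn nxF sx; case: (eqVneq x v) => [e|nx]; last first.
    rewrite nev // in hx; have [v' [h1 h2 h3 h4]] := j2 x hx hn nxF sx.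
    by exists v'; rewrite inE h1 orbT nev ?inP.
  rewrite e in hn nxF sx *.
  have [v' [h1 h2 h3 h4 [h5|h5]]] := hP3 v (mem_head _ _) sx nxF; last by exists v'.
  rewrite h5 eqv in h2; have := adj_bip huv; rewrite h2 F_class.
  lia.
Qed.

Lemma side_pop :
  ~~ [&& n < head 0 P, pre (head 0 P) <= low u & two u] ->
  side_inv F sigma pre par P.
Proof.
move=> hnf; have [pu u0] := top_visited inv.
have inP x : x \in P -> x \in u :: P by rewrite inE => ->; rewrite orbT.
case: (sinv) => j0 j1 j2 j3.
have [eu lt_u adj_u _] := si_chain inv.
split=> //.
- by move=> v x hv; apply: j1; apply: inP.
- move=> x hx hn nxF sx; have [v [h1 h2 h3 h4]] := j2 x hx hn nxF sx.
  move: h1; rewrite inE => /orP[/eqP e|h1]; last by exists v.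
  case/negP: hnf; rewrite e in h2 h3 h4; rewrite -eu h2 F_class h4 andbT /=.
  have [] := chain_par (si_chain inv) (mem_head _ _) (_ : par u != 0); first by rewrite h2; lia.
  rewrite h2 => _ lt_Fu _.
  case: (si_low_attained inv (mem_head _ _)) => [->|[y [z [k1 k2 k3 k4]]]]; first exact: ltnW.
  rewrite -k4 leqNgt; apply/negP => lt_z.
  have sy : sigma y by rewrite (j1 u y (mem_head _ _) h2 k3).
  have nz : z != F by apply: contraTneq lt_z => ->; rewrite ltnn.
  have ny : y != F by apply: contraTneq k3 => ->; rewrite -ltnNge.
  have sz : sigma z by rewrite -(sigma_adj k1).
  by have := j0 z k2 sz nz; lia.
- move=> w hw sw nw; have [v [h1 h2 h3 h4 h5]] := j3 w (inP _ hw) sw nw.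
  exists v; split=> //; move: h1; rewrite inE => /orP[/eqP e|//].
  by have := lt_u w hw; rewrite e in h4; lia.
Qed.

End Steps.
End Sides.
End DepthFirst.

Lemma search_inv_ext root il pre low low' par ptr cnt P : low' =1 low ->
  search_inv root il pre low par ptr cnt P -> search_inv root il pre low' par ptr cnt P.
Proof.
move=> e [i1 i2 i3 i4 i5 i6 i7 i8 i9 i10 i11 i12 i13 i14]; split=> //.
- by rewrite e.
- by move=> u hu; rewrite e; apply: i12.
- by move=> y i u h1 h2 h3 /(i13 y i u h1 h2 h3)[u' h4 h5]; exists u'; rewrite ?e.
- by move=> u hu; rewrite e; apply: i14.
Qed.

(** * Reading the graph *)

Definition row (A : nat -> nat) (W u d : nat) : seq nat :=
  mkseq (fun i => A (u * W + i)) d.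

Lemma index_inj W u u' i i' : i < W -> i' < W -> u * W + i = u' * W + i' ->
  u = u' /\ i = i'.
Proof.
move=> hi hi' h; have Wp : 0 < W by lia.
have := congr1 (divn^~ W) h; rewrite !divnMDl // !divn_small // !addn0 => e.
by split=> //; move: h; rewrite e => /addnI.
Qed.

Lemma set_fun_index (T : Type) (A : nat -> T) W u u' i i' v : i < W -> i' < W ->
  set_fun A (u * W + i) v (u' * W + i') =
  if (u' == u) && (i' == i) then v else A (u' * W + i').
Proof.
move=> hi hi'; rewrite /set_fun; case: eqP => [h|h].
  by have [-> ->] := index_inj hi' hi h; rewrite !eqxx.
by case: andP => // -[/eqP eu /eqP ei]; case: h; rewrite eu ei.
Qed.

Lemma row_push A W D u v u' : D u < W -> D u' <= W ->
  row (set_fun A (u * W + D u) v) W u' (set_fun D u (D u).+1 u') =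
  if u' == u then rcons (row A W u (D u)) v else row A W u' (D u').
Proof.
move=> h h'; rewrite {2}/set_fun; case: eqP => [->|ne].
  rewrite /row /mkseq -addn1 iotaD map_cat /= cats1 add0n /set_fun eqxx; congr rcons.
  apply/eq_in_map => i; rewrite mem_iota => /andP[_ hi].
  by rewrite eqn_add2l ifF //; lia.
apply/eq_in_map => i; rewrite mem_iota => /andP[_ hi].
by rewrite set_fun_index ?(negbTE (introN eqP ne)) //=; lia.
Qed.

Lemma size_row A W u d : size (row A W u d) = d.
Proof. exact: size_mkseq. Qed.

Lemma nth_row A W u d i : i < d -> nth 0 (row A W u d) i = A (u * W + i).
Proof. exact: nth_mkseq. Qed.

Lemma sum_push (D : nat -> nat) u m : u < m ->
  \sum_(x < m) set_fun D u (D u).+1 x = (\sum_(x < m) D x).+1.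
Proof.
move=> um; rewrite (bigD1 (Ordinal um)) //= [in RHS](bigD1 (Ordinal um)) //=.
rewrite {1}/set_fun eqxx addSn; congr (_ + _).+1; apply: eq_bigr => i hi.
by rewrite /set_fun ifF //; apply/negbTE.
Qed.

(* Vertices are numbered 1, ..., n. *)
Section Algorithm.
Variables (n : nat) (E : rel nat) (es : seq (nat * nat)) (B : nat).
Local Notation N := n.+1.
Local Notation m := (size es).
Hypotheses (Esym : symmetric E) (Eirr : irreflexive E).
Hypothesis Ebnd : forall x y, E x y -> 0 < x <= n.
Hypothesis count_es : forall x y, count_mem (x, y) es + count_mem (y, x) es = E x y.
Hypothesis B_large : 8 * N ^ 3 <= B.

Lemma Ebnd2 x y : E x y -> 0 < y <= n.
Proof. by rewrite Esym; apply: Ebnd. Qed.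

Lemma N_lt_B : N < B. Proof. by move: B_large; rewrite !expnS expn0; nia. Qed.
Lemma Q_lt_B : N * N < B. Proof. by move: B_large; rewrite !expnS expn0; nia. Qed.

Definition encode (l : seq (nat * nat)) : seq int :=
  flatten [seq [:: Posz p.1.-1; Posz p.2.-1] | p <- l].

Definition input : seq int := [:: Posz n, Posz m & encode es].

Definition nbrs_ok (A D : nat -> nat) (F : rel nat) : Prop :=
  (forall x, ~~ (0 < x <= n) -> D x = 0) /\
  (forall x, 0 < x <= n -> uniq (row A N x (D x)) /\
                           forall y, (y \in row A N x (D x)) = (y == x) || F x y).

Lemma nbrs_deg A D (F : rel nat) x : (forall x y, F x y -> 0 < y <= n) ->
  nbrs_ok A D F -> D x <= n.
Proof.
move=> hF [h0 h1]; case: (boolP (0 < x <= n)) => hx; last by rewrite h0.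
have [u mem] := h1 x hx; rewrite -(size_row A N x (D x)) -[leqRHS](size_iota 1 n).
apply: uniq_leq_size => // y; rewrite mem mem_iota => /orP[/eqP ->|/hF]; lia.
Qed.

Definition seen (k : nat) : rel nat :=
  fun x y => ((x, y) \in take k es) || ((y, x) \in take k es).

Lemma seen_E k x y : seen k x y -> E x y.
Proof.
suff H u v : (u, v) \in take k es -> E u v by case/orP => /H //; rewrite Esym.
by move=> /mem_take; rewrite -has_pred1 has_count; move: (count_es u v); case: (E u v); lia.
Qed.

Lemma seen_all x y : seen m x y = E x y.
Proof.
rewrite /seen take_size; have := count_es x y.
rewrite -!has_pred1 !has_count; move: (count_mem _ es) (count_mem _ es) => a b.
by case: (E x y); lia.
Qed.

Lemma seenS k (p := nth (0, 0) es k) : k < m ->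
  [/\ E p.1 p.2, ~~ seen k p.1 p.2
    & forall x y, seen k.+1 x y =
        [|| (x == p.1) && (y == p.2), (x == p.2) && (y == p.1) | seen k x y]].
Proof.
move=> km; have Hp : E p.1 p.2.
  apply: (@seen_E k.+1); rewrite /seen (take_nth (0, 0) km) !mem_rcons !inE.
  by rewrite -surjective_pairing eqxx.
split=> //; last first.
  move=> x y; rewrite /seen (take_nth (0, 0) km) -/p (surjective_pairing p) !mem_rcons !inE /=.
  rewrite !xpair_eqE [(y == _) && _]andbC.
  by case: (_ && _); case: (_ && _); case: (_ \in _); case: (_ \in _).
have := count_es p.1 p.2; rewrite Hp -(cat_take_drop k es) (drop_nth (0, 0) km) -/p.
rewrite !count_cat /= -surjective_pairing eqxx /seen -!has_pred1 !has_count /=.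
by rewrite -surjective_pairing; lia.
Qed.

Lemma input_loop1 Q s : sv s vN = N -> sv s vx = 1 ->
  (forall u, av s aDeg u = 0) ->
  (forall t s', framed (While (Lt ($vx) ($vN)) self_loop_body) s s' ->
     nbrs_ok (av s' aNb) (av s' aDeg) (fun _ _ => false) ->
     \sum_(x < N) av s' aDeg x = n -> t <= 10 * n + 1 -> Q t s') ->
  wp B (While (Lt ($vx) ($vN)) self_loop_body) Q s.
Proof.
move=> hN hx hD HQ.
pose I (s : state) := [/\ 0 < sv s vx <= N, forall u, av s aDeg u = (0 < u < sv s vx)
   & forall u, 0 < u < sv s vx -> av s aNb (u * N) = u].
apply: (wp_while (I := I) (m := fun s => 10 * (N - sv s vx))).
- by rewrite /I hx; split=> // u; rewrite ?hD; lia.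
- move=> s1 [Fv _ _] [h1 h2 h3] /=; rewrite (Fv vN) // hN => hlt.
  have hB := N_lt_B; have hN1 : sv s1 vN = N by rewrite Fv.
  wstep; wstep; wstep; split; last by lia.
  split=> //=; first by lia.
  + by move=> u; rewrite /set_fun; case: eqP => [->|ne]; rewrite ?h2; lia.
  + move=> u hu; rewrite /set_fun hN1; case: eqP => [|ne]; first by nia.
    by apply: h3; nia.
- move=> t s1 Fr [h1 h2 h3] hc ht; apply: (HQ) => //.
  + move: hc; case: (Fr) => Fv _ _ /=; rewrite (Fv vN) // hN => hc.
    split=> x hx'; first by rewrite h2; lia.
    have -> : av s1 aDeg x = 1 by rewrite h2; lia.
    have -> : row (av s1 aNb) N x 1 = [:: x] by rewrite /row /mkseq /= addn0 h3 //; lia.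
    by split=> // y; rewrite inE orbF.
  + move: hc; case: (Fr) => Fv _ _ /=; rewrite (Fv vN) // hN => hc.
    transitivity (\sum_(x < N) (0 < x : nat)).
      by apply: eq_bigr => i _; rewrite h2; have := ltn_ord i; lia.
    by rewrite big_ord_recl /= add0n sum_nat_const card_ord muln1.
  + by move: ht; rewrite hx; lia.
Qed.

Lemma nbrs_push A D (F : rel nat) x y : (forall u v, F u v -> 0 < v <= n) ->
  nbrs_ok A D F -> 0 < x <= n -> y != x -> ~~ F x y ->
  nbrs_ok (set_fun A (x * N + D x) y) (set_fun D x (D x).+1)
    (fun u v => ((u == x) && (v == y)) || F u v).
Proof.
move=> hF ok hx nyx nF; have hD u : D u <= n by apply: nbrs_deg ok.
case: (ok) => h0 h1; split=> u hu.
  rewrite /set_fun; case: eqP => [e|_]; last exact: h0.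
  by move: hu; rewrite e hx.
have [uq mem] := h1 u hu; rewrite row_push ?ltnS // ?leqW //.
case: eqP => [eu|nu]; last by split=> // v; rewrite mem.
rewrite -eu rcons_uniq mem uq eu (negbTE nyx) (negbTE nF); split=> // v.
by rewrite mem_rcons inE -eu mem; case: eqP => // ->; rewrite eu orbT.
Qed.

Definition graph_read (s : state) : Prop :=
  [/\ forall x y, x <= n -> y <= n -> av s aM (x * N + y) = E x y,
      nbrs_ok (av s aNb) (av s aDeg) E
    & \sum_(x < N) av s aDeg x = n + m * 2].

Lemma m_leq : m <= N * N.
Proof.
have <- : size [seq (x, y) | x <- iota 0 N, y <- iota 0 N] = N * N.
  by rewrite size_allpairs !size_iota.
apply: uniq_leq_size => [|[x y] h].
  apply: count_mem_uniq => -[x y]; move: (count_es x y).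
  by rewrite -has_pred1 has_count; move: (count_mem _ es) (count_mem _ es) => a b; case: (E x y); lia.
have Exy : E x y by apply: (@seen_E m); rewrite /seen take_size h.
by apply: allpairs_f; rewrite mem_iota; move: (Ebnd Exy) (Ebnd2 Exy); lia.
Qed.

Lemma input_loop2 Q s : sv s vN = N -> sv s vm = m -> sv s vi = 0 ->
  si s = encode es -> (forall i, av s aM i = 0) ->
  nbrs_ok (av s aNb) (av s aDeg) (fun _ _ => false) ->
  \sum_(x < N) av s aDeg x = n ->
  (forall t s', framed (While (Lt ($vi) ($vm)) read_edge) s s' -> so s' = so s ->
     graph_read s' -> t <= 20 * m + 1 -> Q t s') ->
  wp B (While (Lt ($vi) ($vm)) read_edge) Q s.
Proof.
move=> hN hm hi hin hM hnb hsum HQ.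
pose I (s' : state) := [/\ sv s' vi <= m /\ so s' = so s, si s' = encode (drop (sv s' vi) es),
   forall x y, x <= n -> y <= n -> av s' aM (x * N + y) = seen (sv s' vi) x y,
   nbrs_ok (av s' aNb) (av s' aDeg) (seen (sv s' vi))
   & \sum_(x < N) av s' aDeg x = n + sv s' vi * 2].
apply: (wp_while (I := I) (m := fun s => 20 * (m - sv s vi))).
- rewrite /I hi drop0 mul0n addn0; split=> //; first by move=> *; rewrite hM /seen take0.
  split=> [x /(hnb.1 x) //|x /(hnb.2 x)[u mem]]; split=> // y.
  by rewrite mem /seen take0.
- move=> s1 [Fv _ _] [[h1 h1'] h2 h3 h4 h5] /=; rewrite (Fv vm) // hm => hlt.
  have hN1 : sv s1 vN = N by rewrite (Fv vN).
  have hB := N_lt_B; have hB2 := Q_lt_B; have hm2 := m_leq.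
  have := seenS hlt; case ep: (nth (0, 0) es (sv s1 vi)) => [x y] /= [Exy nseen seenE].
  have hx := Ebnd Exy; have hy := Ebnd2 Exy.
  have nyx : y != x by apply/eqP => e; move: Exy; rewrite e Eirr.
  have hsub u v : seen (sv s1 vi) u v -> 0 < v <= n by move=> /seen_E /Ebnd2.
  have ok1 := nbrs_push hsub h4 hx nyx nseen.
  set D1 := set_fun _ x _ in ok1; set A1 := set_fun _ _ y in ok1.
  have hsub2 u v : (u == x) && (v == y) || seen (sv s1 vi) u v -> 0 < v <= n.
    by case/orP => [/andP[_ /eqP ->]|/hsub].
  have nseen2 : ~~ ((y == x) && (x == y) || seen (sv s1 vi) y x).
    by rewrite (negbTE nyx) /= /seen orbC.
  have nxy : x != y by rewrite eq_sym.
  have ok2 := nbrs_push hsub2 ok1 hy nxy nseen2.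
  have dx : av s1 aDeg x <= n by apply: nbrs_deg h4.
  have dy : D1 y <= n by apply: nbrs_deg ok1.
  rewrite (drop_nth (0, 0) hlt) ep /encode /= in h2.
  rewrite /read_edge; apply: wp_seq; apply: (wp_read h2) => /=; first by lia.
  apply: wp_seq; apply: (@wp_read _ _ y.-1 (encode (drop (sv s1 vi).+1 es))) => //=; first by lia.
  wstep; wstep; rewrite !addn1 !prednK ?hN1; try lia.
  do 6 (wstep; rewrite ?prednK ?hN1 ?addn1; try lia).
  { by move: dy; rewrite /D1; lia. }
  wstep; split; last by lia.
  rewrite /I /= addn1; split=> //.
  + move=> u v hu hv; rewrite !set_fun_index //; try lia.
    rewrite h3 // seenE; case: ((u == x) && _); case: ((u == y) && _) => //.
  + case: ok2 => o1 o2; split=> // u hu; have [uq mem] := o2 u hu; split=> // v.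
    by rewrite mem seenE; case: (v == u) => //=; case: (_ && _); case: (_ && _).
  + rewrite (sum_push D1) ?(sum_push (av s1 aDeg)) ?h5; try lia.
- move=> t s1 Fr [[h1 h1'] h2 h3 h4 h5] hc ht; apply: HQ => //.
    have e : sv s1 vi = m.
      by move: hc; case: (Fr) => Fv _ _ /=; rewrite (Fv vm) // hm; lia.
    rewrite e in h3 h4 h5; split=> //.
    + by move=> x y hx hy; rewrite h3 // seen_all.
    + case: h4 => o1 o2; split=> // x hx; have [uq mem] := o2 x hx; split=> // y.
      by rewrite mem seen_all.
  by move: ht; rewrite hi; lia.
Qed.

Lemma read_graph_correct Q :
  (forall t s, sv s vn = n -> sv s vN = N -> sv s vQ = N * N ->
     (forall x, vz <= x -> sv s x = 0) -> (forall k, aNb < k -> av s k = fun=> 0) ->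
     so s = [::] -> graph_read s -> t <= 20 * (n + m) + 20 -> Q t s) ->
  wp B read_graph Q (init input).
Proof.
move=> HQ; have hB := N_lt_B; have hB2 := Q_lt_B; have hm := m_leq.
rewrite /read_graph; apply: wp_seq; apply: (@wp_read _ _ n) => //=; first by lia.
apply: wp_seq; apply: (@wp_read _ _ m) => //=; first by lia.
wstep; rewrite addn1.
wstep; wstep; apply: wp_seq; apply: input_loop1 => //= t1 s1 [Fv1 Fa1 Fo1] hnb1 hs1 ht1.
have [Ei1 Eo1] := Fo1 isT; wstep.
apply: input_loop2 => //=; rewrite ?(Fv1 vN) ?(Fv1 vm) ?(Fa1 aM) //.
move=> t2 s2 [Fv2 Fa2 _] Eo2 hg ht2.
apply: HQ => //.
- by rewrite (Fv2 vn) //= (Fv1 vn).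
- by rewrite (Fv2 vN) //= (Fv1 vN).
- by rewrite (Fv2 vQ) //= (Fv1 vQ).
- move=> x hx; rewrite Fv2 ?/set_key /=; last by rewrite !inE /=; lia.
  rewrite !ifF; try lia; rewrite Fv1 ?/set_key /=; last by rewrite !inE /=; lia.
  by rewrite /set_key !ifF //; lia.
- move=> k hk; rewrite Fa2 ?/set_key /=; last by rewrite !inE /=; lia.
  by rewrite Fa1 //= !inE /=; lia.
- by rewrite Eo2 /= Eo1.
- by lia.
Qed.

(** * Classifying the edges *)

Definition common x y z := ((z == x) || E z x) && ((z == y) || E z y).

Definition class_of (s : state) x y := av s aM (x * N + y).

Definition classified (s : state) : Prop :=
  [/\ forall x y, x <= n -> y <= n -> ~~ E x y -> class_of s x y = 0,
      forall x y, E x y -> 0 < class_of s x y <= n ^ 3 + 1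
    & forall x y u v, E x y -> E u v ->
        (class_of s x y = class_of s u v <-> common x y =1 common u v)].

Section Classify.
Variables (s0 : state).
Hypotheses (s0n : sv s0 vn = n) (s0N : sv s0 vN = N).
Hypothesis s0_read : graph_read s0.

Local Notation L z := (row (av s0 aNb) N z (av s0 aDeg z)).
Local Notation d z := (av s0 aDeg z).

Lemma mem_L z y : 0 < z <= n -> (y \in L z) = (y == z) || E z y.
Proof. by move=> hz; case: s0_read => _ [_ /(_ z hz)[_ ->]]. Qed.

Lemma uniq_L z : 0 < z <= n -> uniq (L z).
Proof. by move=> hz; case: s0_read => _ [_ /(_ z hz)[]]. Qed.

Lemma L_bound z y : 0 < z <= n -> y \in L z -> 0 < y <= n.
Proof. by move=> hz; rewrite mem_L // => /orP[/eqP -> //|/Ebnd2]. Qed.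

Lemma deg_leq z : d z <= n.
Proof. by case: s0_read => _ h _; apply: nbrs_deg Ebnd2 h. Qed.

(* In round z the pairs of L z x L z are visited in lexicographic order; the ones
   before position (i, j) are done. *)
Definition done z i j x y :=
  ((x \in take i (L z)) && (y \in L z)) ||
  [&& i < d z, x == nth 0 (L z) i & y \in take j (L z)].

Lemma done_next z i j x y : 0 < z <= n -> i < d z -> j < d z ->
  done z i j.+1 x y =
  done z i j x y || ((x == nth 0 (L z) i) && (y == nth 0 (L z) j)).
Proof.
move=> hz hi hj; rewrite /done hi /= (take_nth 0) ?size_row // mem_rcons inE.
by case: (x == _); case: (y == _); rewrite /= ?orbT ?orbF.
Qed.

Lemma not_done z i j : 0 < z <= n -> i < d z -> j < d z ->
  done z i j (nth 0 (L z) i) (nth 0 (L z) j) = false.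
Proof.
move=> hz hi hj; have u := uniq_L hz.
have H k : k < d z -> (nth 0 (L z) k \in take k (L z)) = false.
  move=> hk; apply/negbTE/negP => h; have := u.
  rewrite -(cat_take_drop k (L z)) cat_uniq => /and3P[_ /hasPn /(_ (nth 0 (L z) k)) h2 _].
  by rewrite (drop_nth 0) ?size_row // inE eqxx h in h2; have := h2 isT.
by rewrite /done !H // !andbF.
Qed.

Lemma done_row z i x y : 0 < z <= n -> i < d z ->
  done z i (d z) x y = done z i.+1 0 x y.
Proof.
move=> hz hi; rewrite /done hi take0 in_nil !andbF orbF.
rewrite (take_oversize (n := d z)) ?size_row // [in RHS](take_nth 0) ?size_row //.
by rewrite mem_rcons inE; case: (x == _); case: (y \in _); rewrite ?andbF ?andbT ?orbT ?orbF.
Qed.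

Lemma done_all z x y : 0 < z <= n -> done z (d z) 0 x y = common x y z.
Proof.
move=> hz; rewrite /done ltnn /= orbF take_oversize ?size_row // !mem_L //.
by rewrite /common ![_ == z]eq_sym.
Qed.

Definition prefix_key z x y := [seq z' <- iota 1 z | common x y z'].

Definition key z i j x y :=
  if done z i j x y then rcons (prefix_key z.-1 x y) z else prefix_key z.-1 x y.

Lemma key_round z x y : 0 < z <= n -> key z (d z) 0 x y = prefix_key z x y.
Proof.
case: z => [|z] // hz; rewrite /key done_all // /prefix_key -[in RHS](addn1 z) iotaD filter_cat /= add1n.
by case: ifP; rewrite ?cats0 ?cats1.
Qed.

Lemma key_start z x y : key z.+1 0 0 x y = prefix_key z x y.
Proof. by rewrite /key /done !take0 !in_nil /= !andbF. Qed.

(* [f t] is the sequence of vertices spelled by trie node [t]. *)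
Record trie_inv (f : nat -> seq nat) (K : nat -> nat -> seq nat) (s : state) : Prop := {
  trie_root : 0 < sv s vcnt /\ f 1 = [::];
  trie_inj : forall t t', 0 < t <= sv s vcnt -> 0 < t' <= sv s vcnt -> f t = f t' -> t = t';
  trie_child : forall c z (t := av s aTrie (c * N + z)),
    0 < c <= sv s vcnt -> 0 < z <= n ->
    if t == 0 then forall t', 0 < t' <= sv s vcnt -> f t' <> rcons (f c) z
    else 0 < t <= sv s vcnt /\ f t = rcons (f c) z;
  trie_fresh : forall c z, sv s vcnt < c -> z <= n -> av s aTrie (c * N + z) = 0;
  trie_prefix : forall t p z, 0 < t <= sv s vcnt -> f t = rcons p z ->
    exists2 t', 0 < t' <= sv s vcnt & f t' = p;
  trie_edge : forall x y, E x y ->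
    0 < class_of s x y <= sv s vcnt /\ f (class_of s x y) = K x y;
  trie_nonedge : forall x y, x <= n -> y <= n -> ~~ E x y -> class_of s x y = 0 }.

Lemma trie_inv_ext f K K' s s' : trie_inv f K s ->
  sv s' vcnt = sv s vcnt -> av s' aTrie = av s aTrie -> av s' aM = av s aM ->
  (forall x y, E x y -> K x y = K' x y) -> trie_inv f K' s'.
Proof.
case=> h1 h2 h3 h4 h5 h6 h7 e1 e2 e3 h.
split; rewrite ?e1 ?e2 // /class_of e3 // => x y Exy; rewrite -h //; exact: h6.
Qed.

Lemma row_loop Q s z i : 0 < z <= n -> i < d z ->
  sv s vz = z -> sv s vN = N -> sv s vx = nth 0 (L z) i -> sv s vj = 0 ->
  av s aNb = av s0 aNb -> av s aDeg = av s0 aDeg ->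
  sv s vcnt <= 1 + z.-1 * (n * n) + i * n ->
  (exists f, trie_inv f (key z i 0) s) ->
  (forall t s', framed (While (Lt ($vj) (Arr aDeg ($vz))) trie_step) s s' ->
     sv s' vcnt <= 1 + z.-1 * (n * n) + i * n + d z ->
     (exists f, trie_inv f (key z i (d z)) s') -> t <= 12 * d z + 1 -> Q t s') ->
  wp B (While (Lt ($vj) (Arr aDeg ($vz))) trie_step) Q s.
Proof.
move=> hz hi hsz hsN hsx hsj hNb hDeg hcnt hT HQ.
pose I (s : state) := [/\ sv s vj <= d z, sv s vcnt <= 1 + z.-1 * (n * n) + i * n + sv s vj
  & exists f, trie_inv f (key z i (sv s vj)) s].
apply: (wp_while (I := I) (m := fun s => 12 * (d z - sv s vj))).
- by rewrite /I hsj; split=> //; rewrite addn0.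
- move=> s1 [Fv Fa _] [h1 h2 [f hf]] /=; rewrite (Fa aDeg) // (Fv vz) // hsz hDeg => hlt.
  have hN1 : sv s1 vN = N by rewrite (Fv vN).
  have hz1 : sv s1 vz = z by rewrite (Fv vz).
  have hx1 : sv s1 vx = nth 0 (L z) i by rewrite (Fv vx).
  have hNb1 : av s1 aNb = av s0 aNb by rewrite (Fa aNb).
  have dn := deg_leq z.
  have hB : sv s1 vcnt + 2 * N < B.
    move: B_large h2; rewrite !expnS expn0 => hb h2.
    have : z.-1 * (n * n) <= n.-1 * (n * n) by apply: leq_mul; lia.
    have : i * n <= n * n by apply: leq_mul; lia.
    case: (n) hb h2 dn => [|k] /=; nia.
  have ey : av s1 aNb (z * N + sv s1 vj) = nth 0 (L z) (sv s1 vj) by rewrite hNb1 nth_row.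
  set j := sv s1 vj in h1 h2 hf hlt ey *.
  set x := nth 0 (L z) i in hx1; set y := nth 0 (L z) j in ey.
  have hx : 0 < x <= n by apply: (L_bound hz); apply: mem_nth; rewrite size_row.
  have hy : 0 < y <= n by apply: (L_bound hz); apply: mem_nth; rewrite size_row.
  have hnd : done z i j x y = false by apply: not_done.
  rewrite /trie_step; wstep; rewrite hz1 hN1 ey; first by lia.
  have [hroot hinj hchild hfresh hprefix hedge hnon] := hf.
  move Ec : (class_of s1 x y) => c.
  wstep; rewrite hx1 hN1 -/(class_of s1 x y) Ec.
    case: (boolP (E x y)) => Exy; last by move: (hnon x y); rewrite Ec; lia.
    by have := hedge x y Exy; rewrite Ec; lia.
  apply: wp_seq; apply: wp_if => /= hc; last first.
    apply: wp_skip; wstep; split; last by lia.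
    rewrite /I /= addn1; split=> //; first by lia.
    exists f; apply: trie_inv_ext (hf) _ _ _ _ => // u v Euv.
    rewrite /key done_next //; case: (altP andP) => [[/eqP eu /eqP ev]|]; last by rewrite orbF.
    by have := hedge u v Euv; rewrite eu ev Ec; lia.
  have Exy : E x y.
    by apply: contraTT hc => nE; rewrite -Ec hnon //; lia.
  have := hedge x y Exy; rewrite Ec /key hnd => -[c_le fc].
  wstep; rewrite ?hz1 ?hN1.
    have := hchild c z c_le hz; case: ifP => [/eqP -> _|_ []]; lia.
  have ch := hchild c z c_le hz; cbv zeta in ch.
  apply: wp_seq; apply: wp_if => /= ht.
  + rewrite ht in ch; wstep; rewrite ?addn1; wstep; wstep; rewrite ?hz1 ?hN1.
    wstep; rewrite ?hx1 ?hN1; wstep; split; last by lia.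
    rewrite /I /= addn1; split=> //; first by lia.
    set t := (sv s1 vcnt).+1.
    exists (set_fun f t (rcons (prefix_key z.-1 x y) z)).
    have fold u : u <= sv s1 vcnt -> set_fun f t (rcons (prefix_key z.-1 x y) z) u = f u.
      by move=> hu; rewrite /set_fun ifF // /t; lia.
    have fnew : set_fun f t (rcons (prefix_key z.-1 x y) z) t = rcons (f c) z.
      by rewrite /set_fun eqxx fc.
    split; rewrite /class_of /=.
    * by case: hroot => h0 h0'; split=> //; rewrite fold.
    * move=> u v hu hv; case: (eqVneq u t) => [->|nu]; case: (eqVneq v t) => [->|nv] //.
      - rewrite fnew fold; last by rewrite /t in nv *; lia.
        move=> e; case: (ch v); first by rewrite /t in nv *; lia.
        by rewrite e.
      - rewrite fnew fold; last by rewrite /t in nu *; lia.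
        move=> e; case: (ch u); first by rewrite /t in nu *; lia.
        by rewrite e.
      - by rewrite !fold; try (rewrite /t in nu nv *; lia); apply: hinj; rewrite /t in nu nv *; lia.
    * move=> c' z' hc' hz'; rewrite set_fun_index; try lia.
      case: (altP andP) => [[/eqP ec /eqP ez]|nn].
        by rewrite ec ez fnew fold; [rewrite (_ : (t == 0) = false) //; split=> //; rewrite /t | ]; lia.
      case: (eqVneq c' t) => [et|nt].
        rewrite et hfresh ?fnew /t; try lia.
        move=> t' ht'; case: (eqVneq t' t) => [->|nt'].
          by rewrite fnew => /(congr1 size); rewrite !size_rcons; lia.
        rewrite fold; last by rewrite /t in nt'; lia.
        move=> e; have [|t'' ht'' e''] := hprefix t' _ _ _ e; first by rewrite /t in nt'; lia.
        exact: ch ht'' e''.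
      have hc2 : 0 < c' <= sv s1 vcnt by rewrite /t in nt; lia.
      have := hchild c' z' hc2 hz'; rewrite (fold c'); last by lia.
      case: ifP => [_ H t' ht'|_ [H1 H2]]; last by split; rewrite ?fold //; lia.
      case: (eqVneq t' t) => [->|nt']; last by rewrite fold; rewrite /t in nt'; try apply: H; lia.
      rewrite fnew => /rcons_inj[e ez]; case/negP: nn; rewrite ez eqxx andbT.
      by apply/eqP/esym; apply: hinj.
    * move=> c' z' hc' hz'; rewrite set_fun_index; try lia.
      by rewrite ifF ?hfresh //; rewrite /t in hc'; lia.
    * move=> t' p z' ht'; case: (eqVneq t' t) => [->|nt'].
        rewrite fnew => /rcons_inj[<- _]; exists c; last by rewrite fold //; lia.
        by rewrite /t; lia.
      rewrite fold; last by rewrite /t in nt'; lia.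
      move=> e; have [|t'' ht'' e''] := hprefix t' _ _ _ e; first by rewrite /t in nt'; lia.
      by exists t''; rewrite ?fold //; rewrite /t; lia.
    * move=> u v Euv; have hu := Ebnd Euv; have hv := Ebnd2 Euv.
      rewrite set_fun_index; try lia.
      rewrite /key done_next // -/j -/x -/y.
      case: (boolP ((u == x) && (v == y))) => [/andP[/eqP eu /eqP ev]|nuv].
        by rewrite orbT fnew eu ev fc /t; split=> //; lia.
      have [h3 h4] := hedge u v Euv.
      rewrite /class_of in h3 h4; rewrite orbF fold; last by lia.
      by rewrite h4; split=> //; rewrite /t; lia.
    * move=> u v hu hv nE; rewrite set_fun_index; try lia.
      case: (altP andP) => [[/eqP eu /eqP ev]|nuv]; last exact: hnon.
      by rewrite eu ev Exy in nE.
  + rewrite (negbTE ht) in ch; apply: wp_skip; wstep.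
    rewrite ?hx1 ?hN1 ?hz1; wstep; split; last by lia.
    rewrite /I /= addn1; split=> //; first by lia.
    exists f; split=> //; rewrite /class_of /=.
    * move=> u v Euv; have hu := Ebnd Euv; have hv := Ebnd2 Euv.
      rewrite set_fun_index; try lia.
      rewrite /key done_next // -/j -/x -/y.
      case: (boolP ((u == x) && (v == y))) => [/andP[/eqP eu /eqP ev]|nuv].
        by rewrite orbT; case: ch => ch1 ->; rewrite eu ev fc.
      by rewrite orbF; apply: hedge.
    * move=> u v hu hv nE; rewrite set_fun_index; try lia.
      case: (altP andP) => [[/eqP eu /eqP ev]|nuv]; last exact: hnon.
      by rewrite eu ev Exy in nE.
- move=> t s1 Fr [h1 h2 h3] hc ht; have e : sv s1 vj = d z.
    by case: (Fr) hc => Fv Fa _ /=; rewrite (Fa aDeg) // (Fv vz) // hsz hDeg; lia.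
  by rewrite e in h2 h3; apply: HQ => //; rewrite hsj in ht; lia.
Qed.

Lemma round_loop Q s z : 0 < z <= n ->
  sv s vz = z -> sv s vN = N -> sv s vi = 0 ->
  av s aNb = av s0 aNb -> av s aDeg = av s0 aDeg ->
  sv s vcnt <= 1 + z.-1 * (n * n) ->
  (exists f, trie_inv f (key z 0 0) s) ->
  (forall t s', framed (While (Lt ($vi) (Arr aDeg ($vz))) trie_row) s s' ->
     sv s' vcnt <= 1 + z * (n * n) ->
     (exists f, trie_inv f (prefix_key z) s') -> t <= (12 * d z + 5) * d z + 1 -> Q t s') ->
  wp B (While (Lt ($vi) (Arr aDeg ($vz))) trie_row) Q s.
Proof.
move=> hz hsz hsN hsi hNb hDeg hcnt hT HQ.
have hB := N_lt_B; have dn := deg_leq z.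
pose I (s : state) := [/\ sv s vi <= d z, sv s vcnt <= 1 + z.-1 * (n * n) + sv s vi * n
  & exists f, trie_inv f (key z (sv s vi) 0) s].
apply: (wp_while (I := I) (m := fun s => (12 * d z + 5) * (d z - sv s vi))).
- by rewrite /I hsi; split=> //; rewrite addn0.
- move=> s1 [Fv Fa _] [h1 h2 [f hf]] /=; rewrite (Fa aDeg) // (Fv vz) // hsz hDeg => hlt.
  have hN1 : sv s1 vN = N by rewrite (Fv vN).
  have hz1 : sv s1 vz = z by rewrite (Fv vz).
  have hNb1 : av s1 aNb = av s0 aNb by rewrite (Fa aNb).
  have hD1 : av s1 aDeg = av s0 aDeg by rewrite (Fa aDeg).
  have ex : av s1 aNb (z * N + sv s1 vi) = nth 0 (L z) (sv s1 vi) by rewrite hNb1 nth_row.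
  have hx : 0 < nth 0 (L z) (sv s1 vi) <= n.
    by apply: (L_bound hz); apply: mem_nth; rewrite size_row.
  rewrite /trie_row; wstep; wstep; rewrite hz1 hN1 ex; first by lia.
  apply: wp_seq; apply: (row_loop hz hlt) => //=; first by exists f; apply: trie_inv_ext hf _ _ _ _.
  move=> t s2 [Fv2 Fa2 _] h2' hT2 ht; wstep; rewrite (Fv2 vi) //=; first by lia.
  split; last by nia.
  rewrite /I /= addn1; split; [by lia | by rewrite mulSn; lia |].
  case: hT2 => g hg; exists g; apply: trie_inv_ext hg _ _ _ _ => // x y _.
  by rewrite /key done_row.
- move=> t s1 Fr [h1 h2 [f h3]] hc ht; have e : sv s1 vi = d z.
    by case: (Fr) hc => Fv Fa _ /=; rewrite (Fa aDeg) // (Fv vz) // hsz hDeg; lia.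
  rewrite e in h2 h3; apply: HQ => //; last by rewrite hsi in ht; lia.
    have : d z * n <= n * n by rewrite leq_mul2r dn orbT.
    by case: (z) hz h2 => [|z'] //= _; rewrite mulSn; lia.
  by exists f; apply: trie_inv_ext h3 _ _ _ _ => // x y _; rewrite key_round.
Qed.

Definition trie_cost z := (12 * d z + 5) * d z + 5.

Lemma common_range x y z : 0 < x <= n -> common x y z -> 0 < z <= n.
Proof. by move=> hx /andP[/orP[/eqP -> //|/Ebnd]]. Qed.

Lemma classify_correct Q : (forall i, av s0 aTrie i = 0) ->
  (forall t s, framed classify s0 s -> classified s ->
     t <= \sum_(1 <= z < N) trie_cost z + 3 -> Q t s) ->
  wp B classify Q s0.
Proof.
move=> hTrie HQ; have hB := N_lt_B; have [hM _ _] := s0_read.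
apply: wp_framed; rewrite /classify; wstep; wstep.
pose I (s : state) := [/\ 0 < sv s vz <= N, sv s vcnt <= 1 + (sv s vz).-1 * (n * n)
  & exists f, trie_inv f (prefix_key (sv s vz).-1) s].
apply: (wp_while (I := I) (m := fun s => \sum_(sv s vz <= z < N) trie_cost z)).
- split=> //=; exists (fun=> [::]); split=> //=.
  + by lia.
  + by move=> c z hc hz; rewrite hTrie; case=> [|t] // _ /(congr1 size); rewrite size_rcons.
  + by move=> t p z _ /(congr1 size); rewrite size_rcons.
  + by move=> x y Exy; rewrite /class_of hM ?Exy //; move: (Ebnd Exy) (Ebnd2 Exy); lia.
  + by move=> x y hx hy nE; rewrite /class_of hM // (negbTE nE).
- move=> s1 [Fv Fa _] [h1 h2 [f hf]] /=; rewrite (Fv vN) //= s0N => hlt.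
  have hz : 0 < sv s1 vz <= n by lia.
  rewrite /trie_round; wstep; apply: wp_seq; apply: (round_loop hz) => //=.
  + by rewrite (Fv vN).
  + by rewrite (Fa aNb).
  + by rewrite (Fa aDeg).
  + exists f; apply: trie_inv_ext hf _ _ _ _ => // x y _.
    by rewrite -(prednK (proj1 (andP hz))) key_start.
  move=> t s2 [Fv2 Fa2 _] h2' hT2 ht; wstep; rewrite (Fv2 vz) //=; first by lia.
  rewrite addn1; split; last first.
    by rewrite [X in _ < X]big_ltn //; move: ht; rewrite -/(trie_cost _) /trie_cost; lia.
  split=> /=; [by lia | by [] |].
  by case: hT2 => g hg; exists g; apply: trie_inv_ext hg _ _ _ _.
- move=> t s1 Fr [h1 h2 [f hf]] hc /= ht Frr; have e : sv s1 vz = N.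
    by case: (Fr) hc => Fv Fa _ /=; rewrite (Fv vN) //= s0N; lia.
  apply: HQ => //; last by lia.
  case: hf => hr hi _ _ _ hedge hnon; rewrite e /= in h2 hedge; split=> //.
  + move=> x y Exy; have [h _] := hedge x y Exy.
    by rewrite !expnS expn0 muln1; lia.
  + move=> x y u v Exy Euv; have [b1 f1] := hedge x y Exy; have [b2 f2] := hedge u v Euv.
    have hk : prefix_key n x y = prefix_key n u v <-> common x y =1 common u v.
      split=> [eq_k z|eq_c]; last by apply: eq_filter.
      have := mem_filter (common x y) z (iota 1 n).
      rewrite -/(prefix_key n x y) eq_k mem_filter mem_iota (_ : (_ <= _ < _) = (0 < z <= n)) //.
      case: (boolP (0 < z <= n)) => hz; first by rewrite !andbT => ->.
      move=> _; case: (boolP (common x y z)) => [/(common_range (Ebnd Exy))|_].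
        by rewrite (negbTE hz).
      by case: (boolP (common u v z)) => // /(common_range (Ebnd Euv)); rewrite (negbTE hz).
    rewrite -hk -f1 -f2; split=> [-> //|]; exact: hi.
Qed.

End Classify.

(** * The incidence graph of vertices and classes *)

(* The name of the class of xy as a node of the incidence graph; vertices are
   the nodes 1, ..., n. *)
Definition node (s : state) x y := class_of s x y + N.

Definition incident (s : state) u := row (av s aInc) (N * N) u (av s aIdeg u).

Definition nodes := n ^ 3 + 2 + N.

Record incidence_built (s : state) : Prop := {
  mem_incident : forall u w, (w \in incident s u) <->
    (exists y, E u y /\ w = node s u y) \/ (exists y, E w y /\ u = node s w y);
  two_classes : forall x, 0 < x <= n -> (av s aTwo x != 0 <->
    exists y y', [/\ E x y, E x y' & class_of s x y != class_of s x y']);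
  root_two : if sv s vroot == 0 then forall x, 0 < x <= n -> av s aTwo x = 0
             else (0 < sv s vroot <= n) && (av s aTwo (sv s vroot) != 0);
  idegs : (forall u, av s aIdeg u <= n * n) /\
    \sum_(u < nodes) av s aIdeg u <= 2 * \sum_(1 <= x < N) av s aDeg x }.

Section Incidence.
Variables (s0 : state).
Hypotheses (s0N : sv s0 vN = N) (s0Q : sv s0 vQ = N * N) (s0root : sv s0 vroot = 0).
Hypotheses (s0_nbrs : nbrs_ok (av s0 aNb) (av s0 aDeg) E) (s0_class : classified s0).
Hypotheses (s0Ideg : forall u, av s0 aIdeg u = 0) (s0Two : forall u, av s0 aTwo u = 0).

Local Notation L z := (row (av s0 aNb) N z (av s0 aDeg z)).
Local Notation d z := (av s0 aDeg z).
Local Notation nd := (node s0).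
Local Notation W := (N * N).

(* b is a class node met by vertex a through an edge processed before the i-th
   neighbour of x. *)
Definition reached x i a b := has (fun y => [&& E a y, b == nd a y
  & (a < x) || ((a == x) && (y \in take i (L x)))]) (iota 1 n).

Lemma reachedP x i a b : reflect
  (exists y, [/\ E a y, b = nd a y & (a < x) || ((a == x) && (y \in take i (L x)))])
  (reached x i a b).
Proof.
apply: (iffP hasP) => [[y _ /and3P[h1 /eqP h2 h3]]|[y [h1 h2 h3]]]; exists y => //.
  by rewrite mem_iota; move: (Ebnd2 h1); lia.
by rewrite h1 h2 eqxx.
Qed.

Lemma reached_next x i a b (y := nth 0 (L x) i) : i < d x ->
  reached x i.+1 a b = reached x i a b || [&& E x y, a == x & b == nd x y].
Proof.
move=> hi; apply/reachedP/orP.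
  case=> y' [h1 h2]; rewrite (take_nth 0) ?size_row // mem_rcons inE -/y.
  case: (ltngtP a x) => //= hax; first by left; apply/reachedP; exists y'; split=> //; rewrite hax.
  case/orP => [/eqP e|h3]; last by left; apply/reachedP; exists y'; split=> //; rewrite hax eqxx h3 orbT.
  by right; rewrite h2 -e hax -hax h1 eqxx.
rewrite (take_nth 0) ?size_row //; case=> [/reachedP[y' [h1 h2 h3]]|/and3P[h1 /eqP h2 /eqP h3]].
  exists y'; split=> //; rewrite mem_rcons inE.
  by case/orP: h3 => [->//|/andP[-> ->]]; rewrite !orbT.
by exists y; rewrite h2 h3 eqxx mem_rcons inE eqxx orbT.
Qed.

Lemma reached_row x a b : 0 < x <= n -> reached x (d x) a b = reached x.+1 0 a b.
Proof.
move=> hx; have [_ mem] := s0_nbrs.2 x hx; apply: eq_has => y.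
rewrite take0 in_nil andbF orbF take_oversize ?size_row // mem.
have -> : (a < x.+1) = (a < x) || (a == x) by rewrite ltnS leq_eqVlt orbC.
case: (boolP (E a y)) => //= Eay; case: (b == _) => //=.
by case: (a =P x) => [<-|_]; rewrite ?Eay ?orbT ?orbF.
Qed.

Record inc_inv x i (s : state) : Prop := {
  ii_mem : forall u w, (w \in incident s u) = reached x i u w || reached x i w u;
  ii_two : forall u, 0 < u <= n ->
    (av s aTwo u != 0) = has (fun w => w != av s aInc (u * W)) (incident s u);
  ii_root : if sv s vroot == 0 then forall u, 0 < u <= n -> av s aTwo u = 0
            else (0 < sv s vroot <= n) && (av s aTwo (sv s vroot) != 0);
  ii_deg : forall u, av s aIdeg u <= x.-1 * n + i;
  ii_sum : \sum_(u < nodes) av s aIdeg u <= 2 * (\sum_(1 <= z < x) d z + i) }.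

Lemma inc_inv_ext x i x' i' s s' : inc_inv x i s ->
  av s' aInc = av s aInc -> av s' aIdeg = av s aIdeg -> av s' aTwo = av s aTwo ->
  sv s' vroot = sv s vroot ->
  (forall a b, reached x' i' a b = reached x i a b) ->
  x.-1 * n + i <= x'.-1 * n + i' ->
  \sum_(1 <= z < x) d z + i <= \sum_(1 <= z < x') d z + i' ->
  inc_inv x' i' s'.
Proof.
case=> h1 h2 h3 h4 h5 e1 e2 e3 e4 hr hb hs.
split; rewrite /incident ?e1 ?e2 ?e3 ?e4 //.
- by move=> u w; rewrite !hr -h1.
- by move=> u; apply: leq_trans (h4 u) hb.
- by apply: leq_trans h5 _; lia.
Qed.

Lemma deg_leq0 z : d z <= n.
Proof. exact: nbrs_deg Ebnd2 s0_nbrs. Qed.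

Lemma incidence_step_correct Q s x : 0 < x <= n -> sv s vi < d x ->
  sv s vx = x -> sv s vN = N -> sv s vQ = W ->
  av s aM = av s0 aM -> av s aNb = av s0 aNb -> inc_inv x (sv s vi) s ->
  (forall t s', framed incidence_step s s' -> sv s' vi = (sv s vi).+1 ->
     inc_inv x (sv s vi).+1 s' -> t <= 11 -> Q t s') ->
  wp B incidence_step Q s.
Proof.
move=> hx hi hsx hsN hsQ hM hNb hI HQ; apply: wp_framed.
have dn := deg_leq0 x; have hB := Q_lt_B.
have hBn : nodes + n < B.
  by move: B_large; rewrite /nodes !expnS expn0; case: (n) hx => [|k] _; [lia|nia].
have hB3 : x.-1 * n + d x < W.
  have : x.-1 * n <= n.-1 * n by rewrite leq_mul2r; lia.
  by case: (n) hx dn => [|k] _ dn /=; nia.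
set i := sv s vi in hi hI *; set y := nth 0 (L x) i.
have [uq mem] := s0_nbrs.2 x hx.
have hyL : y \in L x by apply: mem_nth; rewrite size_row.
have hy : 0 < y <= n by move: hyL; rewrite mem => /orP[/eqP ->|/Ebnd2].
have ey : av s aNb (x * N + i) = y by rewrite hNb /y nth_row.
have ec : av s aM (x * N + y) = class_of s0 x y by rewrite hM.
have [c0 cpos _] := s0_class.
rewrite /incidence_step; wstep; rewrite hsx hsN ey ec.
  case: (boolP (E x y)) => Exy; last by rewrite c0; lia.
  by have := cpos x y Exy; move: hBn; rewrite /nodes; lia.
apply: wp_seq; apply: wp_if => /= hc; last first.
  apply: wp_skip; wstep; move=> F; apply: HQ => //=; first by rewrite addn1.
  apply: inc_inv_ext hI _ _ _ _ _ _ _ => // [a b||]; try lia.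
  rewrite reached_next // -/y; case: (boolP (E x y)) => Exy; last by rewrite /= orbF.
  by have := cpos x y Exy; lia.
have Exy : E x y by apply: contraTT hc => nE; rewrite c0 //; lia.
have hnd : N < nd x y < nodes by rewrite /nodes /node; have := cpos x y Exy; lia.
have [hmem htwo hroot hdeg hsum] := hI.
have dx := hdeg x.
wstep; first by move: hnd; rewrite /node; lia.
rewrite hsN -/(node s0 x y); set c := nd x y in hnd *.
set A := av s aInc; set D := av s aIdeg.
have hdD : forall u, D u <= x.-1 * n + i := hdeg.
have hdx := hdD x.
set A1 := set_fun A (x * W + D x) c; set D1 := set_fun D x (D x).+1.
have dc : D1 c <= x.-1 * n + i by rewrite /D1 /set_fun ifF; [exact: hdD | lia].
set A2 := set_fun A1 (c * W + D1 c) x; set D2 := set_fun D1 c (D1 c).+1.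
wstep; rewrite hsx hsQ -/A -/D -/A1.
wstep; rewrite hsx ?addn1 -/D; first by move: dx; rewrite -/D; lia.
rewrite -/D1.
wstep; rewrite ?hsx ?hsQ -/A1 -/D1 -/A2.
wstep; rewrite -/D1 addn1 -/D2.
have EA2 u : 0 < u <= n -> A2 (u * W) = if (u == x) && (D x == 0) then c else A (u * W).
  move=> hu; rewrite -[u * W]addn0 /A2 set_fun_index; try lia.
  rewrite (_ : (u == c) = false) /=; last by lia.
  by rewrite /A1 set_fun_index; try lia; rewrite [0 == _]eq_sym.
have Hrow u : row A2 W u (D2 u) = if u == c then rcons (row A W c (D c)) x
    else if u == x then rcons (row A W x (D x)) c else row A W u (D u).
  have hD1 v : D1 v <= W by rewrite /D1 /set_fun; case: ifP => _; have := hdD v; lia.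
  have hD v : D v <= W by have := hdD v; lia.
  rewrite /A2 /D2 row_push ?hD1 //; try lia.
  by case: eqP => [_|_]; rewrite /A1 /D1 row_push ?hD //; try lia; rewrite ifF //; lia.
have Hmem u w : (w \in row A2 W u (D2 u)) = reached x i.+1 u w || reached x i.+1 w u.
  rewrite !reached_next // -/y Exy /= Hrow -/c.
  have H := hmem u w; rewrite /incident -/A -/D in H.
  case: (eqVneq u c) => [uc|nuc].
    rewrite mem_rcons inE -uc H (_ : (u == x) = false) /=; last by lia.
    by rewrite orbF; case: (w == x); rewrite ?orbT ?orbF.
  case: (eqVneq u x) => [ux|nux].
    rewrite ux in H *; rewrite mem_rcons inE H /= ?andbF ?orbF.
    by rewrite -!orbA; case: (w == c); rewrite ?orbT ?orbF.
  by rewrite H /= ?andbF ?orbF.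
have Hdeg u : D2 u <= x.-1 * n + i.+1.
  rewrite /D2 {1}/set_fun; case: ifP => _; first by lia.
  by rewrite /D1 /set_fun; have := hdD u; case: ifP => _; lia.
have Hsum : \sum_(u < nodes) D2 u <= 2 * (\sum_(1 <= z < x) d z + i.+1).
  rewrite (sum_push D1) ?(sum_push D); try lia.
  by move: hsum; rewrite -/D; lia.
have Htwo u : 0 < u <= n -> has (fun w => w != A2 (u * W)) (row A2 W u (D2 u)) =
    (av s aTwo u != 0) || ((u == x) && (c != A2 (x * W))).
  move=> hu; rewrite htwo // /incident -/A -/D Hrow (_ : (u == c) = false) /=; last by lia.
  rewrite EA2 //; case: (eqVneq u x) => [->|nu] /=; last by rewrite orbF.
  rewrite EA2 // eqxx /= -cats1 has_cat /= orbF.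
  by case: (D x =P 0) => [->|_].
apply: wp_if => /=; rewrite ?hsx ?hsQ => hcmp.
  apply: wp_skip; wstep; move=> F; apply: HQ => //=; first by rewrite addn1.
  split=> //=; rewrite /incident /= -/A2 -/D2 //.
  move=> u hu; rewrite Htwo // (_ : (c != _) = false) ?andbF ?orbF //.
  by apply/negbTE; rewrite negbK.
have {}hcmp : c != A2 (x * W) := hcmp.
wstep; wstep; wstep; move=> F; apply: HQ => //=; first by rewrite addn1.
split=> //=; rewrite /incident /= ?hsx -/A2 -/D2 //.
- by move=> u hu; rewrite Htwo // hcmp andbT /set_fun; case: (u == x); rewrite ?orbT ?orbF.
- by rewrite (_ : (x == 0) = false) ?hx /= /set_fun ?eqxx //; lia.
Qed.

Lemma incidence_row_correct Q s x : 0 < x <= n ->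
  sv s vi = 0 -> sv s vx = x -> sv s vN = N -> sv s vQ = W ->
  av s aM = av s0 aM -> av s aNb = av s0 aNb -> av s aDeg = av s0 aDeg ->
  inc_inv x 0 s ->
  (forall t s', framed (While (Lt ($vi) (Arr aDeg ($vx))) incidence_step) s s' ->
     inc_inv x.+1 0 s' -> t <= 12 * d x + 1 -> Q t s') ->
  wp B (While (Lt ($vi) (Arr aDeg ($vx))) incidence_step) Q s.
Proof.
move=> hx hi hsx hsN hsQ hM hNb hDeg hI HQ.
apply: (wp_while (I := fun s => sv s vi <= d x /\ inc_inv x (sv s vi) s)
  (m := fun s => 12 * (d x - sv s vi))).
- by rewrite hi.
- move=> s1 [Fv Fa _] [h1 h2] /=; rewrite (Fa aDeg) // (Fv vx) // hsx hDeg => hlt.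
  apply: (incidence_step_correct hx hlt) => //=.
  + by rewrite (Fv vx).
  + by rewrite (Fv vN).
  + by rewrite (Fv vQ).
  + by rewrite (Fa aM).
  + by rewrite (Fa aNb).
  by move=> t s2 _ -> h3 ht; split; [split=> // | lia].
- move=> t s1 Fr [h1 h2] hc ht; have e : sv s1 vi = d x.
    by case: (Fr) hc => Fv Fa _ /=; rewrite (Fa aDeg) // (Fv vx) // hsx hDeg; lia.
  have dn := deg_leq0 x; rewrite e in h2; apply: HQ => //; last by rewrite hi in ht; lia.
  apply: inc_inv_ext h2 _ _ _ _ _ _ _ => // [a b||].
  + by rewrite reached_row.
  + by case: (x) hx dn => [|x'] //= _ dn; rewrite addn0 mulSn; lia.
  + by rewrite [leqRHS]addn0 [leqRHS]big_nat_recr //=; case/andP: hx.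
Qed.

Lemma incidence_correct Q :
  (forall t s, framed incidence s0 s -> incidence_built s ->
     t <= \sum_(1 <= z < N) (12 * d z + 5) + 2 -> Q t s) ->
  wp B incidence Q s0.
Proof.
move=> HQ; have hB := N_lt_B; apply: wp_framed; rewrite /incidence; wstep.
apply: (wp_while (I := fun s => 0 < sv s vx <= N /\ inc_inv (sv s vx) 0 s)
  (m := fun s => \sum_(sv s vx <= z < N) (12 * d z + 5))).
- split=> //=.
  have r0 a b : reached 1 0 a b = false.
    apply/negbTE/negP => /reachedP[y [h _]].
    by rewrite take0 in_nil andbF orbF; move: (Ebnd h); lia.
  split=> //=.
  + by move=> u w; rewrite /incident /= s0Ideg !r0.
  + by move=> u _; rewrite /incident /= s0Ideg s0Two.
  + by rewrite s0root.
  + by move=> u; rewrite s0Ideg.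
  + by rewrite big1 // => u _; rewrite s0Ideg.
- move=> s1 [Fv Fa _] [h1 h2] /=; rewrite (Fv vN) //= s0N => hlt.
  have hx : 0 < sv s1 vx <= n by lia.
  rewrite /incidence_row; wstep; apply: wp_seq; apply: (incidence_row_correct hx) => //=.
  + by rewrite (Fv vN).
  + by rewrite (Fv vQ).
  + by rewrite (Fa aM).
  + by rewrite (Fa aNb).
  + by rewrite (Fa aDeg).
  + by apply: inc_inv_ext h2 _ _ _ _ _ _ _.
  move=> t s2 [Fv2 Fa2 _] hI ht; wstep; rewrite (Fv2 vx) //=; first by lia.
  rewrite addn1; split; last by rewrite [X in _ < X]big_ltn //; lia.
  by split; [lia | apply: inc_inv_ext hI _ _ _ _ _ _ _].
- move=> t s1 Fr [h1 hI] hc /= ht Frr; have e : sv s1 vx = N.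
    by case: (Fr) hc => Fv Fa _ /=; rewrite (Fv vN) //= s0N; lia.
  apply: HQ => //; last by lia.
  rewrite e in hI; case: hI => hmem htwo hroot hdeg hsum.
  have eM : av s1 aM = av s0 aM by case: Frr => _ ->.
  have eD : av s1 aDeg = av s0 aDeg by case: Frr => _ ->.
  have rP a b : reached N 0 a b <-> exists y, E a y /\ b = node s1 a y.
    split=> [/reachedP[y [h1' h2 _]]|[y [h1' h2]]].
      by exists y; split=> //; rewrite h2 /node /class_of eM.
    apply/reachedP; exists y; split=> //; first by rewrite h2 /node /class_of eM.
    by have := Ebnd h1'; rewrite ltnS => /andP[_ ->].
  have mem u w : (w \in incident s1 u) <->
      (exists y, E u y /\ w = node s1 u y) \/ (exists y, E w y /\ u = node s1 w y).
    by rewrite hmem -!rP; split=> [/orP|/orP].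
  split=> //.
  + move=> x hx; rewrite htwo //; split=> [/hasP[w hw nw]|[y [y' [Ey Ey' ne]]]].
      have H v : v \in incident s1 x -> exists y, E x y /\ v = node s1 x y.
        by case/mem => // -[y [_ ey]]; move: hx ey; rewrite /node; lia.
      have hv : av s1 aInc (x * W) \in incident s1 x.
        rewrite /incident; set D := av s1 aIdeg x; have D0 : 0 < D.
          by rewrite -(size_row (av s1 aInc) W x D); move: hw; rewrite /incident -/D; case: (row _ _ _ _).
        by rewrite -[x * W]addn0 -(nth_row (av s1 aInc) W x D0) mem_nth // size_row.
      have [y [Ey ey]] := H _ hw; have [y' [Ey' ey']] := H _ hv.
      exists y, y'; split=> //; apply: contraNneq nw => e'; rewrite ey' ey /node e' //.
    have h1' : node s1 x y \in incident s1 x by apply/mem; left; exists y.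
    have h2' : node s1 x y' \in incident s1 x by apply/mem; left; exists y'.
    case: (eqVneq (node s1 x y) (av s1 aInc (x * W))) => [e1|ne1]; last by apply/hasP; exists (node s1 x y).
    apply/hasP; exists (node s1 x y') => //; rewrite -e1 /node eqn_add2r eq_sym //.
  + split; first by move=> u; have := hdeg u; rewrite addn0.
    by rewrite eD -[X in 2 * X]addn0.
Qed.

End Incidence.

(** * Running the search *)

Definition join_found (s : state) : Prop :=
  let F := sv s vfound in let v := sv s vfu in let pre := av s aPre in
  [/\ n < F < nodes, 0 < v <= n, 0 < pre F < pre v /\ pre (sv s vroot) < pre v,
      av s aTwo v != 0
    & forall x y, pre v <= pre x -> y \in incident s x -> pre v <= pre y \/ y = F].

Definition no_separation (s : state) : Prop :=
  forall F sigma, n < F -> sigma (sv s vroot) = false ->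
    (forall x y, y \in incident s x -> x != F -> y != F -> sigma x = sigma y) ->
    forall x y, E x y -> node s x y != F -> sigma (node s x y) = false.

Section Dfs.
Variable s0 : state.
Hypotheses (s0n : sv s0 vn = n) (s0N : sv s0 vN = N) (s0Q : sv s0 vQ = N * N).
Hypotheses (s0_inc : incidence_built s0) (s0_class : classified s0).
Hypothesis s0_deg : \sum_(1 <= x < N) av s0 aDeg x <= n * N.
Hypotheses (s0found : sv s0 vfound = 0) (s0Ptr : av s0 aPtr = fun=> 0).
Hypotheses (s0Pre : av s0 aPre = fun=> 0) (s0Low : av s0 aLow = fun=> 0).
Hypothesis s0Par : av s0 aPar = fun=> 0.
Hypothesis E_connected : forall (S : pred nat) x, 0 < x <= n -> S x ->
  (forall u v, E u v -> S u -> S v) -> forall y, 0 < y <= n -> S y.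

Local Notation il u := (incident s0 u).
Local Notation root := (sv s0 vroot).
Local Notation T := (\sum_(u < nodes) av s0 aIdeg u).

Lemma node_range x y : E x y -> N < node s0 x y < nodes.
Proof. by move=> h; case: s0_class => _ /(_ _ _ h) h2 _; rewrite /node /nodes; lia. Qed.

Lemma il_sym u w : w \in il u -> u \in il w.
Proof. by rewrite !(mem_incident s0_inc) => -[h|h]; [right|left]. Qed.

Lemma il_bip u w : w \in il u -> (n < u) = (w <= n).
Proof.
by rewrite (mem_incident s0_inc) => -[[y [h ->]]|[y [h ->]]]; move: (Ebnd h) (node_range h); lia.
Qed.

Lemma il_range u w : w \in il u -> 0 < w < nodes.
Proof.
rewrite (mem_incident s0_inc) => -[[y [h ->]]|[y [h _]]]; move: (node_range h) (Ebnd h); rewrite /nodes; lia.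
Qed.

Lemma il_gt0 u w : w \in il u -> 0 < w.
Proof. by case/il_range/andP. Qed.

Lemma il_two u w w' : u <= n -> w \in il u -> w' \in il u -> w != w' -> av s0 aTwo u != 0.
Proof.
move=> hu; rewrite !(mem_incident s0_inc) => -[[y [h e]]|[y [h e]]]; last first.
  by move: (node_range h); lia.
case=> [[y' [h' e']]|[y' [h' e']]]; last by move: (node_range h'); lia.
move=> ne; apply/(two_classes s0_inc (Ebnd h)); exists y, y'; split=> //.
by apply: contraNneq ne => eq_c; rewrite e e' /node eq_c.
Qed.

Lemma size_il u : size (il u) = av s0 aIdeg u.
Proof. exact: size_row. Qed.

Definition dfs_inv (k : nat) (s : state) : Prop :=
  [/\ sv s vfound = 0, 0 < root <= n & exists P, 
    [/\ sv s vu = head 0 P /\ {in P, forall u, u < nodes},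
        search_inv root (incident s0) (av s aPre) (av s aLow) (av s aPar) (av s aPtr) (sv s vcnt) P,
        forall F sigma, n < F -> sigma root = false ->
          (forall x y, y \in il x -> x != F -> y != F -> sigma x = sigma y) ->
          side_inv n (fun x => av s0 aTwo x != 0) F sigma (av s aPre) (av s aPar) P,
        sv s vcnt <= 1 + \sum_(u < nodes) av s aPtr u
      & k = 20 * (2 * (T - \sum_(u < nodes) av s aPtr u) + size P)]]
  \/ [/\ sv s vu = 0, sv s vfound != 0, k = 0, join_found s & 0 < root].

Lemma nodes_lt_B : nodes + N < B.
Proof. by move: B_large; rewrite /nodes !expnS expn0; case: (n) => [|k]; nia. Qed.

Lemma T_lt_B : T + 2 < B.
Proof.
have [_ h] := idegs s0_inc; move: B_large h s0_deg; rewrite !expnS expn0.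
by move: (\sum_(u < nodes) _) (\sum_(1 <= x < N) _) => a b; case: (n) => [|k]; nia.
Qed.

Lemma scan_correct s k u P : 0 < root <= n ->
  framed (If (Lt (Arr aPtr ($vu)) (Arr aIdeg ($vu))) dfs_scan dfs_retreat) s0 s ->
  sv s vfound = 0 -> sv s vu = u -> {in u :: P, forall u, u < nodes} ->
  search_inv root (incident s0) (av s aPre) (av s aLow) (av s aPar) (av s aPtr) (sv s vcnt) (u :: P) ->
  (forall F sigma, n < F -> sigma root = false ->
     (forall x y, y \in il x -> x != F -> y != F -> sigma x = sigma y) ->
     side_inv n (fun x => av s0 aTwo x != 0) F sigma (av s aPre) (av s aPar) (u :: P)) ->
  sv s vcnt <= 1 + \sum_(u < nodes) av s aPtr u ->
  k = 20 * (2 * (T - \sum_(u < nodes) av s aPtr u) + size (u :: P)) ->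
  av s aPtr u < size (il u) ->
  wp B dfs_scan (fun t s' => exists2 k', dfs_inv k' s' & t.+1 + k' < k) s.
Proof.
move=> hroot Fr hf hu hP inv sinv hcnt -> hptr; have [Fv Fa _] := Fr.
have hQ1 : sv s vQ = N * N by rewrite (Fv vQ).
have hInc : av s aInc = av s0 aInc by rewrite (Fa aInc).
have hT := T_lt_B; have hN := nodes_lt_B; have hB2 := Q_lt_B.
have un : u < nodes by apply: hP; rewrite mem_head.
set v := nth 0 (il u) (av s aPtr u).
have ev : av s aInc (u * (N * N) + av s aPtr u) = v.
  by rewrite hInc /v /incident nth_row // -size_il.
have huv : v \in il u by apply: mem_nth.
have hv := il_range huv.
have sum_ptr : \sum_(w < nodes) set_fun (av s aPtr) u (av s aPtr u).+1 w <= T.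
  apply: leq_sum => w _; rewrite -size_il /set_fun; case: eqP => [->|_] //.
  exact: (si_ptr inv).
have sumE := sum_push (av s aPtr) un.
rewrite sumE in sum_ptr.
set SP := \sum_(w < nodes) av s aPtr w in hcnt sumE sum_ptr *; set ST := T in hT sum_ptr *.
have hc : sv s vcnt + 2 < B by lia.
have deg_u : av s aPtr u < n * n.
  by apply: leq_trans hptr _; rewrite size_il; case: (idegs s0_inc) => ->.
have pre_lt x : av s aPre x < B.
  by apply: leq_ltn_trans (si_cnt inv x) _; lia.
rewrite /dfs_scan; wstep; rewrite hu hQ1 ev; first by lia.
wstep; rewrite hu; first by lia.
rewrite addn1; apply: wp_if => /= hpre.
  wstep; wstep; rewrite ?addn1; wstep; wstep; rewrite ?hu.
  wstep; exists (20 * (2 * (ST - \sum_(w < nodes) set_fun (av s aPtr) u (av s aPtr u).+1 w)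
    + size (v :: u :: P))); last by rewrite sumE /=; clear -sum_ptr; lia.
  left; split; rewrite ?hf //; exists (v :: u :: P); split=> //=.
  - by split=> // w; rewrite inE => /orP[/eqP ->|/hP //]; case/andP: hv.
  - exact: (scan_new il_sym il_gt0 hroot inv hptr (eqP hpre)).
  - move=> F sigma hF sr sadj.
    exact: (side_push il_sym il_bip il_two hroot hF sr sadj inv (sinv F sigma hF sr sadj) hptr (eqP hpre)).
  - by rewrite sumE; lia.
have pv : 0 < av s aPre v by rewrite lt0n.
have inv' := scan_visited hroot inv hptr pv (erefl _).
have prev := pre_lt v.
set k' := 20 * (2 * (ST - \sum_(w < nodes) set_fun (av s aPtr) u (av s aPtr u).+1 w)
    + size (u :: P)).
have lt_k' : 15 + k' < 20 * (2 * (ST - SP) + (size P).+1).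
  by rewrite /k' sumE /=; clear -sum_ptr; lia.
apply: wp_if => /=; rewrite ?hu => hlt; [wstep | apply: wp_skip]; exists k'; try (by move: lt_k'; rewrite /=; clear; lia);
  left; split; rewrite //= ?hf //; exists (u :: P); split=> //=; rewrite ?sumE; try lia.
- apply: search_inv_ext inv' => x; rewrite ?hu /set_fun; case: (x =P u) => // _.
  by rewrite -/v; apply/esym/minn_idPr/ltnW.
- apply: search_inv_ext inv' => x; rewrite ?hu /set_fun; case: (x =P u) => [->|//].
  by rewrite -/v; apply/esym/minn_idPl; rewrite leqNgt.
Qed.

Lemma retreat_correct s k u P : 0 < root <= n ->
  framed (If (Lt (Arr aPtr ($vu)) (Arr aIdeg ($vu))) dfs_scan dfs_retreat) s0 s ->
  sv s vfound = 0 -> sv s vu = u -> {in u :: P, forall u, u < nodes} ->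
  search_inv root (incident s0) (av s aPre) (av s aLow) (av s aPar) (av s aPtr) (sv s vcnt) (u :: P) ->
  (forall F sigma, n < F -> sigma root = false ->
     (forall x y, y \in il x -> x != F -> y != F -> sigma x = sigma y) ->
     side_inv n (fun x => av s0 aTwo x != 0) F sigma (av s aPre) (av s aPar) (u :: P)) ->
  sv s vcnt <= 1 + \sum_(u < nodes) av s aPtr u ->
  k = 20 * (2 * (T - \sum_(u < nodes) av s aPtr u) + size (u :: P)) ->
  av s aPtr u = size (il u) ->
  wp B dfs_retreat (fun t s' => exists2 k', dfs_inv k' s' & t.+1 + k' < k) s.
Proof.
move=> hroot Fr hf hu hP inv sinv hcnt -> hptr; have [Fv Fa _] := Fr.
have hT := T_lt_B; have hN := nodes_lt_B.
have un : u < nodes by apply: hP; rewrite mem_head.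
have [pu u0] := top_visited inv.
have [hpar lt_u adj_u _] := si_chain inv.
have hPP x : x \in P -> x < nodes by move=> hx; apply: hP; rewrite inE hx orbT.
have hhead : P != [::] -> head 0 P \in P by case: (P) => //= *; rewrite mem_head.
have ph : head 0 P < nodes.
  by case: (eqVneq P [::]) => [->|/hhead /hPP //]; rewrite /nodes /=; lia.
set p := head 0 P in hpar hhead ph *.
set lp := if P == [::] then 0 else minn (av s aLow p) (av s aLow u).
have inv' : search_inv root (incident s0) (av s aPre) (set_fun (av s aLow) p lp)
    (av s aPar) (av s aPtr) (sv s vcnt) P.
  by apply: (retreat il_sym hroot inv hptr); rewrite -/p /lp; case: eqP.
have sum_ptr : \sum_(w < nodes) av s aPtr w <= T.
  by apply: leq_sum => w _; rewrite -size_il; apply: (si_ptr inv).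
set SP := \sum_(w < nodes) av s aPtr w in hcnt sum_ptr *; set ST := T in hT sum_ptr *.
have np : p != u.
  case: (eqVneq P [::]) => [e|/hhead /lt_u]; first by rewrite /p e /=; lia.
  by apply: contraTneq => ->; rewrite ltnn.
have [pre0 low0] := si_zero inv.
have low_u : av s aLow u < B.
  by have := si_low inv (mem_head _ _); have := si_cnt inv u; lia.
rewrite /dfs_retreat; wstep; rewrite hu hpar; first by lia.
pose mid t (s' : state) := [/\ t <= 2, sv s' = set_key (sv s) vp p,
  forall k, k != aLow -> av s' k = av s k & av s' aLow =1 set_fun (av s aLow) p lp].
apply: wp_seq; apply: (wp_weaken (Q' := mid)); last first.
  apply: wp_if => /=; rewrite hu => hlt; [apply: wp_put; first by rewrite /= hu | apply: wp_skip]; split=> //=.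
  - by move=> k' /negbTE hk; rewrite /set_key hk.
  - move=> x; rewrite hu /set_fun; case: (x =P p) => // _; rewrite /lp.
    case: eqP => [e|_]; first by move: hlt; rewrite /p e /= low0.
    by apply/esym/minn_idPr/ltnW.
  - move=> x; rewrite /set_fun; case: (x =P p) => [->|//]; rewrite /lp.
    case: eqP => [e|_]; first by rewrite /p e.
    by apply/esym/minn_idPl; rewrite leqNgt.
move=> t1 s1 [ht1 Ev Ea El].
have Eu : sv s1 vu = u by rewrite Ev.
have Ep : sv s1 vp = p by rewrite Ev.
have En : sv s1 vn = n by rewrite Ev /set_key /= (Fv vn).
have lowu : av s1 aLow u = av s aLow u by rewrite El /set_fun eq_sym (negbTE np).
have Epre : av s1 aPre = av s aPre by apply: Ea.
have Etwo : av s1 aTwo = av s0 aTwo by rewrite Ea // (Fa aTwo).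
set K := 20 * (2 * (ST - SP) + size P).
have lt_K : 19 + K < 20 * (2 * (ST - SP) + (size P).+1) by rewrite /K; clear; lia.
have Hpop : ~~ [&& n < p, av s aPre p <= av s aLow u & av s0 aTwo u != 0] ->
    forall t, t <= 10 -> dfs_inv K (set_var s1 vu p) /\ t.+1 + K < 20 * (2 * (ST - SP) + size (u :: P)).
  move=> hnf t ht; split; last by move: lt_K ht => /=; clear; lia.
  left; split; rewrite //= ?Ev /set_key /= ?hf //; exists P.
  split; rewrite //= ?Ev /set_key //= ?Epre ?(Ea aPar) ?(Ea aPtr) //.
  - exact: search_inv_ext El inv'.
  - move=> F sigma hF sr sadj.
    exact: (side_pop hroot hF sr sadj inv (sinv F sigma hF sr sadj) hnf).
apply: wp_if => /=; rewrite En Ep => hnp; last first.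
  wstep; rewrite Ep.
  have [|h1 h2] := Hpop (ltac:(by rewrite (negbTE hnp))) (1 + (t1 + 2)); first by clear -ht1; lia.
  by exists K.
apply: wp_if => /=; rewrite Eu Ep lowu Epre => hlow.
  wstep; rewrite Ep.
  have [|h1 h2] := Hpop (ltac:(by rewrite (leqNgt (av s aPre p)) hlow andbF)) (1 + (t1 + 3)); first by clear -ht1; lia.
  by exists K.
apply: wp_if => /=; rewrite Eu Etwo => htwo.
  wstep; rewrite Ep.
  have [|h1 h2] := Hpop (ltac:(by rewrite htwo !andbF)) (1 + (t1 + 4)); first by clear -ht1; lia.
  by exists K.
wstep; rewrite Ep.
wstep; rewrite Eu.
wstep; exists 0; last by move: lt_K ht1; clear; lia.
have Pn : P != [::] by apply: contraTneq hnp => e; rewrite /p e.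
have [pp p0] : 0 < av s aPre p /\ 0 < p by apply: (si_path inv); rewrite inE hhead ?orbT.
have lt_pu : av s aPre p < av s aPre u by apply/lt_u/hhead.
right; split; rewrite //= /join_found /= ?Ev ?Epre ?Etwo /set_key /=; first by lia.
split=> //; first by rewrite hnp ph.
- have hup : p \in il u by case: adj_u => // e; rewrite e in Pn.
  by rewrite u0 -(il_bip (il_sym hup)).
- by rewrite (Fv vroot) // (si_root inv); lia.
- move=> x y hx; rewrite /incident /= !Ea // (Fa aInc) // (Fa aIdeg) // => hxy.
  apply: (subtree_closed il_sym hroot inv hptr _ hx hxy).
  by rewrite leqNgt.
- by case/andP: hroot.
Qed.

Lemma dfs_correct Q : (sv s0 vroot <= n) ->
  (forall t s, framed dfs s0 s ->
     (sv s vfound = 0 /\ (0 < root -> no_separation s0)) \/ (sv s vfound != 0 /\ join_found s) ->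
     t <= 40 * T + 30 -> Q t s) ->
  wp B dfs Q s0.
Proof.
move=> le_root HQ; have hT := T_lt_B; have hN := nodes_lt_B.
apply: wp_framed; rewrite /dfs; wstep.
wstep; wstep; wstep; rewrite s0Pre s0Low.
case: (posnP root) => hr.
  apply: (wp_while (I := fun s => sv s vu = 0 /\ sv s vfound = 0) (m := fun=> 0)).
  - by rewrite /= hr s0found.
  - by move=> s _ [h _] /=; rewrite h.
  - by move=> t s _ [h1 h2] _ ht Fr; apply: HQ => //; [left; split=> //; lia | lia].
have hroot : 0 < root <= n by rewrite hr.
apply: (wp_while_ghost (I := dfs_inv) (k0 := 20 * (2 * T + 1))).
- left; split=> //=; exists [:: root]; split=> //=.
  + by split=> // u; rewrite inE => /eqP ->; rewrite /nodes; lia.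
  + by rewrite s0Ptr s0Par; exact: (search_inv_init (n := n)).
  + by move=> F sigma hF sr _; rewrite s0Par; apply: (side_inv_init (n := n)).
  + by rewrite s0Ptr [X in _ - X]big1 // subn0.
- move=> k s Fr [[hf _ [P [[hu hP] inv sinv hcnt ek]]]|[hu _ _ _ _]] /=; last by rewrite hu.
  have Fr0 : framed (If (Lt (Arr aPtr ($vu)) (Arr aIdeg ($vu))) dfs_scan dfs_retreat) s0 s.
    case: Fr => Fv Fa Fo; split=> [x hx|a ha|hio].
    + by rewrite Fv //= /set_key !ifF //; apply: contraNF hx => /eqP ->.
    + by rewrite Fa //= /set_key !ifF //; apply: contraNF ha => /eqP ->.
    + by have [-> ->] := Fo hio.
  have [Fv Fa _] := Fr0; rewrite hu.
  case: P hu hP inv sinv ek => [|u P] //= hu hP inv sinv ek _.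
  apply: wp_if => /=; rewrite hu (Fa aIdeg) // -size_il => hc.
    exact: (scan_correct hroot Fr0 hf hu hP inv sinv hcnt ek hc).
  apply: (retreat_correct hroot Fr0 hf hu hP inv sinv hcnt ek).
  by apply/eqP; rewrite eqn_leq (si_ptr inv) leqNgt hc.
- move=> t k s Fr [[hf _ [P [[hu hP] inv sinv hcnt ek]]]|[hu hf _ hj _]] /= hc ht Frr; last first.
    by apply: HQ => //; [right | move: ht; move: (\sum_(w < nodes) _) => X; clear; lia].
  have eP : P = [::].
    case: P hu hP inv {sinv ek} => // u P /= hu _ inv.
    by have [_ u0] := top_visited inv; rewrite hu u0 in hc.
  rewrite eP in inv sinv; apply: HQ => //; last by move: ht; move: (\sum_(w < nodes) _) => X; clear; lia.
  left; split=> // _ F sigma hF sr sadj x y Exy nF.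
  have vis z w : 0 < av s aPre z -> w \in il z -> 0 < av s aPre w.
    move=> hz hw; have hp := si_black inv hz (isT : z \notin [::]).
    by have := si_seen inv (i := index w (il z)) hz; rewrite hp index_mem nth_index // => ->.
  have il1 u v : E u v -> node s0 u v \in il u by move=> h; apply/(mem_incident s0_inc); left; exists v.
  have visx : 0 < av s aPre x.
    apply: (E_connected (S := fun z => 0 < av s aPre z) hroot) (Ebnd Exy).
      by rewrite (si_root inv).
    move=> u v Euv hu'; apply: (vis (node s0 u v)); first exact: vis (il1 _ _ Euv).
    apply/(mem_incident s0_inc); right; exists u; rewrite Esym; split=> //.
    have [_ _ h] := s0_class; rewrite /node; congr addn.
    by apply/(h _ _ _ _ Euv); rewrite ?[E v u]Esym // => z; rewrite /common andbC.
  apply/negP => sn; case: (sinv F sigma hF sr sadj) => _ _ H _.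
  have [|v [] //] := H (node s0 x y) (vis _ _ visx (il1 _ _ Exy)) _ nF sn.
  by have := node_range Exy; lia.
Qed.

End Dfs.

(** * Output *)

Definition written_join (s : state) : seq int :=
  Posz 1 :: [seq Posz ((av s aPre (sv s vfu) <= av s aPre x).*2 +
                       (x \in incident s (sv s vfound))) | x <- iota 1 n].

Lemma write_join_correct Q s : sv s vN = N -> sv s vQ = N * N ->
  (forall u, av s aIdeg u <= n * n) -> (forall u, av s aMark u = 0) -> so s = [::] ->
  (forall t s', so s' = (if sv s vfound == 0 then [:: Posz 0] else written_join s) ->
     t <= 4 * av s aIdeg (sv s vfound) + 6 * n + 10 -> Q t s') ->
  wp B write_join Q s.
Proof.
move=> hN hQ hI hM ho HQ; have hB2 := Q_lt_B; have hB := N_lt_B.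
rewrite /write_join; apply: wp_if => /= hf.
  by apply: wp_write => /=; apply: HQ; rewrite ?hf ?ho //; lia.
set F := sv s vfound in hf HQ *.
apply: wp_seq; apply: wp_write => /=; rewrite ho /=; wstep; apply: wp_seq.
have dF := hI F.
pose I1 (s' : state) := sv s' vi <= av s aIdeg F /\
  forall u, av s' aMark u = (u \in take (sv s' vi) (incident s F)).
apply: (wp_while (I := I1) (m := fun s' => 3 * (av s aIdeg F - sv s' vi))).
- by split=> //= u; rewrite hM take0.
- move=> s1 [Fv Fa _] [h1 h2] /=; rewrite (Fa aIdeg) // (Fv vfound) //= -/F => hlt.
  rewrite /mark_step; wstep; wstep; split; last by lia.
  rewrite (Fv vfound) //= (Fv vQ) //= hQ (Fa aInc) //= -/F addn1; split=> //= u.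
  rewrite (take_nth 0) ?size_row // mem_rcons inE /set_fun nth_row // h2.
  by case: (u == _).
move=> t1 s1 [Fv Fa Fo] [h1 h2] /= hc ht1; have [_ /= Eo] := Fo isT.
have e1 : sv s1 vi = av s aIdeg F.
  by move: hc; rewrite (Fa aIdeg) // (Fv vfound) //= -/F; lia.
have hmark u : av s1 aMark u = (u \in incident s F).
  by rewrite h2 e1 take_oversize // size_row.
have hN1 : sv s1 vN = N by rewrite (Fv vN).
pose bit x := Posz ((av s aPre (sv s vfu) <= av s aPre x).*2 + (x \in incident s F)).
wstep; pose I2 (s' : state) := 0 < sv s' vx <= N /\
  so s' = Posz 1 :: [seq bit x | x <- iota 1 (sv s' vx).-1].
apply: (wp_while (I := I2) (m := fun s' => 5 * (N - sv s' vx))).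
- by split=> //=; rewrite Eo.
- move=> s2 [Fv2 Fa2 _] [h3 h4] /=; rewrite (Fv2 vN) //= hN1 => hlt.
  have ePre : av s2 aPre = av s aPre by rewrite (Fa2 aPre) //= (Fa aPre).
  have efu : sv s2 vfu = sv s vfu by rewrite (Fv2 vfu) //= (Fv vfu).
  have eMark u : av s2 aMark u = (u \in incident s F) by rewrite (Fa2 aMark) //= hmark.
  have next : rcons (Posz 1 :: [seq bit x | x <- iota 1 (sv s2 vx).-1]) (bit (sv s2 vx)) =
      Posz 1 :: [seq bit x | x <- iota 1 (sv s2 vx)].
    case: (sv s2 vx) h3 => // x _.
    by rewrite -[in RHS](addn1 x) iotaD map_cat /= cats1 add1n.
  rewrite /write_step; apply: wp_seq; apply: wp_if => /=; rewrite ePre efu => hlt2.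
    apply: wp_write => /=; wstep; split; last by lia.
    split=> /=; rewrite addn1 //= h4 -next; congr rcons.
    by rewrite /bit eMark leqNgt hlt2.
  apply: wp_write => /=; wstep; split; last by lia.
  split=> /=; rewrite addn1 //= h4 -next; congr rcons.
  by rewrite /bit eMark leqNgt hlt2.
move=> t2 s2 [Fv2 _ _] [h3 h4] /= hc2 ht2.
have e2 : sv s2 vx = N by move: hc2; rewrite (Fv2 vN) //= hN1; lia.
apply: HQ; first by rewrite (negbTE hf) h4 e2.
by move: ht1 ht2 => /=; lia.
Qed.

Lemma incidence_built_ext s s' : incidence_built s ->
  av s' aM = av s aM -> av s' aInc = av s aInc -> av s' aIdeg = av s aIdeg ->
  av s' aTwo = av s aTwo -> av s' aDeg = av s aDeg -> sv s' vroot = sv s vroot ->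
  incidence_built s'.
Proof.
case=> h1 h2 h3 h4 e1 e2 e3 e4 e5 e6.
by split; rewrite /incident /node /class_of ?e1 ?e2 ?e3 ?e4 ?e5 ?e6.
Qed.

Lemma classified_ext s s' : classified s -> av s' aM = av s aM -> classified s'.
Proof. by case=> h1 h2 h3 e; split; rewrite /class_of ?e. Qed.

Lemma sum_cost (d : nat -> nat) D a b : (forall z, d z <= D) ->
  \sum_(1 <= z < N) ((a * d z + b) * d z) <= (a * D + b) * \sum_(1 <= z < N) d z.
Proof.
by move=> hD; rewrite big_distrr leq_sum //= => z _; rewrite leq_mul2r leq_add2r leq_mul2l hD !orbT.
Qed.

Definition final_state (s : state) (t : nat) (o : seq int) : Prop :=
  [/\ classified s, incidence_built s,
      (o = [:: Posz 0] /\ (0 < sv s vroot -> no_separation s)) \/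
      (o = written_join s /\ join_found s),
      nbrs_ok (av s aNb) (av s aDeg) E /\ \sum_(1 <= x < N) av s aDeg x = n + m * 2
    & forall D, (forall z, av s aDeg z <= D) -> t <= (12 * D + 141) * (n + m * 2) + 65].

Lemma one_join_cmd_correct :
  (forall (S : pred nat) x, 0 < x <= n -> S x ->
    (forall u v, E u v -> S u -> S v) -> forall y, 0 < y <= n -> S y) ->
  wp B one_join_cmd (fun t s => exists s', final_state s' t (so s)) (init input).
Proof.
move=> conn; rewrite /one_join_cmd.
apply: wp_seq; apply: read_graph_correct => t1 s1 n1 N1 Q1 v1 a1 o1 g1 ht1.
have [_ nb1 sum1] := g1.
have sum1' : \sum_(1 <= x < N) av s1 aDeg x = n + m * 2.
  rewrite -sum1 -(big_mkord xpredT (fun x => av s1 aDeg x)) [RHS]big_ltn //.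
  by rewrite (nb1.1 0).
have d1 z : av s1 aDeg z <= n by apply: nbrs_deg Ebnd2 nb1.
apply: wp_seq; apply: (classify_correct (s0 := s1)) => //; first by rewrite a1.
move=> t2 s2 [Fv2 Fa2 Fo2] c2 ht2.
apply: wp_seq; apply: (incidence_correct (s0 := s2)) => //.
- by rewrite (Fv2 vN).
- by rewrite (Fv2 vQ).
- by rewrite (Fv2 vroot) // v1.
- by rewrite (Fa2 aNb) // (Fa2 aDeg).
- by move=> u; rewrite (Fa2 aIdeg) // a1.
- by move=> u; rewrite (Fa2 aTwo) // a1.
move=> t3 s3 [Fv3 Fa3 Fo3] i3 ht3.
have eDeg3 : av s3 aDeg = av s1 aDeg by rewrite (Fa3 aDeg) // (Fa2 aDeg).
have c3 : classified s3 by apply: classified_ext c2 _; apply: Fa3.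
have hroot : sv s3 vroot <= n.
  have := root_two i3; case: eqP => [-> //|_]; lia.
apply: wp_seq; apply: (dfs_correct (s0 := s3)) => //.
- by rewrite (Fv3 vn) // (Fv2 vn).
- by rewrite (Fv3 vN) // (Fv2 vN).
- by rewrite (Fv3 vQ) // (Fv2 vQ).
- rewrite eDeg3; apply: (@leq_trans (\sum_(1 <= x < N) n)); first exact: leq_sum.
  by rewrite sum_nat_const_nat subn1 /=; nia.
- by rewrite (Fv3 vfound) // (Fv2 vfound) // v1.
- by rewrite (Fa3 aPtr) // (Fa2 aPtr) // a1.
- by rewrite (Fa3 aPre) // (Fa2 aPre) // a1.
- by rewrite (Fa3 aLow) // (Fa2 aLow) // a1.
- by rewrite (Fa3 aPar) // (Fa2 aPar) // a1.
move=> t4 s4 [Fv4 Fa4 Fo4] hres ht4.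
have i4 : incidence_built s4.
  by apply: incidence_built_ext i3 _ _ _ _ _ _; rewrite ?Fa4 ?Fv4.
have eDeg4 : av s4 aDeg = av s1 aDeg by rewrite (Fa4 aDeg).
have [hI hT] := idegs i4.
apply: write_join_correct => //.
- by rewrite (Fv4 vN) // (Fv3 vN) // (Fv2 vN).
- by rewrite (Fv4 vQ) // (Fv3 vQ) // (Fv2 vQ).
- by move=> u; rewrite (Fa4 aMark) // (Fa3 aMark) // (Fa2 aMark) // a1.
- by have [_ ->] := Fo4 isT; have [_ ->] := Fo3 isT; have [_ ->] := Fo2 isT.
move=> t5 s5 ho ht5; exists s4; split=> //.
- by apply: classified_ext c3 _; rewrite Fa4.
- rewrite ho; case: hres => [[-> h]|[/negbTE -> h]]; [left|by right]; split=> //.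
  rewrite (Fv4 vroot) // => /h; rewrite /no_separation /incident /node /class_of.
  by rewrite (Fv4 vroot) // (Fa4 aInc) // (Fa4 aIdeg) // (Fa4 aM).
- by rewrite eDeg4 (Fa4 aNb) // (Fa3 aNb) // (Fa2 aNb).
move=> D; rewrite eDeg4 => hD.
have hF : av s4 aIdeg (sv s4 vfound) <= \sum_(u < nodes) av s4 aIdeg u.
  have hF : sv s4 vfound < nodes.
    by case: hres => [[-> _]|[_ [/andP[_ ? //]]]]; rewrite /nodes; lia.
  by rewrite (bigD1 (Ordinal hF)) //= leq_addr.
have e3 : \sum_(u < nodes) av s3 aIdeg u = \sum_(u < nodes) av s4 aIdeg u by rewrite (Fa4 aIdeg).
rewrite eDeg4 sum1' in hT.
have H2 : \sum_(1 <= z < N) trie_cost s1 z <= (12 * D + 5) * (n + m * 2) + n * 5.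
  rewrite /trie_cost big_split /= sum_nat_const_nat subn1 leq_add2r -sum1'.
  exact: sum_cost.
have H3 : \sum_(1 <= z < N) (12 * av s2 aDeg z + 5) = 12 * (n + m * 2) + n * 5.
  by rewrite (Fa2 aDeg) // big_split /= -big_distrr /= sum1' sum_nat_const_nat subn1.
rewrite H3 in ht3; rewrite e3 in ht4.
move: ht1 ht2 ht3 ht4 ht5 hF hT H2; rewrite !mulnDl.
move: (\sum_(1 <= z < N) _) (\sum_(u < nodes) _) (av s4 _ _) (12 * D * n) (12 * D * (m * 2)) => x1 x2 x3 x4 x5.
by clear; lia.
Qed.

End Algorithm.

(** * Correctness on graphs over ordinals *)

Section Translation.
Variables (n : nat) (e : rel 'I_n) (s : seq ('I_n * 'I_n)).
Hypotheses (e_sym : symmetric e) (e_irr : irreflexive e).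
Hypotheses (e_conn : connected_graph e) (e_list : edge_list e s).

Definition lift_rel : rel nat :=
  fun a b => [exists i : 'I_n, exists j : 'I_n, [&& a == i.+1, b == j.+1 & e i j]].
Local Notation E := lift_rel.

Definition lift_edges : seq (nat * nat) := [seq (p.1.+1, p.2.+1) | p : 'I_n * 'I_n <- s].

Lemma lift_relP a b : reflect (exists i j : 'I_n, [/\ a = i.+1, b = j.+1 & e i j]) (E a b).
Proof.
apply: (iffP existsP) => [[i /existsP[j /and3P[/eqP ? /eqP ? ?]]]|[i [j [-> -> h]]]].
  by exists i, j.
by exists i; apply/existsP; exists j; rewrite !eqxx h.
Qed.

Lemma lift_relE (i j : 'I_n) : E i.+1 j.+1 = e i j.
Proof.
apply/lift_relP/idP => [[i' [j' [[/val_inj ->] [/val_inj ->]]]]//|h].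
by exists i, j.
Qed.

Lemma lift_rel_sym : symmetric E.
Proof.
suff H a b : E a b -> E b a by move=> a b; apply/idP/idP; apply: H.
by case/lift_relP => i [j [-> -> h]]; rewrite lift_relE e_sym.
Qed.

Lemma lift_rel_irr : irreflexive E.
Proof.
move=> a; apply/negbTE/negP => /lift_relP[i [j [-> [/val_inj <-]]]].
by rewrite e_irr.
Qed.

Lemma lift_rel_bound a b : E a b -> 0 < a <= n.
Proof. by case/lift_relP => i [j [-> _ _]]; rewrite /= ltn_ord. Qed.

Lemma ordP a : 0 < a <= n -> exists i : 'I_n, a = i.+1.
Proof. by case: a => // a ha; exists (Ordinal ha). Qed.

Lemma count_lift_edges x y :
  count_mem (x, y) lift_edges + count_mem (y, x) lift_edges = E x y.
Proof.
have H a b : count_mem (a, b) lift_edges =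
    count (fun p : 'I_n * 'I_n => (p.1.+1 == a) && (p.2.+1 == b)) s.
  by rewrite count_map; apply: eq_count => p; rewrite /= xpair_eqE.
case: (boolP ((0 < x <= n) && (0 < y <= n))) => [/andP[hx hy]|nxy].
  have [i ei] := ordP hx; have [j ej] := ordP hy.
  rewrite !H ei ej lift_relE -e_list; congr (_ + _); apply: eq_count => p;
    by rewrite /= !eqSS -[p in RHS]surjective_pairing xpair_eqE.
have -> : E x y = false.
  apply: contraNF nxy => h; rewrite (lift_rel_bound h).
  by apply: (@lift_rel_bound y x); rewrite lift_rel_sym.
rewrite !H !(@eq_count _ _ pred0) ?count_pred0 //= => p; apply/negbTE; apply: contra nxy;
  by case/andP => /eqP <- /eqP <-; rewrite !ltnS !ltn_ord.
Qed.

Lemma lift_connected (S : pred nat) x : 0 < x <= n -> S x ->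
  (forall u v, E u v -> S u -> S v) -> forall y, 0 < y <= n -> S y.
Proof.
move=> hx Sx hS y hy; have [i ei] := ordP hx; have [j ->] := ordP hy.
apply: (connected_ind (S := fun k : 'I_n => S k.+1) (x := i) e_conn); rewrite -?ei //.
by move=> u v euv; apply: hS; rewrite lift_relE.
Qed.

Lemma input_lift : input n lift_edges = graph_input s.
Proof.
rewrite /input /graph_input size_map; congr [:: _, _ & _].
by rewrite /encode -map_comp.
Qed.

Lemma size_edges : size s <= num_edges e.
Proof.
rewrite /num_edges -(size_map (fun p : 'I_n * 'I_n => [set p.1; p.2])).
have count1 (x y : 'I_n) : (x, y) \in s -> e x y.
  by rewrite -has_pred1 has_count; move: (e_list x y); case: (e x y); lia.
have inj (p q : 'I_n * 'I_n) : [set p.1; p.2] = [set q.1; q.2] -> e p.1 p.2 -> q = p \/ q = (p.2, p.1).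
  case: p => a b; case: q => c d /= h eab.
  have nab : a != b by apply: contraTneq eab => ->; rewrite e_irr.
  have ha : a \in [set c; d] by rewrite -h !inE eqxx.
  have hb : b \in [set c; d] by rewrite -h !inE eqxx orbT.
  move: ha hb nab; rewrite !inE => /orP[] /eqP -> /orP[] /eqP ->; rewrite ?eqxx //; auto.
have hu : uniq [seq [set p.1; p.2] | p : 'I_n * 'I_n <- s].
  have us : uniq s.
    apply: count_mem_uniq => -[x y]; move: (e_list x y); rewrite -has_pred1 has_count.
    by move: (count_mem _ s) (count_mem _ s) => a b; case: (e x y); lia.
  rewrite map_inj_in_uniq // => p q hp hq h.
  case: p q hp hq h => [a b] [c d] hp hq h; have eab := count1 _ _ hp.
  case: (inj _ _ h eab) => //= e2; have := e_list a b; rewrite eab.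
  have nab : a != b by apply: contraTneq eab => ->; rewrite e_irr.
  rewrite e2 in hq; move: hp hq; rewrite -!has_pred1 !has_count.
  by move: (count_mem _ s) (count_mem _ s) => x y; lia.
rewrite -(card_uniqP hu) subset_leq_card //; apply/subsetP => X /mapP[[x y] hp ->].
by apply/imsetP; exists (x, y) => //; rewrite inE; apply: count1.
Qed.

Local Notation K := (closed_common e).

Lemma common_lift (i j k : 'I_n) : common E i.+1 j.+1 k.+1 = (k \in K i j).
Proof. by rewrite inE /common !lift_relE !eqSS. Qed.

Section Output.
Variables (st : state) (t : nat) (o : seq int).
Hypothesis fin : final_state n E lift_edges st t o.
Local Notation nd i j := (node n st i.+1 j.+1).
Local Notation v := (sv st vfu).
Local Notation F := (sv st vfound).
Local Notation pre := (av st aPre).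

Lemma class_eqP (i j k l : 'I_n) : e i j -> e k l ->
  (class_of n st i.+1 j.+1 == class_of n st k.+1 l.+1) = (K i j == K k l).
Proof.
move=> eij ekl; have [[_ _ h] _ _ _ _] := fin.
have {}h := h i.+1 j.+1 k.+1 l.+1; rewrite !lift_relE in h; have {}h := h eij ekl.
apply/eqP/eqP => [/h hc|hK]; first by apply/setP => z; rewrite -!common_lift hc.
apply/h => z; case: (boolP (0 < z <= n)) => [/ordP[k' ->]|hz]; first by rewrite !common_lift hK.
have H (i1 j1 : 'I_n) : common E i1.+1 j1.+1 z = false.
  apply: contraNF hz => /andP[/orP[/eqP -> |/lift_rel_bound //] _].
  by rewrite /= ltn_ord.
by rewrite !H.
Qed.

Lemma node_eqP (i j k l : 'I_n) : e i j -> e k l -> (nd i j == nd k l) = (K i j == K k l).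
Proof. by move=> eij ekl; rewrite /node eqn_add2r class_eqP. Qed.

Lemma node_gt (i j : 'I_n) : e i j -> n < nd i j.
Proof.
move=> eij; have [[_ h _] _ _ _ _] := fin.
by have := h i.+1 j.+1; rewrite lift_relE => /(_ eij); rewrite /node; lia.
Qed.

Lemma nodeC (i j : 'I_n) : e i j -> nd i j = nd j i.
Proof.
move=> eij; apply/eqP; rewrite node_eqP //; first by rewrite closed_commonC.
by rewrite e_sym.
Qed.

Lemma node_incident (i j : 'I_n) : e i j ->
  nd i j \in incident n st i.+1 /\ j.+1 \in incident n st (nd i j).
Proof.
move=> eij; have [_ inc _ _ _] := fin; split; apply/(mem_incident inc).
  by left; exists j.+1; rewrite lift_relE.
by right; exists i.+1; rewrite lift_relE e_sym nodeC.
Qed.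

Lemma twoP (i : 'I_n) : (av st aTwo i.+1 != 0) <->
  exists j k : 'I_n, [/\ e i j, e i k & K i j != K i k].
Proof.
have [_ inc _ _ _] := fin; rewrite (two_classes inc) /=; last by rewrite ltn_ord.
split=> [[a [b [/lift_relP[i1 [j [e1 -> eij]]] /lift_relP[i2 [k [e2 -> eik]]]]]]|].
  move: e1 e2 => [/val_inj e1] [/val_inj e2]; rewrite -e1 in eij; rewrite -e2 in eik.
  by rewrite class_eqP // => ne; exists j, k.
by case=> j [k [eij eik ne]]; exists j.+1, k.+1; rewrite !lift_relE class_eqP.
Qed.

Lemma two_other (C : {set 'I_n}) (i : 'I_n) : av st aTwo i.+1 != 0 ->
  exists2 j, e i j & K i j != C.
Proof.
move=> /twoP[j [k [eij eik ne]]]; case: (eqVneq (K i j) C) => [eC|]; last by exists j.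
by exists k => //; rewrite -eC eq_sym.
Qed.

Lemma found_one_join : join_found n st -> finds_one_join e (written_join n st).
Proof.
case=> hF hv [hFv hrv] htwo closed; have [_ inc _ _ _] := fin.
have [i0 ei0] := ordP hv.
have [r er] : exists r : 'I_n, sv st vroot = r.+1 /\ av st aTwo r.+1 != 0.
  have := root_two inc; case: eqP => [_ h|_ /andP[h1 h2]]; first by rewrite h in htwo.
  by have [r er] := ordP h1; exists r; rewrite -er.
case: er => er rtwo.
pose S := [set i : 'I_n | pre v <= pre i.+1].
have i0S : i0 \in S by rewrite inE -ei0.
have rS : r \notin S by rewrite inE -er -ltnNge.
have crossF (i j : 'I_n) : e i j -> i \in S -> j \notin S -> nd i j = F.
  move=> eij; rewrite !inE => hi hj; have [h1 h2] := node_incident eij.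
  case: (closed _ _ hi h1) => // h3; case: (closed _ _ h3 h2) => [h4|h4]; first by rewrite h4 in hj.
  by move: hF (ltn_ord j); rewrite -h4; lia.
have [x [y [exy xS yS]]] := connected_crossing (S := mem S) e_conn i0S rS.
pose C := K x y.
have crossC (i j : 'I_n) : e i j -> i \in S -> j \notin S -> K i j = C.
  move=> eij hi hj; apply/eqP; rewrite -node_eqP //.
  by rewrite (crossF i j) // (crossF x y).
have eF : F = nd x y by rewrite (crossF x y).
exists (~: S), S, (C :\: S), (C :&: S); split.
  apply: (separation_one_join e_sym crossC exy xS yS).
    rewrite ei0 in htwo; have [j eij nC] := two_other C htwo.
    by exists i0, j.
  by have [j erj nC] := two_other C rtwo; exists r, j.
rewrite /written_join /join_output; congr cons.
rewrite -[1]/(1 + 0) iotaDl -val_enum_ord -!map_comp; apply: eq_map => i /=.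
rewrite add1n; congr Posz; rewrite inE; congr (_ + nat_of_bool _).
have -> : (i \in C :\: S :|: C :&: S) = (i \in C).
  by rewrite !inE; case: (_ <= _); rewrite ?andbT ?andbF ?orbF.
rewrite (mem_cut_cliqueE e_sym crossC exy xS yS).
apply/idP/existsP => [/(mem_incident inc)[|]|[j /andP[eij /eqP eC]]].
- by case=> b [/lift_relP[i1 [j [e1 -> eij]]]]; move: (node_gt eij) (ltn_ord i); rewrite e1; lia.
- case=> b [/lift_relP[i1 [j [[/val_inj <-] -> eij]]]]; rewrite eF => /eqP.
  by rewrite node_eqP // => /eqP h; exists j; rewrite eij /C h eqxx.
- by apply/(mem_incident inc); right; exists j.+1; rewrite lift_relE eij eF; split=> //; apply/eqP; rewrite node_eqP // eC.
Qed.

Lemma not_found_no_join : (0 < sv st vroot -> no_separation n E st) ->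
  ~ exists V1 V2 A1 A2 : {set 'I_n}, one_join e V1 V2 A1 A2.
Proof.
move=> nosep; have [_ inc _ _ _] := fin; case=> V1 [V2 [A1 [A2 oj]]].
have hr : 0 < sv st vroot.
  rewrite lt0n; apply/negP => /eqP r0; have := root_two inc; rewrite r0 eqxx => h0.
  have [_ [x [y [exy xV yV]]] crossC [x' [y' [exy' _ nC]]] _] := one_join_separation e_sym e_conn oj.
  have hall : forall z, [forall w, e z w ==> (K z w == A1 :|: A2)].
    have same (z w w' : 'I_n) : e z w -> e z w' -> K z w = K z w'.
      move=> h1 h2; apply/eqP; apply: contraTT isT => ne.
      have : av st aTwo z.+1 != 0 by apply/twoP; exists w, w'.
      by rewrite h0 //= ltn_ord.
    apply: (connected_ind (x := x) e_conn).
      by apply/forallP => w; apply/implyP => exw; rewrite -(same _ _ _ exy exw) crossC.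
    move=> z w ezw /forallP /(_ w); rewrite ezw /= => /eqP eC.
    apply/forallP => w'; apply/implyP => eww'; rewrite (same _ _ z eww').
      by rewrite closed_commonC eC.
    by rewrite e_sym.
  by have /forallP /(_ y') := hall x'; rewrite exy' (negbTE nC).
have [r er] : exists r : 'I_n, sv st vroot = r.+1.
  have := root_two inc; rewrite (_ : (_ == 0) = false) ?(gtn_eqF hr) // => /andP[h _].
  exact: ordP.
wlog rV : V1 V2 A1 A2 oj / r \notin V2.
  move=> H; case: (boolP (r \in V2)) => rV; last exact: H oj rV.
  apply: (H V2 V1 A2 A1); first exact: one_join_sym.
  by have [-> _ _ _ _] := one_join_separation e_sym e_conn oj; rewrite inE negbK.
have [_ [x [y [exy xV yV]]] crossC [x' [y' [exy' xV' nC]]] _] := one_join_separation e_sym e_conn oj.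
set C := A1 :|: A2 in crossC nC.
have crossC2 := crossing_sym e_sym crossC.
pose vside a := [exists i : 'I_n, (a == i.+1) && (i \in V2)].
have vsideE (i : 'I_n) : vside i.+1 = (i \in V2).
  apply/existsP/idP => [[j /andP[/eqP[/val_inj ->]]]//|h].
  by exists i; rewrite eqxx.
pose sigma a := if a <= n then vside a else
  [exists i : 'I_n, exists j : 'I_n, [&& e i j, i \in V2 & a == nd i j]].
have sigmaV (i : 'I_n) : sigma i.+1 = (i \in V2) by rewrite /sigma ltn_ord vsideE.
have sigmaN (i j : 'I_n) : e i j -> K i j != C -> sigma (nd i j) = (i \in V2).
  move=> eij nK; rewrite /sigma leqNgt node_gt //=; apply/existsP/idP; last first.
    by move=> hi; exists i; apply/existsP; exists j; rewrite eij hi eqxx.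
  case=> k /existsP[l /and3P[ekl kV /eqP /esym /eqP]]; rewrite node_eqP // => /eqP eK.
  apply: contraT => iV; case/negP: nK.
  have := class_one_side e_sym crossC exy xV yV ekl eij eK kV iV.
  by rewrite -eK => ->.
have ndF (i j : 'I_n) : e i j -> (nd i j != nd x y) = (K i j != C).
  by move=> eij; rewrite node_eqP // (crossC x y).
have adjV a b : E a b -> node n st a b != nd x y -> sigma a = sigma (node n st a b).
  case/lift_relP => i [j [-> -> eij]]; rewrite ndF // => nK.
  by rewrite sigmaN // sigmaV.
have := nosep hr (nd x y) sigma; rewrite er sigmaV (negbTE rV) => /(_ (node_gt exy) erefl).
have hadj a b : b \in incident n st a -> a != nd x y -> b != nd x y -> sigma a = sigma b.
  case/(mem_incident inc) => -[c [h ->]] h1 h2; first exact: adjV.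
  by rewrite -adjV.
move=> /(_ hadj x'.+1 y'.+1); rewrite lift_relE ndF // sigmaN // xV' => /(_ exy' nC).
by [].
Qed.

Lemma output_correct : finds_one_join e o \/ reports_no_one_join e o.
Proof.
have [_ _ [[-> h]|[-> h]] _ _] := fin; [right|left; exact: found_one_join].
by split=> //; apply: not_found_no_join.
Qed.

Lemma deg_le_max : forall a, av st aDeg a <= max_degree e + 1.
Proof.
move=> a; have [_ _ _ [[h0 h1] _] _] := fin.
case: (boolP (0 < a <= n)) => ha; last by rewrite h0.
have [uq mem] := h1 a ha; rewrite -(size_row (av st aNb) n.+1 a (av st aDeg a)).
have [i ei] := ordP ha.
apply: (@leq_trans (size (a :: [seq (j : 'I_n).+1 | j <- enum [set y | e i y]]))).
  apply: uniq_leq_size => // b; rewrite mem inE => /orP[->//|].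
  rewrite ei => /lift_relP[i1 [j [[/val_inj <-] -> eij]]].
  by apply/orP; right; apply/mapP; exists j; rewrite // mem_enum inE.
rewrite /= size_map -cardE addn1 ltnS /max_degree.
exact: (leq_bigmax (F := fun x => #|[set y | e x y]|) i).
Qed.

Lemma deg_sum : \sum_(1 <= a < n.+1) av st aDeg a = n + size s * 2.
Proof. by have [_ _ _ [_ ->] _] := fin; rewrite size_map. Qed.

Lemma order_bound : n <= size s * 2 + 1.
Proof.
case: (leqP n 1) => [|n2]; first by lia.
suff : n * 2 <= n + size s * 2 by lia.
have [_ _ _ [[_ h1] _] _] := fin.
rewrite -deg_sum -[X in X * 2 <= _]subn0 -subSS -sum_nat_const_nat.
rewrite big_nat [X in _ <= X]big_nat; apply: leq_sum => a ha.
have {}ha : 0 < a <= n by lia.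
have [uq mem] := h1 a ha; rewrite -(size_row (av st aNb) n.+1 a (av st aDeg a)).
have [i ei] := ordP ha.
have [k nki] : exists k : 'I_n, k != i.
  case: (eqVneq i (Ordinal (ltnW n2))) => [->|ne]; last by exists (Ordinal (ltnW n2)); rewrite eq_sym.
  by exists (Ordinal n2).
have [||u [w [euw /= /eqP eu nw]]] := connected_crossing (S := pred1 i) (x := i) (y := k) e_conn.
- by rewrite /= eqxx.
- by [].
rewrite eu in euw; apply: (@leq_trans (size [:: a; w.+1])) => //.
apply: uniq_leq_size; first by rewrite /= inE ei eqSS eq_sym -(inj_eq val_inj) /= in nw *; rewrite andbT.
move=> b; rewrite !inE mem => /orP[->//|/eqP ->].
by rewrite ei lift_relE euw orbT.
Qed.

Lemma time_bound : t <= 3000 * (num_edges e * (max_degree e + inv_ack (num_edges e) (max_degree e)) + 1).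
Proof.
have [_ _ _ _ /(_ _ deg_le_max)] := fin; rewrite size_map => ht.
have hn := order_bound; have hm := size_edges.
set M := num_edges e in hm *; set D := max_degree e in ht *.
apply: (@leq_trans (3000 * (M * D + 1))); last first.
  by rewrite leq_mul2l /= leq_add2r leq_mul2l leq_addr orbT.
case: (posnP (size s)) => [m0|m1].
  have D0 : D = 0.
    apply/eqP; rewrite -leqn0; apply/bigmax_leqP => x _; rewrite leqn0 cards_eq0.
    apply/eqP/setP => y; rewrite !inE; have := e_list x y.
    by rewrite (size0nil m0); case: (e x y).
  by move: ht hn; rewrite D0 m0; clear; nia.
have D1 : 0 < D.
  case: s e_list m1 => // p s' hl _; have ep : e p.1 p.2.
    have := hl p.1 p.2; rewrite /= -surjective_pairing eqxx; case: (e _ _) => //.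
  apply: leq_trans (leq_bigmax (F := fun x => #|[set y | e x y]|) p.1).
  by apply/card_gt0P; exists p.2; rewrite inE.
apply: leq_trans ht _; apply: (@leq_trans (3000 * (size s * D + 1))); last first.
  by rewrite leq_mul2l /= leq_add2r leq_mul2r hm orbT.
apply: (@leq_trans ((165 * D) * (5 * size s) + 65)); last by nia.
by rewrite leq_add2r; apply: leq_mul; lia.
Qed.

End Output.
End Translation.
Lemma bound_large n w : n < 2 ^ w -> 0 < w -> 8 * n.+1 ^ 3 <= 2 ^ (6 * w).
Proof.
move=> hn hw; rewrite (_ : 6 * w = 3 * w + w * 3) ?(expnD _ (3 * w)); last by lia.
have h8 : 2 ^ 3 <= 2 ^ (3 * w) by rewrite leq_exp2l // leq_pmulr.
apply: leq_mul; first exact: leq_trans h8.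
by rewrite expnM leq_exp2r.
Qed.

Theorem theorem17 :
  exists (P : program) (C : nat),
    forall (n : nat) (e : rel 'I_n) (s : seq ('I_n * 'I_n)),
      symmetric e -> irreflexive e -> connected_graph e -> edge_list e s ->
      exists (t : nat) (o : seq int),
        [/\ run (bitlen (Posz n)) P (start (graph_input s)) t o,
            t <= C * (num_edges e
                      * (max_degree e + inv_ack (num_edges e) (max_degree e))
                      + 1)
          & finds_one_join e o \/ reports_no_one_join e o].
Proof.
pose P := ccmd one_join_cmd 0; pose q := cmd_deg 6 one_join_cmd.
exists P, (4 * q * (size P * 3000) + 1) => n e s e_sym e_irr e_conn e_list.
have hw : 0 < bitlen (Posz n) by [].
have hn : n < 2 ^ bitlen (Posz n) by apply: trunc_log_ltn.
have [t [s' [hex [st fin]]]] := one_join_cmd_correct (lift_rel_sym e_sym) (lift_rel_irr e_irr)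
  (@lift_rel_bound n e) (count_lift_edges e_sym e_list) (bound_large hn hw) (lift_connected e_conn).
rewrite input_lift in hex.
have [T hrun hT] := run_compiled (q := q) wf_one_join (leqnn _) isT isT hw hex.
exists T, (so s'); split=> //; last exact: (output_correct e_sym e_conn fin).
have ht := time_bound e_irr e_conn e_list fin.
apply: leq_trans hT _; move: ht; set X := num_edges e * _ + 1 => ht.
have mono k p : k * (p * t) <= k * (p * 3000) * X by rewrite -!mulnA !leq_mul2l ht !orbT.
rewrite mulnDl mul1n; apply: leq_add; first exact: mono.
by rewrite /X addn1.
Qed.
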